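(* Let $d\in\mathbb{N}$, $\alpha\in(d-1,\infty)$ and $\Sigma\in\mathcal{S}_{++}^d$. Let $\mathfrak{W}\sim\mathcal{W}_d(\alpha,\Sigma)$ and let $$\mathfrak{Z}_{\alpha,\Sigma}:=\alpha\Sigma+\sqrt{2\alpha}\,\Sigma^{1/2}\,\frac{\mathfrak{G}+\mathfrak{G}^\top}{2}\,\Sigma^{1/2},$$ where $\mathfrak{G}$ is a $d\times d$ matrix of independent standard normal random variables. Let $\mu_{\mathfrak{W}}$ and $\mu_{\mathfrak{Z}_{\alpha,\Sigma}}$ denote the laws on $\mathcal{S}^d$ of $(\mathfrak{W}-\alpha\Sigma)/\sqrt\alpha$ and $(\mathfrak{Z}_{\alpha,\Sigma}-\alpha\Sigma)/\sqrt\alpha$, respectively. Then $$d^{\mathcal{S}}_{\mathrm{W}}(\mu_{\mathfrak{W}},\mu_{\mathfrak{Z}_{\alpha,\Sigma}})\le\frac1{\sqrt{\pi\alpha}}\,\|\Sigma^{-1}\|_2\,\sqrt{\{(d+2)\,\mathrm{tr}(\Sigma)^2+\|\Sigma\|_F^2\}\,\{\mathrm{tr}(\Sigma)^2+\|\Sigma\|_F^2\}}.$$ The $\alpha^{-1/2}$ rate in this bound is optimal.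
   Context: $\mathcal{S}^d$ and $\mathcal{S}_{++}^d$ are the sets of real symmetric and of real symmetric positive definite $d\times d$ matrices. $\mathrm{tr}$ is the trace, $\|A\|_F=\sqrt{\mathrm{tr}(A^\top A)}$ is the Frobenius norm, $\|\cdot\|_2$ the spectral norm, $|A|$ the determinant of a square matrix $A$, and $\Sigma^{1/2}$ the symmetric square root. For $\alpha\in(d-1,\infty)$ and $\Sigma\in\mathcal{S}_{++}^d$, the Wishart distribution $\mathcal{W}_d(\alpha,\Sigma)$ is the law on $\mathcal{S}_{++}^d$ with density (with respect to Lebesgue measure $\prod_{i\le j}\mathrm{d}X_{ij}$) $$X\mapsto\frac{|X|^{\alpha/2-(d+1)/2}\exp\{-\mathrm{tr}(\Sigma^{-1}X)/2\}}{|2\Sigma|^{\alpha/2}\,\Gamma_d(\alpha/2)},\qquad X\in\mathcal{S}_{++}^d,$$ where $\Gamma_d$ is the multivariate gamma function, $\Gamma_d(x)=\pi^{d(d-1)/4}\prod_{j=1}^d\Gamma(x-(j-1)/2)$. For probability measures $\mu,\nu$ on $\mathcal{S}^d$ with finite first moments, the Wasserstein distance is $$d^{\mathcal{S}}_{\mathrm{W}}(\mu,\nu):=\sup\Big\{\Big|\int h\,\mathrm{d}\mu-\int h\,\mathrm{d}\nu\Big|:\ h:\mathcal{S}^d\to\mathbb{R},\ |h(S)-h(T)|\le\|S-T\|_F\ \text{for all }S,T\in\mathcal{S}^d\Big\}.$$ *)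

(* Defs.v *)
From HB Require Import structures.
From mathcomp Require Import all_boot all_order all_algebra.
From mathcomp Require Import all_classical all_reals all_analysis.
From mathcomp Require Import measurable_realfun.

Set Implicit Arguments.
Unset Strict Implicit.
Unset Printing Implicit Defensive.
Import Order.TTheory GRing.Theory Num.Theory.
Import numFieldNormedType.Exports.
Local Open Scope classical_set_scope.
Local Open Scope ring_scope.

Section symmetric_matrices.
Context (R : realType) (d : nat).

Definition issymmx : {pred 'M[R]_d} := [pred A : 'M[R]_d | A^T == A].

Fact issymmx_submod_closed : submod_closed issymmx.
Proof.
split=> [|a A B]; rewrite !inE; first by rewrite trmx0.
by move=> /eqP hA /eqP hB; rewrite linearP /= hA hB.
Qed.

HB.instance Definition _ :=
  GRing.isSubmodClosed.Build R 'M[R]_d issymmx issymmx_submod_closed.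

Record symmx := SymMx { symmx_val :> 'M[R]_d ; symmxP : symmx_val \in issymmx }.

HB.instance Definition _ := [isSub for symmx_val].
HB.instance Definition _ := [Choice of symmx by <:].
HB.instance Definition _ := [SubChoice_isSubLmodule of symmx by <:].
HB.instance Definition _ := isPointed.Build symmx 0.

(* The sigma-algebra generated by the entries, i.e. the Borel sigma-algebra of
   the finite-dimensional space of symmetric matrices. *)
Definition symmx_entry_sets : set (set symmx) :=
  [set A | exists i j (B : set R),
     measurable B /\ A = [set S : symmx | B ((S : 'M[R]_d) i j)]].

HB.instance Definition _ := @isMeasurable.Build default_measure_display symmx
  <<s symmx_entry_sets >> (@sigma_algebra0 _ setT symmx_entry_sets)
  (@sigma_algebraC _ symmx_entry_sets)
  (@sigma_algebra_bigcup _ setT symmx_entry_sets).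

Lemma measurable_symmx_entry i j :
  measurable_fun [set: symmx] (fun S : symmx => (S : 'M[R]_d) i j).
Proof.
move=> _ B mB; rewrite setTI; apply: sub_sigma_algebra.
by exists i, j, B.
Qed.

Lemma measurable_fun_symmx dT (T : measurableType dT) (f : T -> symmx) :
  (forall i j, measurable_fun [set: T] (fun t => (f t : 'M[R]_d) i j)) ->
  measurable_fun [set: T] f.
Proof.
move=> mf; apply: (@measurability _ _ _ _ _ _ symmx_entry_sets) => //.
by move=> _ [_ [i [j [B [mB ->]]]] <-]; exact: mf.
Qed.

End symmetric_matrices.

Section matrix_notions.
Context (R : realType).

Definition frob_norm m n (A : 'M[R]_(m, n)) : R := Num.sqrt (\tr (A^T *m A)).

(* Operator norm for the Euclidean norm, which is [frob_norm] on columns. *)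
Definition spectral_norm m n (A : 'M[R]_(m, n)) : R :=
  sup [set frob_norm (A *m x) | x in [set x : 'cV[R]_n | frob_norm x = 1]].

Definition posdefmx d (S : symmx R d) : Prop :=
  forall x : 'cV[R]_d, x != 0 -> 0 < (x^T *m S *m x) 0 0.

(* The (unique) positive definite square root of a positive definite matrix. *)
Definition sqrt_symmx d (S : symmx R d) : symmx R d :=
  xget 0 [set Q : symmx R d | posdefmx Q /\ (Q : 'M[R]_d) *m Q = S].

Fact sympart_subproof d (A : 'M[R]_d) : 2^-1 *: (A + A^T) \in @issymmx R d.
Proof. by rewrite inE linearZ /= linearD /= trmxK addrC. Qed.

Definition sympart d (A : 'M[R]_d) : symmx R d := SymMx (sympart_subproof A).

Fact symconj_subproof d (Q S : symmx R d) :
  (Q : 'M[R]_d) *m S *m Q \in @issymmx R d.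
Proof.
have /eqP hQ : (Q : 'M[R]_d)^T == Q by exact: (symmxP Q).
have /eqP hS : (S : 'M[R]_d)^T == S by exact: (symmxP S).
by rewrite inE !trmx_mul hQ hS mulmxA.
Qed.

Definition symconj d (Q S : symmx R d) : symmx R d :=
  SymMx (symconj_subproof Q S).

End matrix_notions.

Section power_measure.
Context d (T : measurableType d) (R : realType).
Local Open Scope ereal_scope.

Definition tuple_cons n (p : T * n.-tuple T) : n.+1.-tuple T :=
  [tuple of p.1 :: p.2].

Lemma measurable_tuple_cons n :
  measurable_fun [set: T * n.-tuple T] (@tuple_cons n).
Proof. exact: measurable_cons. Qed.

HB.instance Definition _ n :=
  isMeasurableFun.Build _ _ _ _ (@tuple_cons n) (@measurable_tuple_cons n).

Definition tuple_uncons n (t : n.+1.-tuple T) : T * n.-tuple T :=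
  (tnth t ord0, [tuple of behead t]).

Lemma measurable_tuple_uncons n :
  measurable_fun [set: n.+1.-tuple T] (@tuple_uncons n).
Proof.
by apply: measurable_fun_pair; [exact: measurable_tnth|exact: measurable_behead].
Qed.

Lemma tuple_consK n : cancel (@tuple_cons n) (@tuple_uncons n).
Proof.
move=> [x t]; rewrite /tuple_uncons /tuple_cons /=; congr pair.
by apply: val_inj.
Qed.

Variable mu : {sigma_finite_measure set T -> \bar R}.

Section step.
Variables (n : nat) (m : {sigma_finite_measure set (n.-tuple T) -> \bar R}).

Definition power_step : set (n.+1.-tuple T) -> \bar R :=
  pushforward (mu \x m) (@tuple_cons n).

Let power_step0 : power_step set0 = 0.
Proof. by rewrite /power_step /pushforward preimage_set0 measure0. Qed.

Let power_step_ge0 A : 0 <= power_step A.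
Proof. by rewrite /power_step /pushforward measure_ge0. Qed.

Let power_step_sigma_additive : semi_sigma_additive power_step.
Proof.
exact: (@measure_semi_sigma_additive _ _ _
  (pushforward (mu \x m) (@tuple_cons n))).
Qed.

HB.instance Definition _ := isMeasure.Build _ _ _ power_step
  power_step0 power_step_ge0 power_step_sigma_additive.

Let power_step_sigma_finite : sigma_finite setT power_step.
Proof.
have [F FT Ffin] : sigma_finite setT (mu \x m).
  have /sigma_finiteP[F [TF ndF Foo]] := sigma_finiteT mu.
  have /sigma_finiteP[G [TG ndG Goo]] := sigma_finiteT m.
  exists (fun k => F k `*` G k).
    rewrite -setXTT TF TG predeqE => -[x y]; split=> [|[k _ []]] /=.
      move=> [[i _ Fx] [j _ Gy]]; exists (maxn i j) => //; split.
        by move: x Fx; exact/subsetPset/ndF/leq_maxl.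
      by move: y Gy; exact/subsetPset/ndG/leq_maxr.
    by move=> Fx Gy; split; exists k.
  move=> k; have [mF Fk] := Foo k; have [mG Gk] := Goo k.
  split; first exact: measurableX.
  by rewrite product_measure1E// lte_mul_pinfty// ge0_fin_numE.
exists (fun k => @tuple_uncons n @^-1` F k).
  by rewrite -preimage_bigcup -FT preimage_setT.
move=> k; have [mF Foo] := Ffin k; split.
  by rewrite -[X in measurable X]setTI; exact: measurable_tuple_uncons.
rewrite /power_step /pushforward -comp_preimage.
rewrite (_ : _ \o _ = idfun) ?preimage_id//.
by apply/funext => p /=; rewrite tuple_consK.
Qed.

HB.instance Definition _ := Measure_isSigmaFinite.Build _ _ _ power_step
  power_step_sigma_finite.

End step.

(* The product measure mu \x ... \x mu on [n.-tuple T]. *)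
Fixpoint power_measure n : {sigma_finite_measure set (n.-tuple T) -> \bar R} :=
  if n is k.+1 return {sigma_finite_measure set (n.-tuple T) -> \bar R}
  then power_step (power_measure k)
  else \d_([tuple] : 0.-tuple T).

End power_measure.

Section lebesgue_symmx.
Context (R : realType) (d : nat).

Definition upper_pairs : seq ('I_d * 'I_d) :=
  [seq p : 'I_d * 'I_d <- enum {: 'I_d * 'I_d} | (p.1 <= p.2)%N].

Definition upper_pair (i j : 'I_d) : 'I_d * 'I_d :=
  if (i <= j)%N then (i, j) else (j, i).

Fact symmx_of_upper_subproof (v : (size upper_pairs).-tuple (measurableTypeR R)) :
  \matrix_(i, j) nth (0 : R) v (index (upper_pair i j) upper_pairs) \in @issymmx R d.
Proof.
rewrite inE; apply/eqP/matrixP => i j; rewrite !mxE /upper_pair.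
by case: (ltngtP i j) => // /val_inj ->.
Qed.

(* The symmetric matrix whose entries on and above the diagonal are listed by
   v, in the order of [upper_pairs]. *)
Definition symmx_of_upper (v : (size upper_pairs).-tuple (measurableTypeR R)) : symmx R d :=
  SymMx (symmx_of_upper_subproof v).

Lemma measurable_symmx_of_upper :
  measurable_fun [set: (size upper_pairs).-tuple (measurableTypeR R)] symmx_of_upper.
Proof.
apply: measurable_fun_symmx => i j.
under eq_fun do rewrite mxE.
set k := index _ _.
have hk : (k < size upper_pairs)%N.
  rewrite index_mem mem_filter mem_enum andbT /upper_pair.
  by case: ifPn => //=; rewrite -ltnNge => /ltnW.
under eq_fun do rewrite -[k]/(val (Ordinal hk)) -tnth_nth.
exact: measurable_tnth.
Qed.

HB.instance Definition _ :=
  isMeasurableFun.Build _ _ _ _ symmx_of_upper measurable_symmx_of_upper.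

(* prod_(i <= j) dX_ij *)
Definition lebesgue_symmx : set (symmx R d) -> \bar R :=
  pushforward (power_measure (@lebesgue_measure R) (size upper_pairs))
    symmx_of_upper.

Let lebesgue_symmx0 : lebesgue_symmx set0 = 0%E.
Proof. by rewrite /lebesgue_symmx /pushforward preimage_set0 measure0. Qed.

Let lebesgue_symmx_ge0 A : (0 <= lebesgue_symmx A)%E.
Proof. by rewrite /lebesgue_symmx /pushforward measure_ge0. Qed.

Let lebesgue_symmx_sigma_additive : semi_sigma_additive lebesgue_symmx.
Proof.
exact: (@measure_semi_sigma_additive _ _ _
  (pushforward (power_measure (@lebesgue_measure R) _) symmx_of_upper)).
Qed.

HB.instance Definition _ := isMeasure.Build _ _ _ lebesgue_symmx
  lebesgue_symmx0 lebesgue_symmx_ge0 lebesgue_symmx_sigma_additive.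

End lebesgue_symmx.

Section wishart.
Context (R : realType).

Definition Gamma (x : R) : R :=
  \int[lebesgue_measure]_(t in `]0, +oo[) (t `^ (x - 1) * expR (- t)).

Definition mvGamma (d : nat) (x : R) : R :=
  pi `^ (d%:R * (d%:R - 1) / 4) *
  \prod_(1 <= j < d.+1) Gamma (x - (j%:R - 1) / 2).

Definition wishart_pdf d (alpha : R) (Sigma X : symmx R d) : R :=
  \det X `^ (alpha / 2 - (d%:R + 1) / 2) *
  expR (- \tr (invmx Sigma *m X) / 2) /
  (\det (2 *: (Sigma : 'M[R]_d)) `^ (alpha / 2) * mvGamma d (alpha / 2)).

Definition wishart_distributed d (alpha : R) (Sigma : symmx R d)
    dT (T : measurableType dT) (P : probability T R)
    (W : {RV P >-> symmx R d}) : Prop :=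
  forall A : set (symmx R d), measurable A ->
    distribution P W A =
    (\int[@lebesgue_symmx R d]_(X in A `&` [set X | posdefmx X])
       (wishart_pdf alpha Sigma X)%:E)%E.

End wishart.
Arguments wishart_distributed {R d} alpha Sigma {dT T} P W.

Section gaussian.
Context (R : realType) dT (T : measurableType dT) (P : probability T R).

Definition mutually_independent (I : finType) (X : I -> {RV P >-> R}) : Prop :=
  forall (J : {set I}) (B : I -> set R), (forall i, measurable (B i)) ->
    P (\bigcap_(i in [set i | i \in J]) (X i @^-1` B i)) =
    (\prod_(i in J) P (X i @^-1` B i))%E.

Definition standard_normal (X : {RV P >-> R}) : Prop :=
  forall B : set R, measurable B -> distribution P X B = normal_prob 0 1 B.

Definition ginibre d (G : 'I_d -> 'I_d -> {RV P >-> R}) : Prop :=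
  (forall i j, standard_normal (G i j)) /\
  mutually_independent (fun p : 'I_d * 'I_d => G p.1 p.2).

End gaussian.
Arguments ginibre {R dT T} P {d} G.

Section gaussian_Z.
Context (R : realType) dT (T : measurableType dT).
Variables (d : nat) (alpha : R) (Sigma : symmx R d).
Variable G : 'I_d -> 'I_d -> {mfun T >-> R}.

Definition gaussian_Z (t : T) : symmx R d :=
  alpha *: Sigma +
  Num.sqrt (2 * alpha) *:
    symconj (sqrt_symmx Sigma) (sympart (\matrix_(i, j) G i j t)).

Lemma measurable_gaussian_Z : measurable_fun [set: T] gaussian_Z.
Proof.
apply: measurable_fun_symmx => i j.
rewrite /gaussian_Z; under eq_fun do rewrite /= !mxE.
apply: measurable_funD => //; apply: measurable_funM => //.
apply: measurable_sum => k; under eq_fun do rewrite mxE.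
apply: measurable_funM => //; apply: measurable_sum => l.
under eq_fun do rewrite !mxE.
by apply: measurable_funM => //; apply: measurable_funM => //;
  apply: measurable_funD.
Qed.

HB.instance Definition _ :=
  isMeasurableFun.Build _ _ _ _ gaussian_Z measurable_gaussian_Z.

End gaussian_Z.

Section center_scale.
Context (R : realType) dT (T : measurableType dT).
Variables (d : nat) (alpha : R) (Sigma : symmx R d) (X : {mfun T >-> symmx R d}).

Definition center_scale (t : T) : symmx R d :=
  (Num.sqrt alpha)^-1 *: (X t - alpha *: Sigma).

Lemma measurable_center_scale : measurable_fun [set: T] center_scale.
Proof.
apply: measurable_fun_symmx => i j.
rewrite /center_scale; under eq_fun do rewrite /= !mxE.
apply: measurable_funM => //; apply: measurable_funB => //.
exact: (measurableT_comp (@measurable_symmx_entry R d i j)).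
Qed.

HB.instance Definition _ :=
  isMeasurableFun.Build _ _ _ _ center_scale measurable_center_scale.

End center_scale.

(* The integrals are extended reals, so this is meaningful for mu and nu with
   finite first moments; were h not integrable, the difference of integrals
   would be infinite rather than collapse to a default value. *)
Definition wasserstein (R : realType) (d : nat)
    (mu nu : probability (symmx R d) R) : \bar R :=
  ereal_sup
    [set `| \int[mu]_S (h S)%:E - \int[nu]_S (h S)%:E |%E |
       h in [set h : symmx R d -> R |
         forall S T : symmx R d,
           `|h S - h T| <= frob_norm ((S : 'M[R]_d) - T)]].

(* Main.v *)
(** The Wishart law W_d(alpha, Sigma) and the Gaussian law of Z both satisfy an
integration by parts formula.  For the Wishart law it comes from
differentiating, at the identity, the change of variables S |-> B^T S B, where
B is a transvection 1 + x E_ij; summing over (i, j) gives, for every matrix M,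
  E Df(W)[W M + M^T W] = E f(W) (tr (Sigma^-1 W M) - alpha tr M).
The Gaussian formula is obtained from translations in the same way.

Let X = (W - alpha Sigma) / sqrt alpha and let Z be the centered Gaussian
matrix, independent of X.  For a smooth Lipschitz g, differentiate
theta |-> E g (sin theta X + cos theta Z) along the quarter circle.  With
M = Sigma^-1 Z / 2 the two formulas have the same right-hand side, so that all
terms cancel but one, and the derivative is
  (sin theta / sqrt alpha) E Dg[(X Sigma^-1 Z + Z Sigma^-1 X) / 2].
Integrating, the distance is at most E |X Sigma^-1 Z|_F / sqrt alpha.  General
Lipschitz functions are reached by convolving with a small multiple of Z.  The
expectation is bounded by Cauchy-Schwarz and second moments, which follow from
the same formulas; in dimension one the exact value of E |N(0,1)| is needed.

For the optimality of the rate, write T(S) = tr (Sigma^-1 S), q(x) = 1/(1+x^2)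
and p(x) = x q(x).  The two formulas applied to q(T) show that
p(T) + 4 d p(T) q(T) has mean 0 under Z and mean -(4/sqrt alpha) E p(T)^2 under
X.  Either E p(T)^2 itself changes by a constant amount, or the first
expectation changes by a constant times 1/sqrt alpha. *)

Require Import Defs.
From HB Require Import structures.
From mathcomp Require Import all_boot all_order all_algebra.
From mathcomp Require Import all_classical all_reals all_analysis.
From mathcomp Require Import measurable_realfun ring lra.
From mathcomp.real_closed Require complex.

Set Implicit Arguments.
Unset Strict Implicit.
Unset Printing Implicit Defensive.
Import Order.TTheory GRing.Theory Num.Theory.
Import numFieldNormedType.Exports.
Local Open Scope classical_set_scope.
Local Open Scope ring_scope.

(** * Positive definite matrices *)

(** Rotating X into Z along a quarter circle keeps the theta-derivative of first order in g, which
    is what a Lipschitz bound controls, and the weight sin theta has total mass 1 there. The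
    cancellation rests on a symmetry: the weight attached to X moved along Z, and the one attached
    to Z moved along X, are both tr (Sigma^-1 X Sigma^-1 Z) / 2.

    Transvections serve two purposes. Their Jacobian on symmetric matrices can be computed one entry
    at a time by Fubini, and their derivatives at the identity are the matrix units, which span all
    M. Differentiating under the integral needs a dominating function; it comes from an exponential
    moment of W, read off the total mass 1 of the density after rescaling S.

    For optimality, the mean of p(T)^2 under X is never computed. Two test functions are played
    against each other so that this unknown is eliminated, and only the positivity of the Gaussian
    mean of p(T)^2 enters the constant. *)

Section square_root.
Context (R : realType).

(** Newton's scheme: a new node is fitted by adding a multiple of the polynomial that vanishes on
    the old ones. Applied to roots of eigenvalues, it makes the square root of a matrix a polynomial
    in that matrix, hence symmetric. *)
Lemma interpolating_poly (f : R -> R) (s : seq R) :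
  exists p : {poly R}, forall x, x \in s -> p.[x] = f x.
Proof.
elim: s => [|a s [p hp]]; first by exists 0.
have [as_|as_] := boolP (a \in s).
  by exists p => x; rewrite inE => /predU1P[->|]; exact: hp.
pose w : {poly R} := \prod_(b <- s) ('X - b%:P).
have wa : w.[a] != 0.
  by rewrite -rootE root_prod_XsubC.
exists (p + ((f a - p.[a]) / w.[a]) *: w) => x; rewrite inE => /predU1P[->|xs].
  by rewrite hornerD hornerZ divfK// addrC subrK.
have : root w x by rewrite root_prod_XsubC.
by rewrite rootE hornerD hornerZ => /eqP ->; rewrite mulr0 addr0 hp.
Qed.

Lemma trmx_horner_mx n (S : 'M[R]_n.+1) (p : {poly R}) :
  S^T = S -> (horner_mx S p)^T = horner_mx S p.
Proof.
move=> hS; elim/poly_ind: p => [|p c IH]; first by rewrite rmorph0 trmx0.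
rewrite rmorphD rmorphM /= horner_mx_X horner_mx_C linearD /= tr_scalar_mx.
congr (_ + _); rewrite -mulmxE trmx_mul IH hS.
exact: comm_mx_horner.
Qed.

(** The unitary diagonalization lives over a closed field [C]; only its consequence for real
    polynomials in [S] is brought back along [rc], the spectrum of a Hermitian matrix being real. *)
Lemma spectral_annihilation_of (C : numClosedFieldType) (rc : {rmorphism R -> C})
    (rc_real : forall x, rc x \is Num.real)
    (rc_surj : forall z, z \is Num.real -> exists x, z = rc x) n (S : 'M[R]_n.+1) :
  S^T = S -> exists s : seq R, all (eigenvalue S) s /\
    forall p : {poly R}, (forall x, x \in s -> p.[x] = 0) -> horner_mx S p = 0.
Proof.
move=> hS; pose SC := map_mx rc S.
have SCh : SC \is hermsymmx.
  apply/realsym_hermsym.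
    apply/is_hermitianmxP; rewrite expr0 scale1r map_mx_id//.
    by rewrite /SC map_trmx hS.
  by apply/mxOverP => i j; rewrite mxE.
have /orthomx_spectralP SCE := hermitian_normalmx SCh.
have Dreal := hermitian_spectral_diag_real SCh.
have Uu := spectral_unit SC.
set U := spectralmx SC in SCE Uu; set D := spectral_diag SC in SCE Dreal.
have hD i : exists x, D 0 i = rc x.
  by apply: rc_surj; move/mxOverP: Dreal; apply.
pose l i := projT1 (cid (hD i)).
have lE i : D 0 i = rc (l i) by rewrite /l; case: cid.
exists [seq l i | i <- enum 'I_n.+1]; split.
  apply/allP => _ /mapP[i _ ->].
  rewrite eigenvalue_root_char -(fmorph_root rc) map_char_poly -eigenvalue_root_char.
  apply/eigenvalueP; exists (row i U); last first.
    (* The rows of the unitary matrix are the eigenvectors; a zero row would make its determinant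
       vanish. *)
    apply: contraTneq Uu => Ui; rewrite unitmxE (expand_det_row _ i) big1 ?unitr0//.
    by move=> j _; move/rowP/(_ j): Ui; rewrite !mxE => ->; rewrite mul0r.
  rewrite -/SC SCE -row_mul -!mulmxA mulKVmx// row_mul.
  by rewrite -row_mul mul_diag_mx; apply/rowP => j; rewrite !mxE lE.
move=> p hp; apply/(map_mx_inj (f := rc)); rewrite map_horner_mx map_mx0.
rewrite -/SC SCE horner_mx_uconjC// horner_mx_diag.
rewrite (_ : map_mx _ D = 0) ?linear0 ?mulmx0 ?mul0mx//.
apply/rowP => i; rewrite !mxE lE horner_map hp ?rmorph0//.
by apply/mapP; exists i => //; rewrite mem_enum.
Qed.

End square_root.

(* A module, so that the names and coercions imported from [complex] stay local. *)
Module RealSpectral.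
Import complex.
Section spectral.
Context (R : realType).

Lemma spectral_annihilation n (S : 'M[R]_n.+1) :
  S^T = S -> exists s : seq R, all (eigenvalue S) s /\
    forall p : {poly R}, (forall x, x \in s -> p.[x] = 0) -> horner_mx S p = 0.
Proof.
have real_c (x : R) : (complex.real_complex R x : complex.complex R) \is Num.real.
  by rewrite complex.complex_real.
have real_s (z : complex.complex R) : z \is Num.real -> exists x, z = complex.real_complex R x.
  by move=> /complex.complex_realP[x ->]; exists x.
exact: (@spectral_annihilation_of R _ (complex.real_complex R) real_c real_s n S).
Qed.

End spectral.
End RealSpectral.
Import RealSpectral.

Section square_root_pd.
Context (R : realType).

(** [posdefmx] freed from the bundled symmetry, for matrices that are not yet of type [symmx]. On
    elements of [symmx] the two are convertible. *)
Definition pdmx n (S : 'M[R]_n) := forall x : 'cV[R]_n, x != 0 -> 0 < (x^T *m S *m x) 0 0.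

Lemma sqr_col_gt0 n (x : 'cV[R]_n) : x != 0 -> 0 < (x^T *m x) 0 0.
Proof.
move=> x0; rewrite mxE lt_neqAle sumr_ge0 ?andbT; last first.
  by move=> i _; rewrite mxE -expr2 sqr_ge0.
apply: contra x0; rewrite eq_sym psumr_eq0; last first.
  by move=> i _; rewrite mxE -expr2 sqr_ge0.
move=> /allP h; apply/eqP/colP => i; rewrite mxE.
by have /implyP/(_ isT) := h i (mem_index_enum _); rewrite mxE -expr2 sqrf_eq0 => /eqP.
Qed.

Lemma sqrt_pdmx n (S : 'M[R]_n.+1) : S^T = S -> pdmx S ->
  exists Q, [/\ Q^T = Q, pdmx Q & Q *m Q = S].
Proof.
move=> hS pS; have [s [/allP es an]] := spectral_annihilation hS.
have s0 x : x \in s -> 0 < x.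
  move=> /es /eigenvalueP[v vS v0].
  have vT0 : v^T != 0 by rewrite trmx_eq0.
  have := pS _ vT0; rewrite trmxK vS -scalemxAl mxE pmulr_lgt0//.
  by have := sqr_col_gt0 vT0; rewrite trmxK.
(* Fourth roots are interpolated, so that the square root arises as V V = V^T V, whose positivity
   needs no further argument on the spectrum. *)
have [r hr] := interpolating_poly (fun x => Num.sqrt (Num.sqrt x)) s.
pose V := horner_mx S r.
have VT : V^T = V by exact: trmx_horner_mx.
have V4 : (V *m V) *m (V *m V) = S.
  apply/eqP; rewrite -subr_eq0; apply/eqP.
  have <- : horner_mx S (r * r * (r * r) - 'X) = V *m V *m (V *m V) - S.
    by rewrite rmorphB !rmorphM /= horner_mx_X.
  apply: an => x xs; rewrite hornerD hornerN !hornerM hornerX hr//.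
  rewrite -!expr2 !sqr_sqrtr ?subrr ?sqrtr_ge0//; exact/ltW/s0.
exists (V *m V); split => //; first by rewrite trmx_mul VT.
move=> x x0; rewrite mulmxA -mulmxA -{1}VT -trmx_mul.
apply: sqr_col_gt0; apply: contraTneq (pS _ x0) => Vx0.
by rewrite -V4 -!mulmxA Vx0 !mulmx0 mxE ltxx.
Qed.

End square_root_pd.

(** * Frobenius and spectral norms *)

Section frobenius.
Context (R : realType).

(** Lagrange's identity: the difference of the two sides is half the sum of the squares of all a_i
    b_j - a_j b_i. *)
Lemma sum_cauchy_schwarz (I : finType) (a b : I -> R) :
  (\sum_i a i * b i) ^+ 2 <= (\sum_i a i ^+ 2) * (\sum_i b i ^+ 2).
Proof.
have key : 0 <= \sum_i \sum_j (a i * b j - a j * b i) ^+ 2.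
  by apply: sumr_ge0 => i _; apply: sumr_ge0 => j _; exact: sqr_ge0.
have : \sum_i \sum_j (a i * b j - a j * b i) ^+ 2 =
    (\sum_i a i ^+ 2) * (\sum_i b i ^+ 2) + (\sum_i a i ^+ 2) * (\sum_i b i ^+ 2)
    - ((\sum_i a i * b i) ^+ 2) *+ 2.
  rewrite -mulr_natl expr2 !big_distrlr /=.
  rewrite [X in _ = _ + X - _]exchange_big /= mulr_sumr -big_split -sumrB /=.
  apply: eq_bigr => i _; rewrite mulr_sumr -big_split -sumrB /=.
  by apply: eq_bigr => j _; ring.
move=> E; move: key; rewrite E -mulr2n -mulrnBl pmulrn_lge0// subr_ge0.
exact.
Qed.

Lemma frob_norm_ge0 m n (A : 'M[R]_(m, n)) : 0 <= frob_norm A.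
Proof. exact: sqrtr_ge0. Qed.

Lemma mxtrace_mulTmx m n (A B : 'M[R]_(m, n)) :
  \tr (A^T *m B) = \sum_(p : 'I_m * 'I_n) A p.1 p.2 * B p.1 p.2.
Proof.
rewrite /mxtrace; under eq_bigr do rewrite mxE.
rewrite exchange_big /= pair_big /=; apply: eq_bigr => p _.
by rewrite mxE.
Qed.

Lemma sqr_frob_norm m n (A : 'M[R]_(m, n)) : frob_norm A ^+ 2 = \tr (A^T *m A).
Proof.
rewrite sqr_sqrtr// mxtrace_mulTmx sumr_ge0// => p _.
by rewrite -expr2 sqr_ge0.
Qed.

Lemma sqr_frob_normE m n (A : 'M[R]_(m, n)) :
  frob_norm A ^+ 2 = \sum_i \sum_j A i j ^+ 2.
Proof. by rewrite sqr_frob_norm mxtrace_mulTmx pair_big. Qed.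

Lemma ler_frob m n p q (A : 'M[R]_(m, n)) (B : 'M[R]_(p, q)) (k : R) : 0 <= k ->
  frob_norm A ^+ 2 <= k ^+ 2 * frob_norm B ^+ 2 -> frob_norm A <= k * frob_norm B.
Proof.
move=> k0; rewrite -exprMn ler_sqr//; rewrite nnegrE ?mulr_ge0 ?frob_norm_ge0//.
Qed.

Lemma mxtrace_mul_le m n (A B : 'M[R]_(m, n)) :
  `|\tr (A^T *m B)| <= frob_norm A * frob_norm B.
Proof.
rewrite -ler_sqr ?nnegrE ?mulr_ge0 ?frob_norm_ge0 ?normr_ge0//.
rewrite real_normK ?num_real// exprMn !sqr_frob_norm !mxtrace_mulTmx.
exact: (@sum_cauchy_schwarz ('I_m * 'I_n)%type (fun p => A p.1 p.2) (fun p => B p.1 p.2)).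
Qed.

Lemma frob_normD m n (A B : 'M[R]_(m, n)) :
  frob_norm (A + B) <= frob_norm A + frob_norm B.
Proof.
rewrite -ler_sqr ?nnegrE ?addr_ge0 ?frob_norm_ge0// sqrrD !sqr_frob_norm.
rewrite [in (A + B)^T]linearD /= mulmxDl !mulmxDr !raddfD /=.
have -> : \tr (B^T *m A) = \tr (A^T *m B).
  by rewrite -mxtrace_tr trmx_mul trmxK.
have := le_trans (ler_norm _) (mxtrace_mul_le A B); lra.
Qed.

Lemma frob_normZ m n (k : R) (A : 'M[R]_(m, n)) :
  frob_norm (k *: A) = `|k| * frob_norm A.
Proof.
rewrite /frob_norm [in (k *: A)^T]linearZ /= -scalemxAl -scalemxAr scalerA linearZ /=.
by rewrite -expr2 sqrtrM ?sqr_ge0// sqrtr_sqr.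
Qed.

Lemma frob_normN m n (A : 'M[R]_(m, n)) : frob_norm (- A) = frob_norm A.
Proof. by rewrite -scaleN1r frob_normZ normrN1 mul1r. Qed.

Lemma frob_normBC m n (A B : 'M[R]_(m, n)) : frob_norm (A - B) = frob_norm (B - A).
Proof. by rewrite -opprB frob_normN. Qed.

Lemma frob_norm0 m n : frob_norm (0 : 'M[R]_(m, n)) = 0.
Proof. by rewrite -(scale0r 0) frob_normZ normr0 mul0r. Qed.

Lemma frob_norm_tr m n (A : 'M[R]_(m, n)) : frob_norm A^T = frob_norm A.
Proof. by rewrite /frob_norm trmxK mxtrace_mulC. Qed.

Lemma le_frob_norm m n (A : 'M[R]_(m, n)) i j : `|A i j| <= frob_norm A.
Proof.
rewrite -ler_sqr ?nnegrE ?frob_norm_ge0 ?normr_ge0// real_normK ?num_real//.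
rewrite sqr_frob_normE (bigD1 i)//= (bigD1 j)//= -addrA lerDl addr_ge0//.
  by apply: sumr_ge0 => k _; exact: sqr_ge0.
by apply: sumr_ge0 => k _; apply: sumr_ge0 => l _; exact: sqr_ge0.
Qed.

Lemma frob_norm_le_sum m n (A : 'M[R]_(m, n)) :
  frob_norm A <= \sum_i \sum_j `|A i j|.
Proof.
rewrite {1}(matrix_sum_delta A).
have frob_sum (I : finType) (F : I -> 'M[R]_(m, n)) :
    frob_norm (\sum_i F i) <= \sum_i frob_norm (F i).
  elim/big_rec2: _ => [|i x y _ h]; first by rewrite frob_norm0.
  by rewrite (le_trans (frob_normD _ _))// lerD.
apply: (le_trans (frob_sum _ _)); apply: ler_sum => i _.
apply: (le_trans (frob_sum _ _)); apply: ler_sum => j _.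
rewrite frob_normZ -[leRHS]mulr1 ler_wpM2l//.
rewrite -(@ler_sqr R) ?nnegrE ?frob_norm_ge0// sqr_frob_normE expr1n.
rewrite (bigD1 i)//= (bigD1 j)//= mxE !eqxx /= expr1n big1 ?addr0; last first.
  by move=> k /negPf kj; rewrite mxE kj andbF expr0n.
rewrite big1 ?addr0// => k /negPf ki; rewrite big1// => l _.
by rewrite mxE ki expr0n.
Qed.

Lemma frob_normM m n p (A : 'M[R]_(m, n)) (B : 'M[R]_(n, p)) :
  frob_norm (A *m B) <= frob_norm A * frob_norm B.
Proof.
rewrite -ler_sqr ?nnegrE ?mulr_ge0 ?frob_norm_ge0// exprMn.
rewrite -[in leRHS](frob_norm_tr B) !sqr_frob_normE big_distrlr /=.
apply: ler_sum => i _; apply: ler_sum => j _; rewrite mxE.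
rewrite (le_trans (sum_cauchy_schwarz _ _))//.
by under [X in _ <= _ * X]eq_bigr do rewrite mxE.
Qed.

Lemma frob_norm_col m n (A : 'M[R]_(m, n)) :
  frob_norm A ^+ 2 = \sum_j frob_norm (col j A) ^+ 2.
Proof.
rewrite sqr_frob_normE exchange_big /=; apply: eq_bigr => j _.
rewrite sqr_frob_normE; apply: eq_bigr => i _.
by rewrite big_ord1 mxE.
Qed.

Lemma rat_mx_approx m n (A : 'M[R]_(m, n)) (e : R) : 0 < e ->
  exists K : 'M[rat]_(m, n), frob_norm (A - map_mx ratr K) < e.
Proof.
(* The summand 1 keeps [N] positive for empty matrices and makes the last inequality strict. *)
move=> e0; pose N : R := (m * n)%:R + 1.
have N0 : 0 < N by rewrite ltr_wpDl.
have eN : 0 < e / N by rewrite divr_gt0.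
have K i j : {q : rat | `|A i j - ratr q| < e / N}.
  apply: cid; have [|q] := @rat_in_itvoo R (A i j - e / N) (A i j + e / N).
    by rewrite ltrBlDr -addrA ltrDl addr_gt0.
  rewrite in_itv /= => /andP[q1 q2]; exists q.
  by rewrite distrC ltr_distl q1 q2.
exists (\matrix_(i, j) projT1 (K i j)).
apply: (le_lt_trans (frob_norm_le_sum _)).
apply: (@le_lt_trans _ _ (\sum_(i < m) \sum_(j < n) (e / N))).
  apply: ler_sum => i _; apply: ler_sum => j _; rewrite !mxE.
  by case: (K i j) => q /= /ltW.
rewrite !sumr_const !card_ord -mulrnA -mulr_natr mulrAC.
by rewrite ltr_pdivrMr// ltr_pM2l// mulnC ltrDl.
Qed.

End frobenius.

Section spectral_norm.
Context (R : realType) (n : nat) (M : 'M[R]_n).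

Lemma frob_norm_eq0 m p (A : 'M[R]_(m, p)) : frob_norm A = 0 -> A = 0.
Proof.
move=> A0; apply/matrixP => i j; apply/eqP; rewrite mxE -normr_le0 -A0.
exact: le_frob_norm.
Qed.

Lemma le_spectral_norm (x : 'cV[R]_n) :
  frob_norm (M *m x) <= spectral_norm M * frob_norm x.
Proof.
have [x0|x0] := eqVneq (frob_norm x) 0.
  by rewrite x0 mulr0 (frob_norm_eq0 x0) mulmx0 frob_norm0.
have x1 : 0 < frob_norm x by rewrite lt_neqAle eq_sym x0 frob_norm_ge0.
pose y := (frob_norm x)^-1 *: x.
have xE : x = frob_norm x *: y by rewrite scalerA divff// scale1r.
have y1 : frob_norm y = 1.
  by rewrite frob_normZ ger0_norm ?invr_ge0 ?frob_norm_ge0// mulVf.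
move: y xE y1 => y xE y1.
rewrite [in leLHS]xE -scalemxAr frob_normZ ger0_norm ?frob_norm_ge0// mulrC.
rewrite ler_wpM2r ?frob_norm_ge0//.
apply: ub_le_sup; last by exists y.
(* The Frobenius norm of [M] bounds the set under the [sup], which is therefore a true supremum. *)
exists (frob_norm M) => _ [z /= z1 <-].
by rewrite (le_trans (frob_normM _ _))// z1 mulr1.
Qed.

Lemma le_spectral_norm_mul m (A : 'M[R]_(n, m)) : 0 <= spectral_norm M ->
  frob_norm (M *m A) <= spectral_norm M * frob_norm A.
Proof.
move=> s0; apply: ler_frob => //; rewrite !frob_norm_col mulr_sumr.
apply: ler_sum => j _; rewrite [col j (M *m A)]colE -mulmxA -colE -exprMn ler_sqr ?le_spectral_norm//.
  by rewrite nnegrE frob_norm_ge0.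
by rewrite nnegrE mulr_ge0// frob_norm_ge0.
Qed.

Lemma spectral_norm_ge0 : (0 < n)%N -> 0 <= spectral_norm M.
Proof.
move=> n0; have := le_trans (frob_norm_ge0 _) (le_spectral_norm (const_mx 1)).
apply: contraLR; rewrite -!ltNge => s0; rewrite nmulr_rlt0//.
rewrite lt_neqAle frob_norm_ge0 andbT eq_sym; apply/eqP => /frob_norm_eq0.
by move=> /colP/(_ (Ordinal n0)); rewrite !mxE => /eqP; rewrite oner_eq0.
Qed.

Lemma mxtrace_quad_le m (A : 'M[R]_(n, m)) : (0 < n)%N ->
  \tr (A^T *m M *m A) <= spectral_norm M * frob_norm A ^+ 2.
Proof.
move=> n0; rewrite -mulmxA (le_trans (ler_norm _))//.
rewrite (le_trans (mxtrace_mul_le _ _))// expr2 mulrCA ler_wpM2l ?frob_norm_ge0//.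
exact/le_spectral_norm_mul/spectral_norm_ge0.
Qed.

End spectral_norm.

Section positive_definite.
Context (R : realType).

Lemma pdmx_sqrt n (S : 'M[R]_n) : S^T = S -> pdmx S ->
  exists Q, [/\ Q^T = Q, pdmx Q & Q *m Q = S].
Proof.
case: n S => [|n] S hS pS; last exact: sqrt_pdmx.
by exists S; split => //; apply/matrixP => -[].
Qed.

Lemma pdmx_unit n (S : 'M[R]_n) : pdmx S -> S \in unitmx.
Proof.
move=> pS; rewrite -unitmx_tr -row_free_unit -kermx_eq0.
apply/rowV0P => v /sub_kermxP vS; apply/eqP; apply: contraT => v0.
have vT0 : v^T != 0 by rewrite trmx_eq0.
have e : v *m S *m v^T = (v *m S^T *m v^T)^T by rewrite !trmx_mul !trmxK mulmxA.
by have := pS _ vT0; rewrite trmxK e vS mul0mx trmx0 mxE ltxx.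
Qed.

Lemma pdmx_det_gt0 n (S : 'M[R]_n) : S^T = S -> pdmx S -> 0 < \det S.
Proof.
move=> hS pS; have [Q [QT _ QQ]] := pdmx_sqrt hS pS.
have := pdmx_unit pS; rewrite unitmxE unitfE => S0.
by rewrite lt_neqAle eq_sym S0 -QQ det_mulmx -expr2 sqr_ge0.
Qed.

(** If x is nonzero and x^T S x = 0, then y = S x is nonzero, and along x - e y the form is -2 e
    |y|^2 + e^2 y^T S y, which is negative for small e. *)
Lemma psdmx_unit_pdmx n (S : 'M[R]_n) : S^T = S ->
  (forall x : 'cV[R]_n, 0 <= (x^T *m S *m x) 0 0) -> \det S != 0 -> pdmx S.
Proof.
move=> hS psd dS x x0; rewrite lt_neqAle psd andbT; apply/eqP => qx0.
pose y := S *m x.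
have y0 : y != 0.
  apply: contra x0 => /eqP yx0; have Su : S \in unitmx by rewrite unitmxE unitfE.
  by rewrite -(mulKmx Su x) -/y yx0 mulmx0.
have yy := sqr_col_gt0 y0.
pose a := (y^T *m y) 0 0; pose b := (y^T *m S *m y) 0 0.
have b0 : 0 <= b by exact: psd.
have E (e : R) : ((x - e *: y)^T *m S *m (x - e *: y)) 0 0 = - 2 * e * a + e ^+ 2 * b.
  have -> : (x - e *: y)^T *m S *m (x - e *: y) =
     x^T *m S *m x - e *: (x^T *m S *m y) - e *: (y^T *m S *m x)
     + e ^+ 2 *: (y^T *m S *m y).
    rewrite [in (x - _)^T]linearB /= [in (e *: y)^T]linearZ /= !mulmxBl !mulmxBr.
    rewrite -!scalemxAl -!scalemxAr -?scalemxAl scalerA -expr2 opprB !addrA.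
    move: (x^T *m S *m x) (x^T *m S *m y) (y^T *m S *m x) (y^T *m S *m y) => p q r t.
    by apply/matrixP => i j; rewrite !mxE; ring.
  have -> : x^T *m S *m y = y^T *m y by rewrite /y trmx_mul hS.
  have -> : y^T *m S *m x = y^T *m y by rewrite -mulmxA.
  move: (esym qx0); rewrite /a /b.
  move: (x^T *m S *m x) (y^T *m y) (y^T *m S *m y) => p q r p0.
  by rewrite !mxE p0; ring.
(* With e = a / (b + a) one has e b <= a, so the value is at most -2 e a + e a = - e a < 0. *)
have := psd (x - (a / (b + a)) *: y); rewrite E.
have ba : 0 < b + a by rewrite ltr_wpDl.
set e := a / (b + a).
have e0 : 0 < e by rewrite divr_gt0.
have e1 : e * b <= a.
  by rewrite /e mulrAC ler_pdivrMr// ler_wpM2l ?(ltW yy)// lerDl (ltW yy).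
have := ler_wpM2l (ltW e0) e1; have : 0 < e * a by rewrite mulr_gt0.
by rewrite expr2; lra.
Qed.

(* Positive semidefiniteness is a countable condition: this makes the set of
   positive definite matrices measurable. *)
Lemma rat_psdmx n (S : 'M[R]_n) :
  (forall K : 'cV[rat]_n, 0 <= ((map_mx ratr K)^T *m S *m map_mx ratr K) 0 0) ->
  forall x : 'cV[R]_n, 0 <= (x^T *m S *m x) 0 0.
Proof.
move=> h x; rewrite leNgt; apply/negP => qx.
set q := (x^T *m S *m x) 0 0 in qx.
(* [C] exceeds the Lipschitz constant of the quadratic form on the unit ball around x, and the
   summand 1 keeps it positive. The minimum with 1 below keeps the rational vector in that ball. *)
pose C := frob_norm S * (2 * frob_norm x + 1) + 1.
have C0 : 0 < C.
  by rewrite ltr_wpDl// mulr_ge0 ?frob_norm_ge0// addr_ge0// mulr_ge0// frob_norm_ge0.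
have e0 : 0 < Num.min 1 (- q / C).
  by rewrite lt_min ltr01 /= divr_gt0// oppr_gt0.
have [K hK] := rat_mx_approx x e0; have := h K.
set y := map_mx ratr K in hK *.
have qy : `|(y^T *m S *m y) 0 0 - q| <= frob_norm (x - y) * frob_norm S * (2 * frob_norm x + 1).
  have -> : (y^T *m S *m y) 0 0 - q =
     - ((((x - y)^T *m S *m y) 0 0) + (x^T *m S *m (x - y)) 0 0).
    rewrite [in (x - y)^T]linearB /= !mulmxBl mulmxBr /q.
    move: (x^T *m S *m x) (x^T *m S *m y) (y^T *m S *m y) => a b c.
    by rewrite !mxE; ring.
  rewrite normrN (le_trans (ler_normD _ _))//.
  rewrite mulrDr mulr1 (_ : 2 * frob_norm x = (frob_norm x + 1) + (frob_norm x - 1)); last by ring.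
  have yx : frob_norm y <= frob_norm x + 1.
    have := frob_normD x (y - x); rewrite addrC subrK => /le_trans; apply.
    by rewrite lerD2l frob_normBC ltW// (lt_le_trans hK)// ge_min lexx.
  have h1 : `|((x - y)^T *m S *m y) 0 0| <= frob_norm (x - y) * frob_norm S * (frob_norm x + 1).
    rewrite (le_trans (le_frob_norm _ _ _))//.
    rewrite (le_trans (frob_normM _ _))// ler_pM ?frob_norm_ge0//.
    by rewrite (le_trans (frob_normM _ _))// frob_norm_tr.
  have h2 : `|(x^T *m S *m (x - y)) 0 0| <= frob_norm (x - y) * frob_norm S * frob_norm x.
    rewrite (le_trans (le_frob_norm _ _ _))//.
    rewrite (le_trans (frob_normM _ _))// mulrC -mulrA ler_wpM2l ?frob_norm_ge0//.
    by rewrite (le_trans (frob_normM _ _))// frob_norm_tr mulrC.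
  move: h1 h2; lra.
have : frob_norm (x - y) * frob_norm S * (2 * frob_norm x + 1) <= frob_norm (x - y) * C.
  by rewrite -mulrA ler_wpM2l ?frob_norm_ge0// /C lerDl.
have : frob_norm (x - y) * C < - q.
  rewrite -ltr_pdivlMr//; apply: (lt_le_trans hK).
  by rewrite ge_min lexx orbT.
move: qy; rewrite ler_norml => /andP[_]; lra.
Qed.

Lemma pdmx_congr n (S B : 'M[R]_n) : B \in unitmx -> pdmx S -> pdmx (B^T *m S *m B).
Proof.
move=> Bu pS x x0; rewrite (_ : _ *m x = (B *m x)^T *m S *m (B *m x)).
  apply: pS; apply: contra x0 => /eqP Bx.
  by rewrite -(mulKmx Bu x) Bx mulmx0.
by rewrite trmx_mul !mulmxA.
Qed.

Lemma invmx_sqr n (S Q : 'M[R]_n) : Q \in unitmx -> Q *m Q = S ->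
  invmx S = invmx Q *m invmx Q.
Proof.
move=> Qu QQ; have Su : S \in unitmx by rewrite -QQ unitmx_mul Qu.
by apply: (can_inj (mulKmx Su)); rewrite mulmxV// -QQ mulmxA mulmxK// mulmxV.
Qed.

(* With W = V V and Sigma = Q Q: |W| <= |V|^2 <= |Q|^2 |Q^-1 V|^2. *)
Lemma pdmx_frob_le n (S W : 'M[R]_n) : S^T = S -> pdmx S -> W^T = W -> pdmx W ->
  frob_norm W <= \tr S * \tr (invmx S *m W).
Proof.
move=> hS pS hW pW.
have [Q [QT pQ QQ]] := pdmx_sqrt hS pS; have [V [VT _ VV]] := pdmx_sqrt hW pW.
have Qu := pdmx_unit pQ.
have SiE := invmx_sqr Qu QQ.
have -> : \tr S = frob_norm Q ^+ 2 by rewrite sqr_frob_norm QT QQ.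
have -> : \tr (invmx S *m W) = frob_norm (invmx Q *m V) ^+ 2.
  by rewrite sqr_frob_norm trmx_mul VT trmx_inv QT -mulmxA [RHS]mxtrace_mulC SiE
    -VV !mulmxA.
rewrite -[in leLHS]VV (le_trans (frob_normM _ _))// -exprMn -expr2.
rewrite ler_sqr ?nnegrE ?mulr_ge0 ?frob_norm_ge0//.
by rewrite -[in leLHS](mulKVmx Qu V) frob_normM.
Qed.

Lemma pdmx_trace_ge0 n (S W : 'M[R]_n) : S^T = S -> pdmx S -> W^T = W -> pdmx W ->
  0 <= \tr (invmx S *m W).
Proof.
move=> hS pS hW pW.
have [Q [QT pQ QQ]] := pdmx_sqrt hS pS; have [V [VT _ VV]] := pdmx_sqrt hW pW.
rewrite (_ : \tr _ = frob_norm (invmx Q *m V) ^+ 2) ?sqr_ge0//.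
by rewrite sqr_frob_norm trmx_mul VT trmx_inv QT -mulmxA [RHS]mxtrace_mulC
  (invmx_sqr (pdmx_unit pQ) QQ) -VV !mulmxA.
Qed.

(** Write S = Q Q and n = tr (Q S^-1 Q). This bound and the next one convert the dimensional
    constants of the Gaussian estimate into the scale of the final bound. *)
Lemma dim_le_spectral_trace n (S : 'M[R]_n) : (0 < n)%N -> S^T = S -> pdmx S ->
  n%:R <= spectral_norm (invmx S) * \tr S.
Proof.
move=> n0 hS pS; have [Q [QT pQ QQ]] := pdmx_sqrt hS pS.
have Qu := pdmx_unit pQ.
have -> : \tr S = frob_norm Q ^+ 2 by rewrite sqr_frob_norm QT QQ.
apply: le_trans (mxtrace_quad_le _ _ n0); rewrite (invmx_sqr Qu QQ) QT.
by rewrite !mulmxA mulmxV// mul1mx mulVmx// mxtrace1.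
Qed.

Lemma dim_le_spectral_frob n (S : 'M[R]_n) : (0 < n)%N -> S \in unitmx ->
  n%:R <= spectral_norm (invmx S) ^+ 2 * frob_norm S ^+ 2.
Proof.
move=> n0 Su; rewrite -exprMn.
have -> : n%:R = frob_norm (invmx S *m S) ^+ 2 :> R.
  by rewrite mulVmx// sqr_frob_norm trmx1 mulmx1 mxtrace1.
rewrite ler_sqr ?nnegrE ?mulr_ge0 ?frob_norm_ge0 ?spectral_norm_ge0//.
exact/le_spectral_norm_mul/spectral_norm_ge0.
Qed.

End positive_definite.

Section symmx_square_root.
Context (R : realType) (d : nat).
Implicit Types S : symmx R d.

Lemma trmx_symmx S : (S : 'M[R]_d)^T = S.
Proof. by case: S => S /= /eqP. Qed.

Lemma sqrt_symmxP S : posdefmx S ->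
  posdefmx (sqrt_symmx S) /\ (sqrt_symmx S : 'M[R]_d) *m sqrt_symmx S = S.
Proof.
move=> pS; have [Q [QT pQ QQ]] := pdmx_sqrt (trmx_symmx S) pS.
have QS : Q \in @issymmx R d by rewrite inE QT.
by rewrite /sqrt_symmx; case: xgetP => [Q' _ //|/(_ (SymMx QS))[]].
Qed.

End symmx_square_root.

(** * Integration and measurability *)

Section real_integrals.
Context d (T : measurableType d) (R : realType) (mu : {measure set T -> \bar R}).
Implicit Types f g : T -> R.

Definition rintegrable f := mu.-integrable [set: T] (EFin \o f).

Lemma rintegrable_meas f : rintegrable f -> measurable_fun [set: T] f.
Proof. by move=> /integrableP[/measurable_EFinP]. Qed.

Lemma rintegrable_le f g : measurable_fun [set: T] f -> rintegrable g ->
  (forall x, `|f x| <= g x) -> rintegrable f.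
Proof.
move=> mf ig fg; apply: (le_integrable measurableT _ _ ig); first exact/measurable_EFinP.
by move=> x _ /=; rewrite lee_fin (le_trans (fg x))// ler_norm.
Qed.

Lemma rintegrableD f g : rintegrable f -> rintegrable g ->
  rintegrable (fun x => f x + g x).
Proof.
move=> i1 i2; have := integrableD measurableT i1 i2.
by apply: eq_integrable => // x _ /=; rewrite EFinD.
Qed.

Lemma rintegrableZ k f : rintegrable f -> rintegrable (fun x => k * f x).
Proof.
move=> i1; have := integrableZl measurableT k i1.
by apply: eq_integrable => // x _ /=; rewrite EFinM.
Qed.

Lemma rintegrableN f : rintegrable f -> rintegrable (fun x => - f x).
Proof.
move=> i1; have := integrableN i1.
by apply: eq_integrable => // x _ /=; rewrite EFinN.
Qed.

Lemma rintegrableB f g : rintegrable f -> rintegrable g ->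
  rintegrable (fun x => f x - g x).
Proof. by move=> i1 i2; apply: rintegrableD => //; exact: rintegrableN. Qed.

Lemma rintegrable_norm f : rintegrable f -> rintegrable (fun x => `|f x|).
Proof. exact: integrable_norm. Qed.

Lemma rintegrable_sum (I : finType) (F : I -> T -> R) :
  (forall i, rintegrable (F i)) -> rintegrable (fun x => \sum_i F i x).
Proof.
move=> h; have := @integrable_sum _ _ _ mu setT measurableT I (index_enum I) xpredT
  (fun i => EFin \o F i) (fun i _ => h i).
by apply: eq_integrable => // x _ /=; rewrite sumEFin.
Qed.

Lemma RintegralTD f g : rintegrable f -> rintegrable g ->
  \int[mu]_x (f x + g x) = \int[mu]_x f x + \int[mu]_x g x.
Proof. exact: RintegralD. Qed.

Lemma RintegralTB f g : rintegrable f -> rintegrable g ->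
  \int[mu]_x (f x - g x) = \int[mu]_x f x - \int[mu]_x g x.
Proof. exact: RintegralB. Qed.

Lemma RintegralTZ k f : rintegrable f ->
  \int[mu]_x (k * f x) = k * \int[mu]_x f x.
Proof. exact: RintegralZl. Qed.

Lemma rintegrable_fin f : rintegrable f ->
  (\int[mu]_x (f x)%:E = (\int[mu]_x f x)%:E)%E.
Proof. by move=> i; rewrite /Rintegral fineK//; exact: integrable_fin_num. Qed.

Lemma Rintegral_sum (I : finType) (F : I -> T -> R) :
  (forall i, rintegrable (F i)) ->
  \int[mu]_x (\sum_i F i x) = \sum_i \int[mu]_x F i x.
Proof.
move=> h; rewrite /Rintegral; under eq_integral do rewrite -sumEFin.
rewrite integral_sum//.
by under eq_bigr do rewrite rintegrable_fin//; rewrite sumEFin.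
Qed.

Lemma ge0_rintegrable f : measurable_fun [set: T] f -> (forall x, 0 <= f x) ->
  (\int[mu]_x (f x)%:E < +oo)%E -> rintegrable f.
Proof.
move=> mf f0 fi; apply/integrableP; split; first exact/measurable_EFinP.
by under eq_integral do rewrite /= ger0_norm//.
Qed.

(** Dominated convergence in the punctured neighbourhood of 0, through sequences. The limit [D]
    comes out integrable instead of being assumed measurable; this is how derivatives, known only as
    limits of quotients, become integrable. *)
Lemma cvg_Rintegral_dnbhs (F : R -> T -> R) (D G : T -> R) (delta : R) :
  0 < delta ->
  (forall x, x != 0 -> `|x| <= delta -> measurable_fun [set: T] (F x)) ->
  (forall x t, x != 0 -> `|x| <= delta -> `|F x t| <= G t) ->
  rintegrable G ->
  (forall t, F x t @[x --> 0^'] --> D t) ->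
  rintegrable D /\ \int[mu]_t F x t @[x --> 0^'] --> \int[mu]_t D t.
Proof.
move=> delta0 mF FG iG FD.
have dct (u : nat -> R) : (forall n, u n != 0) -> (forall n, `|u n| <= delta) ->
    u @ \oo --> 0 ->
    rintegrable D /\ \int[mu]_t F (u n) t @[n --> \oo] --> \int[mu]_t D t.
  move=> u0 ud ucv.
  have pw t : [set: T] t -> (F (u n) t)%:E @[n --> \oo] --> (D t)%:E.
    move=> _; apply: cvg_EFin; first exact: nearW.
    have /cvgr_dnbhsP/(_ u) := FD t; apply; split => //.
  have mf n : measurable_fun [set: T] (fun t => (F (u n) t)%:E).
    by apply/measurable_EFinP; exact: mF.
  have bd n t : [set: T] t -> (`|(F (u n) t)%:E| <= (G t)%:E)%E.
    by move=> _ /=; rewrite lee_fin FG.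
  have mD : measurable_fun [set: T] (EFin \o D) by exact: (emeasurable_fun_cvg _ _ mf pw).
  have [iD _ cD] := @dominated_convergence _ _ _ mu _ measurableT
    (fun n t => (F (u n) t)%:E) (EFin \o D) (EFin \o G) mf mD
    (aeW _ (fun t => pw t)) iG (aeW _ (fun t n => bd n t)).
  split => //; rewrite /Rintegral; apply: fine_cvg.
  by rewrite -/(Rintegral mu setT D) -rintegrable_fin.
split.
  (* The integrability of the limit only needs one admissible sequence. *)
  have [] // := dct (fun n => delta / n.+1%:R).
  - by move=> n; rewrite mulf_neq0 ?gt_eqF// invr_gt0.
  - move=> n; rewrite normrM gtr0_norm// ler_piMr ?(ltW delta0)//.
    by rewrite normfV gtr0_norm// invf_le1// ler1n.
  - rewrite -[X in _ --> X](mulr0 delta); apply: cvgMr => //.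
    exact: cvg_harmonic.
apply/cvgr_dnbhsP => u [u0 ucv].
(* A sequence tending to 0 obeys the bound by [delta] only from some rank on, hence the shift by
   [N]. *)
have [N _ hN] : \forall n \near \oo, `|u n| <= delta by exact: cvgr0_norm_le.
rewrite -(cvg_shiftn N) /=.
have [] // := dct (fun n => u (n + N)%N).
- by move=> n; apply: hN => /=; rewrite leq_addl.
- by rewrite (cvg_shiftn N u).
Qed.

End real_integrals.

Section density.
Context d (T : measurableType d) (R : realType).
Variables (mu nu : {measure set T -> \bar R}) (q : T -> R).
Hypotheses (mq : measurable_fun [set: T] q) (q0 : forall x, 0 <= q x).
Hypothesis nuE : forall A, measurable A -> nu A = (\int[mu]_(x in A) (q x)%:E)%E.
Local Open Scope ereal_scope.
Import HBNNSimple.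

(** The density is known on sets only; simple functions and monotone convergence extend it to
    nonnegative functions. *)
Lemma ge0_integral_density (f : T -> \bar R) : measurable_fun [set: T] f ->
  (forall x, 0 <= f x) -> \int[nu]_x f x = \int[mu]_x (f x * (q x)%:E).
Proof.
move=> mf f0.
have step (h : {nnsfun T >-> R}) :
    \int[nu]_x (h x)%:E = \int[mu]_x ((h x)%:E * (q x)%:E).
  rewrite integralT_nnsfun sintegralE.
  under [RHS]eq_integral.
    move=> x xD; rewrite fimfunE -fsumEFin// ge0_mule_fsuml; last first.
      by move=> r; rewrite EFinM nnfun_muleindic_ge0.
    over.
  rewrite [RHS]ge0_integral_fsum//; last 2 first.
  - move=> r; apply: emeasurable_funM; last exact/measurable_EFinP.
    by apply/measurable_EFinP/measurableT_comp.
  - move=> n x _; apply: mule_ge0; last by rewrite lee_fin.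
    by rewrite EFinM nnfun_muleindic_ge0.
  apply: eq_fsbigr => r _.
  have [r0|r0] := leP 0%R r; last first.
    rewrite preimage_nnfun0// measure0 mule0 integral0_eq// => x _.
    by rewrite indicE in_set0 mulr0 mul0e.
  under eq_integral do rewrite EFinM -muleA.
  rewrite ge0_integralZl//; last 2 first.
  - apply: emeasurable_funM; last exact/measurable_EFinP.
    exact/measurable_EFinP.
  - by move=> x _; rewrite mule_ge0 ?lee_fin.
  congr (_ * _); rewrite nuE// integral_mkcond; apply: eq_integral => x _.
  by rewrite patchE indicE; case: ifPn => _; rewrite ?mul1e ?mul0e.
pose f_ := nnsfun_approx measurableT mf.
transitivity (limn (fun n => \int[nu]_x (f_ n x)%:E)).
  rewrite -monotone_convergence//.
  - apply: eq_integral => y /[!inE] yD; apply/esym/cvg_lim => //.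
    by apply: cvg_nnsfun_approx=> // *; apply: f0; rewrite inE.
  - by move=> n; exact/measurable_EFinP/measurable_funP.
  - by move=> n y _; rewrite lee_fin.
  - by move=> y _ m n mn; rewrite lee_fin; exact/lefP/nd_nnsfun_approx.
under eq_fun do rewrite step.
rewrite -monotone_convergence//.
- apply: eq_integral => y /[!inE] yD; apply/cvg_lim => //.
  apply: cvgeZr; first by [].
  by apply: cvg_nnsfun_approx=> // *; apply: f0; rewrite inE.
- move=> n; apply: emeasurable_funM; last exact/measurable_EFinP.
  exact/measurable_EFinP/measurable_funP.
- by move=> n y _; rewrite mule_ge0 ?lee_fin.
- move=> y _ m n mn; apply: lee_wpmul2r; rewrite ?lee_fin//; exact/lefP/nd_nnsfun_approx.
Qed.

End density.

Section symmx_measurability.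
Context (R : realType) (d : nat).

Lemma symmx_eq (S T : symmx R d) : (S : 'M[R]_d) = T -> S = T.
Proof. exact: val_inj. Qed.

Lemma sympart_id (S : symmx R d) : sympart S = S.
Proof.
apply: symmx_eq; rewrite /= trmx_symmx; apply/matrixP => i j; rewrite !mxE.
by field.
Qed.

Lemma frob_norm_sympart (A : 'M[R]_d) : frob_norm (sympart A) <= frob_norm A.
Proof.
rewrite /= frob_normZ ger0_norm ?invr_ge0// mulrC ler_pdivrMr// mulr_natr mulr2n.
by rewrite (le_trans (frob_normD _ _))// frob_norm_tr.
Qed.

Lemma measurable_frob_norm :
  measurable_fun [set: symmx R d] (fun S : symmx R d => frob_norm S).
Proof.
under eq_fun do rewrite -(ger0_norm (frob_norm_ge0 _)) -sqrtr_sqr sqr_frob_normE.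
have ms : measurable_fun [set: R] (@Num.sqrt R).
  by apply: continuous_measurable_fun; exact: sqrt_continuous.
apply: (measurableT_comp ms).
apply: measurable_sum => i; apply: measurable_sum => j.
by apply: measurable_funX; exact: measurable_symmx_entry.
Qed.

(** The sigma-algebra is generated by the entries, not by open sets, so continuity must be made
    countable: the sublevel set of level r is a union, over symmetrized rational matrices K, of the
    balls L |S - K| < r - h(K). *)
Lemma measurable_lipschitz (h : symmx R d -> R) (L : R) :
  (forall S T : symmx R d, `|h S - h T| <= L * frob_norm ((S : 'M[R]_d) - T)) ->
  measurable_fun [set: symmx R d] h.
Proof.
move=> hL0; have {hL0}[{}L L0 hL] : exists2 L, 0 < L &
    forall S T : symmx R d, `|h S - h T| <= L * frob_norm ((S : 'M[R]_d) - T).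
  exists (`|L| + 1); first by rewrite ltr_wpDl.
  move=> S T; rewrite (le_trans (hL0 S T))// ler_wpM2r ?frob_norm_ge0//.
  by rewrite (le_trans (ler_norm _))// lerDl.
pose K (k : 'M[rat]_d) : symmx R d := sympart (map_mx ratr k).
apply: (measurability _ (RGenInftyO.measurableE R)) => //.
move=> _ [_ [r ->] <-]; rewrite setTI.
rewrite (_ : _ @^-1` _ = \bigcup_(k in [set: 'M[rat]_d])
    [set S : symmx R d | L * frob_norm ((S - K k : symmx R d) : 'M[R]_d) < r - h (K k)]).
  apply: countable_bigcupT_measurable => // k.
  have mf : measurable_fun [set: symmx R d] (fun S => L * frob_norm ((S - K k : symmx R d) : 'M[R]_d)).
    apply: measurable_funM => //; apply: measurableT_comp measurable_frob_norm _.
    apply: measurable_fun_symmx => i j; under eq_fun do rewrite /= !mxE.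
    by apply: measurable_funB => //; exact: measurable_symmx_entry.
  by rewrite -[X in measurable X]setTI;
    exact: (measurable_fun_ltr mf (measurable_cst _)).
apply/seteqP; split => [S|S [k _]] /=; rewrite in_itv /=; last first.
  move=> hS; have := hL S (K k); rewrite ler_norml => /andP[_].
  by move: hS => /=; lra.
(* Half of the available radius: one half pays for replacing h(S) by h(K), the other leaves S inside
   the ball of K. *)
move=> hSr; have e0 : 0 < (r - h S) / (2 * L).
  by rewrite divr_gt0 ?subr_gt0// mulr_gt0.
have [k hk] := rat_mx_approx (S : 'M[R]_d) e0; exists k => //=.
have Sk : frob_norm ((S : 'M[R]_d) - K k) < (r - h S) / (2 * L).
  apply: le_lt_trans hk; rewrite -[X in frob_norm (X - _)](congr1 val (sympart_id S)).
  have := frob_norm_sympart ((S : 'M[R]_d) - map_mx ratr k); apply: le_trans.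
  rewrite le_eqVlt; apply/orP; left; apply/eqP; congr frob_norm; rewrite /=.
  by apply/matrixP => i j; rewrite !mxE; ring.
have := hL (K k) S; rewrite ler_norml => /andP[_].
rewrite frob_normBC; move: Sk; rewrite ltr_pdivlMr ?mulr_gt0//.
by move=> /=; lra.
Qed.

Lemma measurable_mx_det (f : 'I_d -> 'I_d -> symmx R d -> R) :
  (forall i j, measurable_fun [set: symmx R d] (f i j)) ->
  measurable_fun [set: symmx R d] (fun S => \det (\matrix_(i, j) f i j S)).
Proof.
move=> mf; rewrite /determinant; apply: measurable_sum => s.
apply: measurable_funM => //; apply: measurable_prod => i _.
by under eq_fun do rewrite mxE; exact: mf.
Qed.

Lemma measurable_det :
  measurable_fun [set: symmx R d] (fun S : symmx R d => \det (S : 'M[R]_d)).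
Proof.
have := measurable_mx_det (fun i j => @measurable_symmx_entry R d i j).
by apply: eq_measurable_fun => S _; congr (\det _); apply/matrixP => i j; rewrite mxE.
Qed.

Lemma measurable_posdefmx : measurable [set S : symmx R d | posdefmx S].
Proof.
rewrite (_ : [set S | _] = (\bigcap_(K in [set: 'cV[rat]_d]) [set S : symmx R d |
    0 <= ((map_mx ratr K)^T *m (S : 'M[R]_d) *m map_mx ratr K) 0 0]) `&`
    [set S : symmx R d | \det (S : 'M[R]_d) != 0]); last first.
  apply/seteqP; split=> S /=.
    move=> pS; split; last first.
      by have := pdmx_unit pS; rewrite unitmxE unitfE.
    move=> K _ /=; have [->|K0] := eqVneq (map_mx ratr K : 'cV[R]_d) 0.
      by rewrite mulmx0 mxE.
    exact/ltW/pS.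
  move=> [h1 h2]; apply: psdmx_unit_pdmx => //; first exact: trmx_symmx.
  by apply: rat_psdmx => K; exact: h1.
apply: measurableI.
  rewrite -[X in measurable X]setCK; apply: measurableC; rewrite setC_bigcap.
  apply: countable_bigcupT_measurable => // K; apply: measurableC.
  rewrite -[X in measurable X]setTI; apply: measurable_fun_ler => //.
  under eq_fun do rewrite mxE.
  apply: measurable_sum => i; apply: measurable_funM => //.
  under eq_fun do rewrite mxE; apply: measurable_sum => j.
  by apply: measurable_funM => //; exact: measurable_symmx_entry.
rewrite -[X in measurable X]setTI.
apply: (@measurable_neg _ _ _ (fun S : symmx R d => \det (S : 'M[R]_d) == 0)) => //.
by apply: measurable_fun_eqr => //; exact: measurable_det.
Qed.

End symmx_measurability.

(** * Powers of a measure and affine changes of variables *)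

Section lebesgue_affine.
Context (R : realType).
Local Notation leb := (@lebesgue_measure R).
Local Open Scope ereal_scope.

Lemma ge0_integral_affine (a b : R) (f : measurableTypeR R -> \bar R) : (0 < a)%R ->
  measurable_fun [set: measurableTypeR R] f -> (forall x, 0 <= f x) ->
  \int[leb]_x f x = a%:E * \int[leb]_x f (a * x + b)%R.
Proof.
move=> a0 mf f0.
pose g (x : measurableTypeR R) : measurableTypeR R := (a * x + b)%R.
have mg : measurable_fun [set: measurableTypeR R] g.
  have : measurable_fun [set: R] (fun x : R => a * x + b)%R.
    by apply: measurable_funD => //; exact: measurable_funM.
  by [].
pose c := NngNum (ltW a0).
have E A : measurable A -> leb A = mscale c (pushforward leb g) A.
  apply: (@lebesgue_measure_unique _ (mscale c (pushforward leb g))) => //= X /ocitvP[->|[[x y] /= xy ->]].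
    by rewrite !measure0.
  rewrite /mscale /= /pushforward /=.
  rewrite (_ : g @^-1` _ = `](x - b) / a, (y - b) / a]%classic)%R; last first.
    apply/seteqP; split => z /=; rewrite !in_itv /= /g => /andP[h1 h2]; apply/andP.
      by rewrite ltr_pdivrMr// ler_pdivlMr//; split; lra.
    by move: h1 h2; rewrite ltr_pdivrMr// ler_pdivlMr//; split; lra.
  rewrite !lebesgue_measure_itv /= !lte_fin ltr_pM2r ?invr_gt0// ltrD2r xy.
  rewrite -!EFinD -EFinM; congr EFin; field.
  by rewrite gt_eqF.
rewrite (eq_measure_integral (mscale c (pushforward leb g))).
  by rewrite ge0_integral_mscale//= ge0_integral_pushforward.
by move=> A mA _; exact: E.
Qed.

End lebesgue_affine.

Section power_measure_integral.
Context d (T : measurableType d) (R : realType).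
Variable mu : {sigma_finite_measure set T -> \bar R}.
Local Open Scope ereal_scope.

Lemma ge0_integral_power_measureS n (f : n.+1.-tuple T -> \bar R) :
  measurable_fun [set: n.+1.-tuple T] f -> (forall t, 0 <= f t) ->
  \int[power_measure mu n.+1]_t f t =
  \int[mu]_x \int[power_measure mu n]_t f (tuple_cons (x, t)).
Proof.
move=> mf f0.
rewrite -[LHS]/(\int[pushforward (mu \x power_measure mu n) (@tuple_cons _ T n)]_t f t).
rewrite ge0_integral_pushforward// preimage_setT fubini_tonelli1//.
  exact: measurableT_comp.
by move=> x; exact: f0.
Qed.

(** With the head integrated innermost, a change of variables in the head may use an offset that
    depends on the tail. *)
Lemma ge0_integral_power_measureS' n (f : n.+1.-tuple T -> \bar R) :
  measurable_fun [set: n.+1.-tuple T] f -> (forall t, 0 <= f t) ->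
  \int[power_measure mu n.+1]_t f t =
  \int[power_measure mu n]_t \int[mu]_x f (tuple_cons (x, t)).
Proof.
move=> mf f0; rewrite ge0_integral_power_measureS//.
apply: (@fubini_tonelli _ _ _ _ _ mu (power_measure mu n) (f \o @tuple_cons _ T n)).
  exact: measurableT_comp.
by move=> x; exact: f0.
Qed.

Lemma measurable_integral_tuple_consr n (f : n.+1.-tuple T -> \bar R) :
  measurable_fun [set: n.+1.-tuple T] f -> (forall t, 0 <= f t) ->
  measurable_fun [set: T] (fun x => \int[power_measure mu n]_t f (tuple_cons (x, t))).
Proof.
move=> mf f0.
apply: (measurable_fun_fubini_tonelli_F (m2 := power_measure mu n) (f \o @tuple_cons _ T n)).
  exact: measurableT_comp.
by move=> x; exact: f0.
Qed.

Lemma measurable_integral_tuple_consl n (f : n.+1.-tuple T -> \bar R) :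
  measurable_fun [set: n.+1.-tuple T] f -> (forall t, 0 <= f t) ->
  measurable_fun [set: n.-tuple T] (fun t => \int[mu]_x f (tuple_cons (x, t))).
Proof.
move=> mf f0.
apply: (measurable_fun_fubini_tonelli_G (m1 := mu) (f \o @tuple_cons _ T n)).
  exact: measurableT_comp.
by move=> x; exact: f0.
Qed.

Lemma tnth_tuple_cons0 n (x : T) (t : n.-tuple T) : tnth (tuple_cons (x, t)) ord0 = x.
Proof. by []. Qed.

Lemma tnth_tuple_consS n (x : T) (t : n.-tuple T) j :
  tnth (tuple_cons (x, t)) (lift ord0 j) = tnth t j.
Proof. by rewrite (tnth_nth x) /= -tnth_nth. Qed.

Lemma measurable_tuple_consl n (t : n.-tuple T) :
  measurable_fun [set: T] (fun x => tuple_cons (x, t)).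
Proof. exact: (@measurable_cons _ _ _ _ id n (cst t)). Qed.

Lemma measurable_tuple_consr n (x : T) :
  measurable_fun [set: n.-tuple T] (fun t => tuple_cons (x, t)).
Proof. exact: (@measurable_cons _ _ _ _ (cst x) n id). Qed.

Definition set_tnth n (k : 'I_n) (x : T) (t : n.-tuple T) : n.-tuple T :=
  [tuple if i == k then x else tnth t i | i < n].

Lemma set_tnth_cons0 n x y (t : n.-tuple T) :
  set_tnth ord0 y (tuple_cons (x, t)) = tuple_cons (y, t).
Proof.
apply: eq_from_tnth => i; rewrite tnth_mktuple; case: (unliftP ord0 i) => [j ->|-> //].
by rewrite !tnth_tuple_consS.
Qed.

Lemma set_tnth_consS n (k : 'I_n) x y (t : n.-tuple T) :
  set_tnth (lift ord0 k) y (tuple_cons (x, t)) = tuple_cons (x, set_tnth k y t).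
Proof.
apply: eq_from_tnth => i; rewrite tnth_mktuple; case: (unliftP ord0 i) => [j ->|-> //].
by rewrite !tnth_tuple_consS tnth_mktuple (inj_eq lift_inj).
Qed.

Lemma measurable_fun_set_tnth d1 (U : measurableType d1) n (k : 'I_n) (g : U -> T)
    (h : U -> n.-tuple T) :
  measurable_fun [set: U] g -> measurable_fun [set: U] h ->
  measurable_fun [set: U] (fun u => set_tnth k (g u) (h u)).
Proof.
move=> mg mh; apply/measurable_fun_tnthP => i.
rewrite (_ : _ \o _ = fun u => if i == k then g u else tnth (h u) i); last first.
  by apply/funext => u /=; rewrite tnth_mktuple.
case: (i == k) => //.
exact: (measurableT_comp (measurable_tnth i)).
Qed.

Lemma measure_power_box n (B : 'I_n -> set T) : (forall i, measurable (B i)) ->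
  power_measure mu n [set t | forall i, B i (tnth t i)] = \prod_(i < n) mu (B i).
Proof.
elim: n B => [|n IH] B mB.
  rewrite big_ord0 /= diracE mem_set//.
  by move=> [].
rewrite big_ord_recl -(IH (fun i => B (lift ord0 i)))//.
rewrite -[LHS]/((mu \x power_measure mu n) (@tuple_cons _ T n @^-1` _)).
rewrite -product_measure1E//; last first.
  rewrite (_ : [set t | _] = \bigcap_(i in [set: 'I_n]) ((fun t => tnth t i) @^-1` B (lift ord0 i))).
    apply: fin_bigcap_measurable => // i _.
    by rewrite -[X in measurable X]setTI; exact: measurable_tnth.
  by apply/seteqP; split=> t /= h i; [move=> _|]; exact: h.
congr (_ _); apply/seteqP; split=> [[x t] /= h|[x t] /= [h0 h] i].
  split; first exact: (h ord0).
  by move=> i; have := h (lift ord0 i); rewrite tnth_tuple_consS.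
by case: (unliftP ord0 i) => [j ->|-> //]; rewrite tnth_tuple_consS; exact: h.
Qed.

End power_measure_integral.

Section power_lebesgue.
Context (R : realType).
Local Notation TR := (measurableTypeR R).
Local Notation leb := (@lebesgue_measure R).
Local Open Scope ereal_scope.

Lemma measurable_tnthR n (i : 'I_n) :
  measurable_fun [set: n.-tuple TR] (fun t => (tnth t i : R)).
Proof. exact: measurable_tnth. Qed.

(** A dilation and a shear in one coordinate. Since [c] ignores coordinate [k], it is a constant
    offset once the other coordinates are fixed, and Fubini reduces the claim to the line. *)
Lemma ge0_integral_power_affine n (k : 'I_n) (a : R) (c : n.-tuple TR -> R)
    (f : n.-tuple TR -> \bar R) : (0 < a)%R ->
  measurable_fun [set: n.-tuple TR] c ->
  (forall x t, c (set_tnth k x t) = c t) ->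
  measurable_fun [set: n.-tuple TR] f -> (forall t, 0 <= f t) ->
  \int[power_measure leb n]_t f t =
  a%:E * \int[power_measure leb n]_t f (set_tnth k (a * tnth t k + c t)%R t).
Proof.
move=> a0; elim: n k c f => [[]//|n IH] k c f mc ck mf f0.
have mg : measurable_fun [set: n.+1.-tuple TR]
    (fun t => f (set_tnth k (a * tnth t k + c t)%R t)).
  apply: (measurableT_comp mf); apply: measurable_fun_set_tnth => //.
  apply: measurable_funD => //; apply: measurable_funM => //.
  exact: measurable_tnth.
case: (unliftP ord0 k) mg ck => [j ->|->] mg ck.
  rewrite !ge0_integral_power_measureS// -ge0_integralZl//; last 3 first.
  - apply: (@measurable_integral_tuple_consr _ TR R leb n (fun t => f (set_tnth (lift ord0 j) (a * tnth t (lift ord0 j) + c t)%R t))) => //.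
  - by move=> x _; exact: integral_ge0.
  - by rewrite lee_fin ltW.
  apply: eq_integral => x _.
  rewrite (IH j (fun t => c (tuple_cons (x, t))))//.
  - congr (_ * _); apply: eq_integral => t _.
    by rewrite tnth_tuple_consS set_tnth_consS.
  - by apply: (measurableT_comp mc); exact: measurable_tuple_consr.
  - by move=> y t; rewrite -set_tnth_consS ck.
  - by apply: (measurableT_comp mf); exact: measurable_tuple_consr.
rewrite !ge0_integral_power_measureS'// -ge0_integralZl//; last 3 first.
- apply: (@measurable_integral_tuple_consl _ TR R leb n (fun t => f (set_tnth ord0 (a * tnth t ord0 + c t)%R t))) => //.
- by move=> x _; exact: integral_ge0.
- by rewrite lee_fin ltW.
(* The offset ignores the head, so it can be read off with any value there. *)
pose z : TR := (0 : R)%R.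
apply: eq_integral => t _.
rewrite (ge0_integral_affine (c (@tuple_cons _ TR n (z, t))) a0)//; last first.
  by apply: (measurableT_comp mf); exact: measurable_tuple_consl.
congr (_ * _); apply: eq_integral => x _.
rewrite set_tnth_cons0 tnth_tuple_cons0.
by rewrite -(ck z (tuple_cons (x, t))) set_tnth_cons0.
Qed.

Lemma ge0_integral_power_scale n (a : R) (f : n.-tuple TR -> \bar R) : (0 < a)%R ->
  measurable_fun [set: n.-tuple TR] f -> (forall t, 0 <= f t) ->
  \int[power_measure leb n]_t f t =
  (a ^+ n)%:E * \int[power_measure leb n]_t f [tuple (a * tnth t i)%R | i < n].
Proof.
move=> a0; elim: n f => [|n IH] f mf f0.
  rewrite expr0 mul1e; apply: eq_integral => t _; congr f.
  by apply: eq_from_tnth => -[].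
have mg m : measurable_fun [set: m.-tuple TR]
    (fun t => [tuple (a * tnth t i)%R | i < m] : m.-tuple TR).
  apply/measurable_fun_tnthP => i.
  rewrite (_ : _ \o _ = fun t => (a * tnth t i)%R); last first.
    by apply/funext => u /=; rewrite tnth_mktuple.
  by apply: measurable_funM => //; exact: measurable_tnthR.
have mfg : measurable_fun [set: n.+1.-tuple TR]
    (fun t => f [tuple (a * tnth t i)%R | i < n.+1]).
  exact: (measurableT_comp mf (mg _)).
rewrite !ge0_integral_power_measureS// exprS EFinM -muleA.
rewrite (ge0_integral_affine 0 a0)//; last 2 first.
- exact: measurable_integral_tuple_consr.
- by move=> x; exact: integral_ge0.
congr (_ * _); rewrite -ge0_integralZl//; last 3 first.
- apply: (@measurable_integral_tuple_consr _ TR R leb n (fun t => f [tuple (a * tnth t i)%R | i < n.+1])) => //.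
- by move=> x _; exact: integral_ge0.
- by rewrite lee_fin exprn_ge0// ltW.
apply: eq_integral => x _; rewrite IH//; last first.
  by apply: (measurableT_comp mf); exact: measurable_tuple_consr.
congr (_ * _); apply: eq_integral => t _; congr f.
apply: eq_from_tnth => i; rewrite tnth_mktuple; case: (unliftP ord0 i) => [j ->|->].
  by rewrite !tnth_tuple_consS tnth_mktuple.
by rewrite !tnth_tuple_cons0 addr0.
Qed.

End power_lebesgue.

(** * Gaussian tuples *)

Section weighted_transport.
Context d (X : measurableType d) (R : realType) (mu : {measure set X -> \bar R}).
Variables (T : X -> X) (w : X -> R).
Hypotheses (mT : measurable_fun [set: X] T) (mw : measurable_fun [set: X] w).
Hypothesis w0 : forall x, 0 <= w x.
Hypothesis muT : forall F : X -> \bar R, measurable_fun [set: X] F ->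
  (forall x, 0 <= F x)%E -> (\int[mu]_x F x = \int[mu]_x (F (T x) * (w x)%:E))%E.

(** A weighted change of variables for nonnegative functions extends to integrable ones through f =
    (f + |f|) - |f|. Gaussian shifts and Wishart congruences are the two instances. *)
Lemma weighted_transport (f : X -> R) : rintegrable mu f ->
  rintegrable mu (fun x => f (T x) * w x) /\
  \int[mu]_x (f (T x) * w x) = \int[mu]_x f x.
Proof.
move=> fi.
have mf := rintegrable_meas fi.
have pos (g : X -> R) : rintegrable mu g -> (forall x, 0 <= g x) ->
  rintegrable mu (fun x => g (T x) * w x) /\
  \int[mu]_x (g (T x) * w x) = \int[mu]_x g x.
  move=> gi g0; have mg := rintegrable_meas gi.
  have E : (\int[mu]_x (g x)%:E = \int[mu]_x (g (T x) * w x)%:E)%E.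
    rewrite (@muT (EFin \o g)).
    - by apply: eq_integral => x _; rewrite EFinM.
    - exact/measurable_EFinP.
    - by move=> x; rewrite lee_fin.
  split; last by rewrite /Rintegral E.
  apply: ge0_rintegrable.
  - by apply: measurable_funM => //; exact: (measurableT_comp mg).
  - by move=> x; rewrite mulr_ge0.
  - by rewrite -E rintegrable_fin// ltry.
have [i1 e1] := pos _ (rintegrable_norm fi) (fun x => normr_ge0 _).
have fp : rintegrable mu (fun x => f x + `|f x|).
  by apply: rintegrableD => //; exact: rintegrable_norm.
have [i2 e2] : rintegrable mu (fun x => (f (T x) + `|f (T x)|) * w x) /\
    \int[mu]_x ((f (T x) + `|f (T x)|) * w x) = \int[mu]_x (f x + `|f x|).
  apply: (pos (fun x => f x + `|f x|)) => //.
  by move=> x; have := ler_norm (- f x); rewrite normrN; lra.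
have E x : f (T x) * w x = (f (T x) + `|f (T x)|) * w x - `|f (T x)| * w x by ring.
split.
  apply: eq_integrable (rintegrableB i2 i1) => // x _ /=; congr EFin.
  by rewrite E.
under eq_Rintegral do rewrite E.
rewrite RintegralTB// e2 RintegralTD//; last exact: rintegrable_norm.
by rewrite [X in _ - X]e1 addrK.
Qed.

End weighted_transport.

Section exponential_estimates.
Context (R : realType).
Implicit Types x r : R.

Lemma expRB1_ge x : x <= expR x - 1.
Proof. by have := expR_ge1Dx x; lra. Qed.

Lemma norm_expRB1_le x : `|expR x - 1| <= `|x| * expR `|x|.
Proof.
have h1 := expRB1_ge x.
have h2 : expR x - 1 <= x * expR x.
  have := expRB1_ge (- x); rewrite expRN => h.
  have e0 := expR_gt0 x.
  have := ler_wpM2r (ltW e0) h; rewrite mulrBl mulVf ?gt_eqF// mul1r mulNr; lra.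
have e1 : expR x <= expR `|x| by rewrite ler_expR ler_norm.
have e2 : 1 <= expR `|x| by rewrite -expR0 ler_expR.
rewrite ler_norml; apply/andP; split.
  apply: le_trans h1; rewrite lerNl.
  have : `|x| <= `|x| * expR `|x| by rewrite ler_peMr.
  by apply: le_trans; rewrite -normrN ler_norm.
apply: (le_trans h2); rewrite (le_trans (ler_norm _))// normrM.
by rewrite (gtr0_norm (expR_gt0 _)) ler_wpM2l.
Qed.

Lemma le_expR_norm x : x <= expR x.
Proof. by have := expRB1_ge x; lra. Qed.

Lemma is_derive_diff_quotient (f : R -> R) df : is_derive (0 : R) 1 f df ->
  x^-1 * (f x - f 0) @[x --> 0^'] --> df.
Proof.
move=> [dfx <-]; move: dfx; rewrite /derivable /derive /=.
rewrite (_ : (fun h : R => h^-1 *: _) = (fun x => x^-1 * (f x - f 0))); first exact.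
by apply/funext => h; rewrite addr0 [h *: 1]mulr1.
Qed.

End exponential_estimates.

Section gaussian_line.
Context (R : realType).
Local Notation N01 := (normal_prob 0 1 : set (measurableTypeR R) -> \bar R).
Local Notation leb := (@lebesgue_measure R).
Local Open Scope ereal_scope.

Lemma ge0_integral_normal (f : measurableTypeR R -> \bar R) :
  measurable_fun [set: measurableTypeR R] f -> (forall x, 0 <= f x) ->
  \int[N01]_x f x = \int[leb]_x (f x * (normal_pdf 0 1 x)%:E).
Proof.
move=> mf f0; apply: (@ge0_integral_density _ (measurableTypeR R)) => //.
- exact: measurable_normal_pdf.
- by move=> x; exact: normal_pdf_ge0.
Qed.

Lemma normal_pdf_shift (x a : R) :
  (normal_pdf 0 1 (x + a) = normal_pdf 0 1 x * expR (- (a * x) - a ^+ 2 / 2))%R.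
Proof.
rewrite !normal_pdfE ?oner_eq0//= /normal_fun -mulrA -expRD; congr (_ * expR _)%R.
by field.
Qed.

(** Cameron-Martin formula on the line: translation invariance of the Lebesgue measure, with the
    ratio of densities as weight. *)
Lemma ge0_integral_normal_shift (a : R) (f : measurableTypeR R -> \bar R) :
  measurable_fun [set: measurableTypeR R] f -> (forall x, 0 <= f x) ->
  \int[N01]_x f x = \int[N01]_x (f (x + a)%R * (expR (- (a * x) - a ^+ 2 / 2))%:E).
Proof.
move=> mf f0.
have mpdf : measurable_fun [set: measurableTypeR R] (fun x : R => (normal_pdf 0 1 x)%:E).
  by apply/measurable_EFinP; exact: measurable_normal_pdf.
have madd : measurable_fun [set: measurableTypeR R] ((fun x : R => x + a)%R : measurableTypeR R -> measurableTypeR R).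
  have : measurable_fun [set: R] (fun x : R => x + a)%R by exact: measurable_funD.
  by [].
have mexp : measurable_fun [set: measurableTypeR R]
    (fun x : R => (expR (- (a * x) - a ^+ 2 / 2))%:E).
  apply/measurable_EFinP; apply: measurableT_comp => //.
  have : measurable_fun [set: R] (fun x : R => - (a * x) - a ^+ 2 / 2)%R.
    by apply: measurable_funB => //; apply: measurableT_comp => //; exact: measurable_funM.
  by [].
rewrite ge0_integral_normal// [RHS]ge0_integral_normal//; last 2 first.
- apply: emeasurable_funM => //; exact: measurableT_comp.
- by move=> x; rewrite mule_ge0// lee_fin expR_ge0.
rewrite (@ge0_integral_affine _ 1 a)//; last 2 first.
- exact: emeasurable_funM.
- by move=> x; rewrite mule_ge0// lee_fin normal_pdf_ge0.
rewrite mul1e; apply: eq_integral => x _; rewrite mul1r normal_pdf_shift.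
by rewrite EFinM -muleA [X in _ = _ * X]muleC.
Qed.

Lemma normal_prob_setT : N01 [set: _] = 1.
Proof. exact: (@probability_setT _ _ R (normal_prob 0 1)). Qed.

(** The shift formula by -k, applied to the constant 1, says that its weight has mean 1; up to a
    constant this weight is the exponential. *)
Lemma integral_normal_expR (k : R) : \int[N01]_x (expR (k * x))%:E = (expR (k ^+ 2 / 2))%:E.
Proof.
have := ge0_integral_normal_shift (- k) (f := cst 1) (measurable_cst _) (fun=> lee01).
rewrite integral_cst// mul1e => /esym E.
have {}E : \int[N01]_x (cst 1 (x + - k)%R * (expR (- (- k * x) - (- k) ^+ 2 / 2))%:E) = 1.
  rewrite E; exact: normal_prob_setT.
have E2 x : (expR (- (- k * x) - (- k) ^+ 2 / 2) =
    expR (- (k ^+ 2 / 2)) * expR (k * x))%R.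
  by rewrite -expRD; congr expR; ring.
have mx : measurable_fun [set: measurableTypeR R] (fun x : measurableTypeR R => (expR (k * x)%R)%:E).
  apply/measurable_EFinP; apply: measurableT_comp => //.
move: E; under eq_integral do rewrite mul1e E2 EFinM.
rewrite ge0_integralZl//=.
move=> /(congr1 (fun z => (expR (k ^+ 2 / 2))%:E * z)).
by rewrite mule1 muleA -EFinM -expRD subrr expR0 mul1e.
Qed.

End gaussian_line.

Section gaussian_tuple.
Context (R : realType).
Local Notation TR := (measurableTypeR R).
Local Notation N01 := (normal_prob 0 1 : set TR -> \bar R).

Definition gauss n : {sigma_finite_measure set (n.-tuple TR) -> \bar R} :=
  power_measure (normal_prob 0 1) n.

Definition tuple_lin n (a : 'I_n -> R) (t : n.-tuple TR) : R :=
  \sum_(i < n) a i * (tnth t i : R).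

Definition tuple_norm1 n (t : n.-tuple TR) : R := \sum_(i < n) `|(tnth t i : R)|.

Definition tuple_shift n (a : 'I_n -> R) (t : n.-tuple TR) : n.-tuple TR :=
  [tuple (tnth t i : R) + a i | i < n].

Lemma measurable_tuple_lin n (a : 'I_n -> R) :
  measurable_fun [set: n.-tuple TR] (tuple_lin a).
Proof.
apply: measurable_sum => i; apply: measurable_funM => //; exact: measurable_tnthR.
Qed.

Lemma measurable_tuple_norm1 n :
  measurable_fun [set: n.-tuple TR] (@tuple_norm1 n).
Proof.
apply: measurable_sum => i; apply: measurableT_comp => //; exact: measurable_tnthR.
Qed.

Lemma measurable_tuple_shift n (a : 'I_n -> R) :
  measurable_fun [set: n.-tuple TR] (tuple_shift a).
Proof.
apply/measurable_fun_tnthP => i.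
rewrite (_ : _ \o _ = fun t => (tnth t i : R) + a i); last first.
  by apply/funext => u /=; rewrite tnth_mktuple.
apply: measurable_funD => //; exact: measurable_tnthR.
Qed.

Lemma tuple_norm1_ge0 n (t : n.-tuple TR) : 0 <= tuple_norm1 t.
Proof. by apply: sumr_ge0 => i _. Qed.

Lemma tuple_lin_shift n (a b : 'I_n -> R) (t : n.-tuple TR) :
  tuple_lin a (tuple_shift b t) = tuple_lin a t + \sum_i a i * b i.
Proof.
rewrite -big_split /=; apply: eq_bigr => i _.
by rewrite tnth_mktuple mulrDr.
Qed.

Lemma norm_tuple_lin_le n (a : 'I_n -> R) (t : n.-tuple TR) :
  `|tuple_lin a t| <= (\sum_i `|a i|) * tuple_norm1 t.
Proof.
rewrite (le_trans (ler_norm_sum _ _ _))// mulr_suml; apply: ler_sum => i _.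
rewrite normrM ler_wpM2l// /tuple_norm1 (bigD1 i)//= lerDl.
exact: sumr_ge0.
Qed.

Local Open Scope ereal_scope.

Lemma ge0_integral_gauss_shift n (a : 'I_n -> R) (f : n.-tuple TR -> \bar R) :
  measurable_fun [set: n.-tuple TR] f -> (forall t, 0 <= f t) ->
  \int[gauss n]_t f t = \int[gauss n]_t (f (tuple_shift a t) *
    (expR (- tuple_lin a t - (\sum_i a i ^+ 2) / 2))%:E).
Proof.
elim: n a f => [|n IH] a f mf f0.
  apply: eq_integral => t _; rewrite /tuple_lin !big_ord0 oppr0 mul0r subr0 expR0 mule1.
  by congr f; apply: eq_from_tnth => -[].
have mE m (b : 'I_m -> R) : measurable_fun [set: m.-tuple TR]
    (fun t => (expR (- tuple_lin b t - (\sum_i b i ^+ 2) / 2))%:E).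
  apply/measurable_EFinP; apply: measurableT_comp => //.
  apply: measurable_funB => //; apply: measurableT_comp => //.
  exact: measurable_tuple_lin.
have mg : measurable_fun [set: n.+1.-tuple TR] (fun t => f (tuple_shift a t) *
    (expR (- tuple_lin a t - (\sum_i a i ^+ 2) / 2))%:E).
  apply: emeasurable_funM; last exact: mE.
  exact: (measurableT_comp mf (measurable_tuple_shift a)).
have g0 t : 0 <= f (tuple_shift a t) *
    (expR (- tuple_lin a t - (\sum_i a i ^+ 2) / 2))%:E.
  by rewrite mule_ge0// lee_fin expR_ge0.
rewrite /gauss !ge0_integral_power_measureS//.
rewrite (ge0_integral_normal_shift (a ord0)); last 2 first.
- exact: measurable_integral_tuple_consr.
- by move=> x; exact: integral_ge0.
apply: eq_integral => x _.
pose a' i := a (lift ord0 i).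
rewrite (IH a'); last 2 first.
- by apply: (measurableT_comp mf); exact: measurable_tuple_consr.
- by move=> t.
rewrite -ge0_integralZr//; last 2 first.
- apply: emeasurable_funM; last exact: mE.
  apply: (measurableT_comp mf).
  exact: (measurableT_comp (measurable_tuple_consr _) (measurable_tuple_shift a')).
- by move=> t _; rewrite mule_ge0// lee_fin expR_ge0.
apply: eq_integral => t _; rewrite -muleA -EFinM -expRD; congr (_ * _).
  congr f; apply: eq_from_tnth => i; rewrite tnth_mktuple.
  case: (unliftP ord0 i) => [j ->|->].
    by rewrite !tnth_tuple_consS tnth_mktuple.
  by rewrite !tnth_tuple_cons0.
congr (expR _)%:E; rewrite /tuple_lin !big_ord_recl /=.
under [X in (_ = - (_ + X) - _)%R]eq_bigr do rewrite tnth_tuple_consS.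
by rewrite tnth_tuple_cons0 /a'; field.
Qed.

Lemma gauss_setT n : gauss n [set: n.-tuple TR] = 1.
Proof.
have := measure_power_box (normal_prob (0:R) 1) (fun i : 'I_n => measurableT).
rewrite big1; last by move=> i _; exact: normal_prob_setT.
by move=> <-; congr (gauss n _); apply/seteqP; split.
Qed.

Lemma integral_gauss_expR_lty n (k : R) : (0 <= k)%R ->
  \int[gauss n]_t (expR (k * tuple_norm1 t))%:E < +oo.
Proof.
move=> k0; elim: n => [|n IH].
  under eq_integral do rewrite /tuple_norm1 big_ord0 mulr0 expR0.
  by rewrite integral_cst//= mul1e gauss_setT ltry.
have me m : measurable_fun [set: m.-tuple TR] (fun t => (expR (k * tuple_norm1 t))%:E).
  apply/measurable_EFinP; apply: measurableT_comp => //.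
  apply: measurable_funM => //; exact: measurable_tuple_norm1.
have e0 m (t : m.-tuple TR) : 0 <= (expR (k * tuple_norm1 t))%:E.
  by rewrite lee_fin expR_ge0.
rewrite /gauss ge0_integral_power_measureS//.
have E x : \int[power_measure (normal_prob 0 1) n]_t
     (expR (k * tuple_norm1 (tuple_cons (x, t))))%:E =
   (expR (k * `|x : R|))%:E * \int[gauss n]_t (expR (k * tuple_norm1 t))%:E.
  rewrite -ge0_integralZl//; try by [exact: me|move=> t _; exact: e0|rewrite lee_fin expR_ge0].
  apply: eq_integral => t _; rewrite -EFinM -expRD /tuple_norm1 big_ord_recl.
  rewrite tnth_tuple_cons0 mulrDr; congr (expR (_ + _ * _))%:E.
  by apply: eq_bigr => i _; rewrite tnth_tuple_consS.
under eq_integral do rewrite E.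
have mx (c : R) : measurable_fun [set: TR] (fun x : TR => (expR (c * x)%R)%:E).
  by apply/measurable_EFinP; apply: measurableT_comp.
have mxa : measurable_fun [set: TR] (fun x : TR => (expR (k * `|x : R|)%R)%:E).
  apply/measurable_EFinP; apply: measurableT_comp => //.
  apply: measurable_funM => //; exact: measurableT_comp.
rewrite ge0_integralZr//; try by [move=> x _; rewrite lee_fin expR_ge0|
  apply: integral_ge0 => t _; exact: e0].
apply: lte_mul_pinfty => //.
- by apply: integral_ge0 => t _; rewrite lee_fin expR_ge0.
- rewrite ge0_fin_numE; last by apply: integral_ge0 => t _; rewrite lee_fin expR_ge0.
  (* exp (k |x|) is at most exp (k x) + exp (- k x), and both of these have explicit means. *)
  apply: (@le_lt_trans _ _ (\int[N01]_x ((expR (k * x))%:E + (expR (- k * x))%:E))).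
    apply: ge0_le_integral => //; try by [move=> x _; rewrite lee_fin expR_ge0|
      exact: emeasurable_funD].
    move=> x _; rewrite -EFinD lee_fin.
    have [x0|x0] := leP 0%R (x : R).
      by rewrite ger0_norm// lerDl expR_ge0.
    by rewrite ltr0_norm// mulrN mulNr lerDr expR_ge0.
  rewrite ge0_integralD//; try by move=> x _; rewrite lee_fin expR_ge0.
  by rewrite !integral_normal_expR ltry.
Qed.

End gaussian_tuple.

Lemma is_derive_quad (R : realType) (b c x : R) :
  is_derive (x : R) 1 (fun x : R => (b * x + c * x ^+ 2)) (b + c * (2 * x)).
Proof.
have -> : (fun x => b * x + c * x ^+ 2) = ((b \*: (@id R)) + (c \*: ((@id R) ^+ 2))).
  by apply/funext => y /=; rewrite !fctE.
apply: is_derive_eq.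
by rewrite /= expr1 scaler1 /GRing.scale /=; ring.
Qed.
Lemma is_derive_expR_quad (R : realType) (b c : R) :
  is_derive (0 : R) 1 (fun x : R => expR (b * x + c * x ^+ 2)) b.
Proof.
have := @is_derive_quad R b c 0 => h.
have := @is_derive1_comp R expR _ _ _ _ (is_derive_expR _) h.
by rewrite mulr0 expr0n mulr0 addr0 expR0 mul1r mulr0 mulr0 addr0.
Qed.

Section gaussian_ibp.
Context (R : realType) (n : nat).
Local Notation TR := (measurableTypeR R).
Local Notation gauss := (@gauss R n).
Implicit Types (f : n.-tuple TR -> R) (a : 'I_n -> R).

Lemma rintegrable_gauss_expR (k : R) : 0 <= k ->
  rintegrable gauss (fun t => expR (k * tuple_norm1 t)).
Proof.
move=> k0; apply: ge0_rintegrable; last exact: integral_gauss_expR_lty.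
  apply: measurableT_comp => //; apply: measurable_funM => //.
  exact: measurable_tuple_norm1.
by move=> t; exact: expR_ge0.
Qed.

Lemma rintegrable_gauss_growth f (C k : R) : 0 <= k ->
  measurable_fun [set: n.-tuple TR] f ->
  (forall t, `|f t| <= C * expR (k * tuple_norm1 t)) -> rintegrable gauss f.
Proof.
move=> k0 mf fC; apply: rintegrable_le fC => //.
exact/rintegrableZ/rintegrable_gauss_expR.
Qed.

Lemma rintegrable_gauss_cst (c : R) : rintegrable gauss (fun=> c).
Proof.
apply: (@rintegrable_gauss_growth _ `|c| 0) => //.
by move=> t; rewrite mul0r expR0 mulr1.
Qed.

Lemma Rintegral_gauss_cst (c : R) : \int[gauss]_t c = c.
Proof. by rewrite Rintegral_cst//= gauss_setT mulr1. Qed.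

Lemma gauss_shift a f : rintegrable gauss f ->
  rintegrable gauss (fun t => f (tuple_shift a t) *
    expR (- tuple_lin a t - (\sum_i a i ^+ 2) / 2)) /\
  \int[gauss]_t (f (tuple_shift a t) *
    expR (- tuple_lin a t - (\sum_i a i ^+ 2) / 2)) = \int[gauss]_t f t.
Proof.
have mw : measurable_fun [set: n.-tuple TR]
    (fun t => expR (- tuple_lin a t - (\sum_i a i ^+ 2) / 2)).
  apply: measurableT_comp => //; apply: measurable_funB => //.
  apply: measurableT_comp => //; exact: measurable_tuple_lin.
move=> fi; apply: (weighted_transport (measurable_tuple_shift a) mw _ _ fi).
  by move=> t; exact: expR_ge0.
exact: ge0_integral_gauss_shift.
Qed.

(* Differentiate at 0 the identity [gauss_shift] for the shifts [x a]. *)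
Lemma gauss_ibp a f (D : n.-tuple TR -> R) (C K k : R) : 0 <= k ->
  measurable_fun [set: n.-tuple TR] f ->
  (forall t, `|f t| <= K * expR (k * tuple_norm1 t)) ->
  (forall t x, `|f (tuple_shift (fun i => x * a i) t) - f t| <= C * `|x|) ->
  (forall t, x^-1 * (f (tuple_shift (fun i => x * a i) t) - f t) @[x --> 0^'] --> D t) ->
  [/\ rintegrable gauss D, rintegrable gauss (fun t => f t * tuple_lin a t) &
    \int[gauss]_t D t = \int[gauss]_t (f t * tuple_lin a t)].
Proof.
move=> k0 mf fK fC fD.
have fi : rintegrable gauss f by exact: rintegrable_gauss_growth fK.
have K0 : 0 <= K.
  have := le_trans (normr_ge0 _) (fK [tuple (0 : R) | i < n]).
  by rewrite pmulr_lge0// expR_gt0.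
have C0 : 0 <= C.
  have := le_trans (normr_ge0 _) (fC [tuple (0 : R) | i < n] 1).
  by rewrite normr1 mulr1.
pose q : R := \sum_i a i ^+ 2.
have q0 : 0 <= q by apply: sumr_ge0 => i _; exact: sqr_ge0.
pose A : R := \sum_i `|a i|.
have A0 : 0 <= A by exact: sumr_ge0.
have lin_x x t : tuple_lin (fun i => x * a i) t = x * tuple_lin a t.
  by rewrite mulr_sumr; apply: eq_bigr => i _; rewrite mulrA.
pose L (t : n.-tuple TR) : R := A * tuple_norm1 t + q.
have L0 t : 0 <= L t by rewrite addr_ge0// mulr_ge0// tuple_norm1_ge0.
pose rho (x : R) (t : n.-tuple TR) : R := - tuple_lin a t * x + - (q / 2) * x ^+ 2.
(* Each [Fq x] has mean 0 by the shift formula, while its pointwise limit is the difference of the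
   two integrands to be compared. *)
pose Fq (x : R) (t : n.-tuple TR) : R := x^-1 * (f (tuple_shift (fun i => x * a i) t) * expR (rho x t) - f t).
have rhoE x t : - tuple_lin (fun i => x * a i) t - (\sum_i (x * a i) ^+ 2) / 2 = rho x t.
  rewrite lin_x; under eq_bigr do rewrite exprMn.
  by rewrite -mulr_sumr -/q /rho; field.
have rhoL x t : `|x| <= 1 -> `|rho x t| <= `|x| * L t.
  move=> x1; rewrite /rho /L mulrDr (le_trans (ler_normD _ _))// lerD//.
    rewrite mulNr normrN normrM mulrC ler_wpM2l//; exact: norm_tuple_lin_le.
  rewrite mulNr normrN normrM normrX [`|q / 2|]ger0_norm; last by rewrite divr_ge0.
  rewrite expr2 mulrC -mulrA ler_wpM2l//.
  have x0 := normr_ge0 x; nra.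
have dom x t : x != 0 -> `|x| <= 1 -> `|Fq x t| <= (C + K) * expR (2 * q) *
    expR ((k + 2 * A) * tuple_norm1 t).
  move=> x0 x1.
  have xx : `|x^-1| * `|x| = 1 by rewrite -normrM mulVf// normr1.
  have r1 := rhoL x t x1.
  have rL : `|rho x t| <= L t by rewrite (le_trans r1)// ler_piMl.
  (* Product rule for quotients: the first term is controlled by the Lipschitz bound in direction
     [a], the second by the growth of [f]. *)
  have -> : Fq x t = x^-1 * (f (tuple_shift (fun i => x * a i) t) - f t) * expR (rho x t)
      + f t * (x^-1 * (expR (rho x t) - 1)) by rewrite /Fq; ring.
  have b1 : `|x^-1 * (f (tuple_shift (fun i => x * a i) t) - f t) * expR (rho x t)|
      <= C * expR (2 * L t).
    rewrite !normrM (gtr0_norm (expR_gt0 _)) ler_pM//.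
    - have := ler_wpM2l (normr_ge0 x^-1) (fC t x).
      by rewrite mulrCA xx mulr1.
    - rewrite ler_expR; have := ler_norm (rho x t); have := L0 t; lra.
  have b2 : `|f t * (x^-1 * (expR (rho x t) - 1))| <=
      K * expR (k * tuple_norm1 t) * expR (2 * L t).
    rewrite normrM ler_pM// normrM.
    have := ler_wpM2l (normr_ge0 x^-1) (norm_expRB1_le (rho x t)).
    move=> /le_trans; apply.
    have : `|x^-1| * (`|rho x t| * expR `|rho x t|) <= `|x^-1| * ((`|x| * L t) * expR (L t)).
      by rewrite ler_wpM2l// ler_pM// ler_expR.
    move=> /le_trans; apply; rewrite mulrA mulrA xx mul1r.
    rewrite (_ : 2 * L t = L t + L t); last by ring.
    by rewrite expRD ler_wpM2r ?expR_ge0// le_expR_norm.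
  apply: (le_trans (ler_normD _ _)); apply: (le_trans (lerD b1 b2)).
  rewrite -[leRHS]mulrA (_ : expR (2 * q) * expR ((k + 2 * A) * tuple_norm1 t) =
     expR (k * tuple_norm1 t) * expR (2 * L t)); last first.
    by rewrite -!expRD; congr expR; rewrite /L; ring.
  rewrite [leRHS]mulrDl -[K * _ * _]mulrA lerD2r ler_wpM2l//.
  rewrite ler_peMl ?expR_ge0// -expR0 ler_expR mulr_ge0//.
  exact: tuple_norm1_ge0.
have lim t : Fq x t @[x --> 0^'] --> D t - f t * tuple_lin a t.
  have E x : Fq x t = x^-1 * (f (tuple_shift (fun i => x * a i) t) - f t) * expR (rho x t)
      + f t * (x^-1 * (expR (rho x t) - 1)) by rewrite /Fq; ring.
  have dr := is_derive_expR_quad (- tuple_lin a t) (- (q / 2)).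
  have c1 : x^-1 * (expR (rho x t) - 1) @[x --> 0^'] --> - tuple_lin a t.
    have := is_derive_diff_quotient dr.
    by rewrite mulr0 expr0n mulr0 addr0 expR0.
  have c2 : expR (rho x t) @[x --> 0^'] --> (1 : R).
    have : {for (0:R), continuous (fun x => expR (rho x t))}.
      by apply/differentiable_continuous/derivable1_diffP; case: dr.
    move=> /continuous_withinNx /=.
    by rewrite /rho mulr0 expr0n mulr0 addr0 expR0.
  under eq_fun do rewrite E.
  rewrite -mulrN -[X in X + _]mulr1; apply: cvgD; first exact: cvgM.
  by apply: cvgM => //; exact: cvg_cst.
have mFq x : measurable_fun [set: n.-tuple TR] (Fq x).
  apply: measurable_funM => //; apply: measurable_funB => //.
  apply: measurable_funM; first exact: (measurableT_comp mf (measurable_tuple_shift _)).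
  apply: measurableT_comp => //; apply: measurable_funD => //.
  apply: measurable_funM => //; apply: measurableT_comp => //.
  exact: measurable_tuple_lin.
have [iD cD] := @cvg_Rintegral_dnbhs _ _ _ gauss Fq (fun t => D t - f t * tuple_lin a t)
  (fun t => (C + K) * expR (2 * q) * expR ((k + 2 * A) * tuple_norm1 t)) 1 ltr01
  (fun x _ _ => mFq x) (fun x t x0 x1 => dom x t x0 x1)
  (rintegrableZ _ (rintegrable_gauss_expR (addr_ge0 k0 (mulr_ge0 (ler0n R 2) A0)))) lim.
have Fq0 x : \int[gauss]_t Fq x t = 0.
  have [i1 e1] := gauss_shift (fun i => x * a i) fi.
  rewrite RintegralTZ; last first.
    apply: rintegrableB => //; apply: eq_integrable i1 => // t _ /=.
    by rewrite rhoE.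
  rewrite RintegralTB//; last first.
    by apply: eq_integrable i1 => // t _ /=; rewrite rhoE.
  rewrite -[X in _ * (_ - X)]e1; under [X in _ * (_ - X)]eq_Rintegral do rewrite rhoE.
  by rewrite subrr mulr0.
have I0 : \int[gauss]_t (D t - f t * tuple_lin a t) = 0.
  have c0 : \int[gauss]_t Fq x t @[x --> 0^'] --> (0 : R).
    by under eq_fun do rewrite Fq0; exact: cvg_cst.
  exact: (cvg_unique _ cD c0).
have i2 : rintegrable gauss (fun t => f t * tuple_lin a t).
  apply: (@rintegrable_gauss_growth _ (K * A) (k + 1)).
  - by rewrite addr_ge0.
  - apply: measurable_funM => //; exact: measurable_tuple_lin.
  - move=> t; rewrite normrM mulrDl mul1r expRD mulrACA ler_pM//.
    rewrite (le_trans (norm_tuple_lin_le _ _))// ler_wpM2l// le_expR_norm//.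
have i1 : rintegrable gauss D.
  apply: eq_integrable (rintegrableD iD i2) => // t _ /=.
  by rewrite subrK.
split => //; apply/eqP; rewrite -subr_eq0 -RintegralTB//.
exact/eqP.
Qed.

(** Integration by parts for the linear function [tuple_lin b], whose derivative along [a] is
    constant. *)
Lemma gauss_covariance a b :
  rintegrable gauss (fun t => tuple_lin b t * tuple_lin a t) /\
  \int[gauss]_t (tuple_lin b t * tuple_lin a t) = \sum_i b i * a i.
Proof.
have shiftE t x : tuple_lin b (tuple_shift (fun i => x * a i) t) =
    tuple_lin b t + x * \sum_i b i * a i.
  rewrite tuple_lin_shift; congr (_ + _); rewrite mulr_sumr.
  by apply: eq_bigr => i _; rewrite mulrCA.
have [] := @gauss_ibp a (tuple_lin b) (fun=> \sum_i b i * a i)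
  `|\sum_i b i * a i| (\sum_i `|b i|) 1 ler01.
- exact: measurable_tuple_lin.
- move=> t; rewrite (le_trans (norm_tuple_lin_le _ _))// mul1r.
  by rewrite ler_wpM2l ?le_expR_norm// sumr_ge0.
- by move=> t x; rewrite shiftE addrC addKr normrM mulrC.
- move=> t; apply: cvg_near_cst; near=> x.
  rewrite shiftE addrC addKr mulKf//; near: x; exact: nbhs_dnbhs_neq.
by move=> _ i; rewrite Rintegral_gauss_cst => <-.
Unshelve. all: by end_near. Qed.

End gaussian_ibp.

Section boxes.
Context d (T : measurableType d) (n : nat).

Definition box : set (set (n.-tuple T)) :=
  [set A | exists B : 'I_n -> set T, (forall i, measurable (B i)) /\
    A = [set t | forall i, B i (tnth t i)]].

Lemma boxE (B : 'I_n -> set T) : [set t : n.-tuple T | forall i, B i (tnth t i)] =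
  \bigcap_(i in [set: 'I_n]) ((fun t => tnth t i) @^-1` B i).
Proof. by apply/seteqP; split=> t /= h i; [move=> _|]; exact: h. Qed.

Lemma measurable_box A : box A -> measurable A.
Proof.
move=> [B [mB ->]]; rewrite boxE; apply: fin_bigcap_measurable => // i _.
by rewrite -[X in measurable X]setTI; exact: measurable_tnth.
Qed.

Lemma measurable_boxE : @measurable _ (n.-tuple T) = <<s box >>.
Proof.
apply/seteqP; split; last first.
  apply: smallest_sub; first exact: sigma_algebra_measurable.
  exact: measurable_box.
apply: smallest_sub; first exact: smallest_sigma_algebra.
move=> A; rewrite -bigcup_seq /=; move=> [i _ [B mB <-]]; rewrite setTI.
apply: sub_sigma_algebra; exists (fun j => if j == i then B else setT).
split=> [j|]; first by case: eqP.
apply/seteqP; split=> t /= h; first by move=> j; case: eqP => [->|].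
by have := h i; rewrite eqxx.
Qed.

End boxes.

Section gauss_law.
Context (R : realType).
Local Notation TR := (measurableTypeR R).
Local Open Scope ereal_scope.

(** Boxes are stable under intersection and generate the sigma-algebra of tuples, so a measure is
    determined by its values on them. *)
Lemma gauss_unique n (m : {measure set (n.-tuple TR) -> \bar R}) :
  (forall B : 'I_n -> set TR, (forall i, measurable (B i)) ->
    m [set t | forall i, B i (tnth t i)] = \prod_(i < n) normal_prob 0 1 (B i)) ->
  forall A, measurable A -> m A = gauss R n A.
Proof.
move=> hm A mA.
have setTE : [set: n.-tuple TR] = [set t | forall i, (fun=> setT) i (tnth t i)].
  by apply/seteqP; split.
apply: (@measure_unique _ _ _ (@box _ TR n) (fun=> setT)) => //.
- exact: measurable_boxE.
- move=> _ _ [B [mB ->]] [C [mC ->]]; exists (fun i => B i `&` C i); split.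
    by move=> i; exact: measurableI.
  apply/seteqP; split=> t /=.
    by move=> [h1 h2] i; split.
  by move=> h; split=> i; have [] := h i.
- move=> _; exists (fun=> setT); split=> //.
- by rewrite bigcup_const//; exists 0%N.
- by move=> _ [B [mB ->]]; rewrite hm//; exact/esym/measure_power_box.
- move=> _; rewrite setTE (hm (fun=> setT))// big1 ?ltry// => i _; exact: normal_prob_setT.
Qed.

(** Independence and normality of the entries are consumed here: past this point a Gaussian matrix
    is a function on the concrete space [gauss]. *)
Lemma gauss_law n dT (T : measurableType dT) (P : probability T R)
    (X : 'I_n -> {RV P >-> R}) :
  (forall i, standard_normal (X i)) -> mutually_independent X ->
  forall f : n.-tuple TR -> \bar R, measurable_fun setT f -> (forall t, 0 <= f t) ->
  \int[P]_w f [tuple (X i w : TR) | i < n] = \int[gauss R n]_t f t.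
Proof.
move=> hX iX f mf f0.
pose Y w : n.-tuple TR := [tuple (X i w : TR) | i < n].
have mY : measurable_fun [set: T] Y.
  apply/measurable_fun_tnthP => i.
  rewrite (_ : _ \o _ = X i); first exact: (@measurable_funPT _ _ _ _ (X i)).
  by apply/funext => w /=; rewrite tnth_mktuple.
rewrite -[LHS]/(\int[P]_w (f \o Y) w).
have := ge0_integral_pushforward mY P measurableT mf (fun t _ => f0 t).
rewrite preimage_setT => <-; apply: eq_measure_integral => A mA _.
apply: (gauss_unique (m := pushforward P Y)) mA => B mB.
rewrite /= /pushforward.
rewrite (_ : _ @^-1` _ = \bigcap_(i in [set i | i \in [set: 'I_n]%SET]) (X i @^-1` B i)); last first.
  apply/seteqP; split=> w /= h i.
    by move=> _; have := h i; rewrite tnth_mktuple.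
  by rewrite tnth_mktuple; apply: h; exact: finset.in_setT.
rewrite (iX [set: 'I_n]%SET)//; apply: eq_big => [i|i _]; first exact: finset.in_setT.
by have := hX i _ (mB i).
Qed.

Lemma gauss_marginal n (k : 'I_n) (f : TR -> \bar R) : measurable_fun setT f ->
  (forall x, 0 <= f x) ->
  \int[gauss R n]_t f (tnth t k) = \int[normal_prob 0 1]_x f x.
Proof.
move=> mf f0; have mk := @measurable_tnth _ TR n k.
rewrite -[LHS]/(\int[gauss R n]_t (f \o (fun t => tnth t k)) t).
have := ge0_integral_pushforward mk (gauss R n) measurableT mf (fun t _ => f0 t).
rewrite preimage_setT => <-; apply: eq_measure_integral => A mA _.
rewrite /pushforward.
have := @measure_power_box _ TR R (normal_prob 0 1) n (fun i => if i == k then A else setT).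
rewrite (bigD1 k)//= eqxx big1 => [|i /negPf ->]; last exact: normal_prob_setT.
rewrite mule1 => <-; last by move=> i; case: eqP.
congr (gauss R n _); apply/seteqP; split=> t /= h.
  by move=> i; case: eqP => // ->.
by have := h k; rewrite eqxx.
Qed.

Lemma integral_normal_norm :
  \int[normal_prob 0 1]_x (`|x : R|%R)%:E = (Num.sqrt (2 / pi))%:E.
Proof.
have mn : measurable_fun [set: R] (fun x : R => (`|x|%R)%:E).
  by apply/measurable_EFinP; exact: normr_measurable.
rewrite ge0_integral_normal//.
pose p : R := normal_peak 1%R.
pose g (x : R) : R := (expR (0 * x + - (1 / 2) * x ^+ 2))%R.
have gE x : (normal_pdf 0 1 x = p * g x)%R.
  rewrite normal_pdfE ?oner_eq0//= /normal_fun -/p; congr (_ * expR _)%R.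
  by field.
have dg x : is_derive (x : R) 1%R g (g x * (- x))%R.
  have := is_derive1_comp (is_derive_expR _) (is_derive_quad 0%R (- (1 / 2))%R x).
  by move=> h; apply: is_derive_eq h _; rewrite /g; congr (_ * _)%R; field.
have cg : continuous g.
  by move=> x; apply/differentiable_continuous/derivable1_diffP; case: (dg x).
under eq_integral do rewrite gE -EFinM.
rewrite (@ge0_symfun_integralT _ (fun x => `|x| * (p * g x)))%R; last 3 first.
- by move=> x; rewrite mulr_ge0// mulr_ge0 ?normal_peak_ge0// expR_ge0.
- move=> x; apply: cvgM; first exact: norm_continuous.
  by apply: cvgM; [exact: cvg_cst|exact: cg].
- by move=> x /=; rewrite normrN /g sqrrN !mul0r.
rewrite -set_itvcy.
rewrite (@eq_integral _ _ _ _ _ (fun x : TR => ((x : R) * (p * g x))%:E)); last first.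
  by move=> x; rewrite inE /= in_itv /= andbT => x0; rewrite ger0_norm.
pose F (x : R) : R := (- p * g x)%R.
have dF x : is_derive (x : R) 1%R F (x * (p * g x))%R.
  have -> : F = (- p \*: g)%R by apply/funext.
  have := is_deriveZ (- p)%R (dg x).
  by move=> h; apply: is_derive_eq h _; rewrite /GRing.scale /=; ring.
have cF : continuous F.
  by move=> x; apply/differentiable_continuous/derivable1_diffP; case: (dF x).
have F0 : F x @[x --> +oo%R] --> (0 : R)%R.
  rewrite -[X in _ --> X](mulr0 (- p)%R); apply: cvgM; first exact: cvg_cst.
  (* From (x - 1)^2 >= 0 one gets - x^2 / 2 <= 1 / 2 - x. *)
  apply: (@squeeze_cvgr _ _ _ _ (cst 0)%R (fun x => expR (1 / 2)%R * expR (- x)%R)%R).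
  - near=> x; rewrite expR_ge0 /= -expRD ler_expR.
    by have := sqr_ge0 (x - 1)%R; rewrite sqrrB1; lra.
  - exact: cvg_cst.
  - rewrite -[X in _ --> X](mulr0 (expR (1 / 2)%R)); apply: cvgM; first exact: cvg_cst.
    exact: cvgr_expR.
rewrite (@ge0_continuous_FTC2y _ _ F 0%R 0%R)//.
- rewrite /F /g !mul0r expr0n mulr0 addr0 expR0 mulr1 sub0e -EFinN -EFinM.
  rewrite opprK; congr EFin.
  have p0 : (0 <= 2 * p)%R by rewrite mulr_ge0// normal_peak_ge0.
  rewrite -[LHS](ger0_norm p0) -sqrtr_sqr; congr Num.sqrt.
  rewrite exprMn /p /normal_peak exprVn sqr_sqrtr; last first.
    by rewrite expr1n mul1r mulrn_wge0// pi_ge0.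
  rewrite expr1n mul1r -mulr_natr; move: (@pi R) (pi_gt0 R) => c c0.
  by field; rewrite gt_eqF.
- by move=> x x0; rewrite mulr_ge0// mulr_ge0 ?normal_peak_ge0// expR_ge0.
- apply: continuous_subspaceT => x; apply: cvgM; first exact: cvg_id.
  by apply: cvgM; [exact: cvg_cst|exact: cg].
- exact: (cvg_at_right_filter (cF 0%R)).
- by move=> x _; rewrite derive1E; case: (dF x).
Unshelve. all: by end_near. Qed.

End gauss_law.

(** * Congruences and the Lebesgue measure on symmetric matrices *)

Section congruence.
Context (R : realType) (d : nat).
Local Notation TR := (measurableTypeR R).
Local Notation leb := (@lebesgue_measure R).

Fact symcong_subproof (B : 'M[R]_d) (S : symmx R d) : B^T *m S *m B \in @issymmx R d.
Proof. by rewrite inE !trmx_mul trmxK trmx_symmx mulmxA. Qed.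

Lemma symmx_sym (S : symmx R d) a b : S a b = S b a.
Proof. by rewrite -{1}trmx_symmx mxE. Qed.

Definition symcong (B : 'M[R]_d) (S : symmx R d) : symmx R d :=
  SymMx (symcong_subproof B S).

Lemma measurable_mulmx_entry (B C : 'M[R]_d) i j :
  measurable_fun [set: symmx R d] (fun S : symmx R d => (B *m S *m C) i j).
Proof.
under eq_fun do rewrite mxE; apply: measurable_sum => k.
apply: measurable_funM => //; under eq_fun do rewrite mxE.
apply: measurable_sum => l; apply: measurable_funM => //.
exact: measurable_symmx_entry.
Qed.

Lemma measurable_symcong (B : 'M[R]_d) : measurable_fun [set: symmx R d] (symcong B).
Proof. by apply: measurable_fun_symmx => i j /=; exact: measurable_mulmx_entry. Qed.

Lemma upper_pair_eq (a b j k : 'I_d) :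
  (upper_pair a b == upper_pair j k) = ((a == j) && (b == k)) || ((a == k) && (b == j)).
Proof.
rewrite /upper_pair; case: (leqP a b) => ab; case: (leqP j k) => jk;
  rewrite xpair_eqE; apply/idP/idP.
- by move=> ->.
- move=> /orP[//|/andP[/eqP ak /eqP bj]]; subst.
  have -> : j = k by apply/val_inj/eqP; rewrite eqn_leq jk ab.
  by rewrite !eqxx.
- by move=> /andP[-> ->]; rewrite orbT.
- by move=> /orP[/andP[/eqP aj /eqP bk]|/andP[-> ->]//]; subst; rewrite leqNgt jk in ab.
- by move=> /andP[-> ->]; rewrite orbT.
- by move=> /orP[/andP[/eqP aj /eqP bk]|/andP[-> ->]//]; subst; rewrite leqNgt ab in jk.
- by move=> /andP[-> ->].
- move=> /orP[/andP[-> ->]//|/andP[/eqP ak /eqP bj]]; subst.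
  by have := ltn_trans ab jk; rewrite ltnn.
Qed.

Lemma upper_pair_mem (j k : 'I_d) : upper_pair j k \in upper_pairs d.
Proof.
rewrite mem_filter mem_enum andbT /upper_pair.
by case: ifPn => //=; rewrite -ltnNge => /ltnW.
Qed.

Fact symupd_subproof (j k : 'I_d) (x : R) (S : symmx R d) :
  \matrix_(a, b) (if upper_pair a b == upper_pair j k then x else S a b)
    \in @issymmx R d.
Proof.
rewrite inE; apply/eqP/matrixP => a b; rewrite !mxE !upper_pair_eq.
by rewrite orbC [_ && _]andbC [X in _ || X]andbC -[in RHS]trmx_symmx mxE.
Qed.

Definition symupd j k x S : symmx R d := SymMx (symupd_subproof j k x S).

Lemma symupdE j k x S a b : (symupd j k x S : 'M[R]_d) a b =
  if upper_pair a b == upper_pair j k then x else S a b.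
Proof. by rewrite mxE. Qed.

Definition upper_index (j k : 'I_d) : 'I_(size (upper_pairs d)) :=
  Ordinal (introT idP (etrans (index_mem _ _) (upper_pair_mem j k))).

Lemma symmx_of_upperE (t : (size (upper_pairs d)).-tuple TR) j k :
  (symmx_of_upper t : 'M[R]_d) j k = tnth t (upper_index j k).
Proof. by rewrite mxE (tnth_nth 0). Qed.

Lemma symmx_of_upper_set (t : (size (upper_pairs d)).-tuple TR) j k (x : R) :
  symmx_of_upper (set_tnth (upper_index j k) x t : _.-tuple TR) =
  symupd j k x (symmx_of_upper t).
Proof.
apply: symmx_eq; apply/matrixP => a b; rewrite symupdE !symmx_of_upperE tnth_mktuple.
rewrite -(inj_eq val_inj) /=.
have [->|ne] := eqVneq (upper_pair a b) (upper_pair j k); first by rewrite eqxx.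
case: eqP => // /(congr1 (nth (j, k) (upper_pairs d))).
by rewrite !nth_index ?upper_pair_mem// => e; rewrite e eqxx in ne.
Qed.

Local Open Scope ereal_scope.

Lemma ge0_integral_lebesgue_symmx (f : symmx R d -> \bar R) :
  measurable_fun [set: symmx R d] f -> (forall S, 0 <= f S) ->
  \int[@lebesgue_symmx R d]_S f S =
  \int[power_measure leb (size (upper_pairs d))]_t f (symmx_of_upper t).
Proof.
move=> mf f0.
rewrite -[LHS]/(\int[pushforward (power_measure leb (size (upper_pairs d)))
  (@symmx_of_upper R d)]_t f t).
by rewrite ge0_integral_pushforward// preimage_setT.
Qed.

Lemma ge0_integral_symupd j k (a : R) (c : symmx R d -> R) (f : symmx R d -> \bar R) :
  (0 < a)%R -> measurable_fun [set: symmx R d] c ->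
  (forall x S, c (symupd j k x S) = c S) ->
  measurable_fun [set: symmx R d] f -> (forall S, 0 <= f S) ->
  \int[@lebesgue_symmx R d]_S f S =
  a%:E * \int[@lebesgue_symmx R d]_S f (symupd j k (a * S j k + c S)%R S).
Proof.
move=> a0 mc cu mf f0.
have mu : measurable_fun [set: symmx R d]
    (fun S : symmx R d => symupd j k (a * S j k + c S)%R S).
  apply: measurable_fun_symmx => i l; under eq_fun do rewrite symupdE.
  case: eqP => _; last exact: measurable_symmx_entry.
  apply: measurable_funD => //; apply: measurable_funM => //.
  exact: measurable_symmx_entry.
rewrite !ge0_integral_lebesgue_symmx//; last exact: (measurableT_comp mf mu).
rewrite (@ge0_integral_power_affine _ _ (upper_index j k) a (c \o @symmx_of_upper R d))//.
- congr (_ * _); apply: eq_integral => t _.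
  by rewrite symmx_of_upper_set symmx_of_upperE.
- exact: measurableT_comp.
- by move=> x t /=; rewrite symmx_of_upper_set cu.
- exact: (measurableT_comp mf).
Qed.

Section transvection.
Variables (i j : 'I_d) (s : R).

Definition transvection : 'M[R]_d := 1%:M + s *: delta_mx i j.
Local Notation B := transvection.
Local Notation b := (1 + s * (i == j)%:R)%R.

Lemma transvection_congE (S : symmx R d) a c :
  ((B^T *m S *m B) a c = S a c + s * (c == j)%:R * S a i
    + s * (a == j)%:R * S i c
    + s ^+ 2 * ((a == j) && (c == j))%:R * S i i)%R.
Proof.
have dE (A : 'M[R]_d) a' c' : ((A *m delta_mx i j) a' c' = (c' == j)%:R * A a' i)%R.
  rewrite mxE (bigD1 i)//= big1 ?addr0; last first.
    by move=> k /negPf ki; rewrite mxE ki mulr0.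
  by rewrite mxE eqxx mulrC.
have dTE (A : 'M[R]_d) a' c' : ((delta_mx j i *m A) a' c' = (a' == j)%:R * A i c')%R.
  rewrite mxE (bigD1 i)//= big1 ?addr0; last first.
    by move=> k /negPf ki; rewrite mxE ki andbF mul0r.
  by rewrite mxE eqxx andbT.
have -> : (B^T = 1%:M + s *: delta_mx j i)%R.
  by apply/matrixP => p q; rewrite !mxE eq_sym andbC.
rewrite /transvection [(1%:M + _) *m _]mulmxDl mul1mx -scalemxAl.
rewrite mulmxDr mulmx1 -scalemxAr mulmxDl -scalemxAl -mulmxA.
move: (dE S a c) (dTE S a c) (dE S i c).
set W := (S *m delta_mx i j)%R; have := dTE W a c.
set V := (delta_mx j i *m S)%R; set U := (delta_mx j i *m W)%R.
clearbody U V W => h3 h1 h2 h4.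
rewrite !mxE h1 h2 h3 h4.
by case: (a == j); case: (c == j); rewrite /=; ring.
Qed.

(* The entries of row and column [j] whose other index is in [l]: the congruence
   by a transvection only changes row and column [j], and is performed one entry
   at a time, each step being affine in that entry. *)
Definition in_part (l : seq 'I_d) (a c : 'I_d) : bool :=
  ((a == j) && (c \in l)) || ((c == j) && (a \in l)).

Fact transvection_part_subproof (l : seq 'I_d) (S : symmx R d) :
  \matrix_(a, c) (if in_part l a c then (symcong B S : 'M[R]_d) a c
     else S a c)%R \in @issymmx R d.
Proof.
rewrite inE; apply/eqP/matrixP => a c; rewrite mxE [LHS]mxE [RHS]mxE.
by rewrite /in_part orbC !(symmx_sym _ a c).
Qed.

Definition transvection_part l S : symmx R d := SymMx (transvection_part_subproof l S).

Lemma transvection_partE l S a c : (transvection_part l S : 'M[R]_d) a c =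
  if in_part l a c then (symcong B S : 'M[R]_d) a c else S a c.
Proof. by rewrite mxE. Qed.

(** For c in [l], hence different from j and k, the entry (j, c) of the congruence does not involve
    the entry (j, k). Updating (j, k) first therefore leaves the later updates unchanged. *)
Lemma transvection_part_upd l k (S : symmx R d) : j \notin l -> k \notin l ->
  transvection_part l (symupd j k ((symcong B S : 'M[R]_d) j k) S) =
  transvection_part (k :: l) S.
Proof.
move=> jl kl; apply: symmx_eq; apply/matrixP => a c.
have row c' : c' \in l ->
    (symcong B (symupd j k ((symcong B S : 'M[R]_d) j k) S) : 'M[R]_d) j c' =
    (symcong B S : 'M[R]_d) j c'.
  move=> cl; have cj : (c' == j) = false by apply: contraNF jl => /eqP <-.
  have ck : (c' == k) = false by apply: contraNF kl => /eqP <-.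
  rewrite !transvection_congE !symupdE !upper_pair_eq !cj !ck !andbF /=.
  by rewrite !mulr0 !mul0r.
rewrite !transvection_partE; case: ifPn => [|hl].
  rewrite {2}/in_part !inE; move=> /orP[/andP[/eqP -> cl]|/andP[/eqP -> al]].
    by rewrite eqxx cl orbT row.
  by rewrite eqxx al !orbT (symmx_sym _ a j) row// symmx_sym.
rewrite symupdE upper_pair_eq; move: hl; rewrite /in_part !inE.
rewrite negb_or => /andP[h1 h2].
have -> : (a == j) && ((c == k) || (c \in l)) || (c == j) && ((a == k) || (a \in l)) =
    ((a == j) && (c == k)) || ((a == k) && (c == j)).
  move: h1 h2; move: (a == j) (c == j) (c \in l) (a \in l) (a == k) (c == k).
  by do 6 case.
case: ifPn => // /orP[/andP[/eqP -> /eqP ->//]|/andP[/eqP -> /eqP ->]].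
by rewrite symmx_sym.
Qed.

Lemma transvection_part_full (l : seq 'I_d) S : (forall k, k \in l) ->
  transvection_part l S = symcong B S.
Proof.
move=> hl; apply: symmx_eq; apply/matrixP => a c; rewrite transvection_partE.
rewrite /in_part !hl !andbT; case: ifPn => //; rewrite negb_or => /andP[/negPf aj /negPf cj].
by rewrite [RHS]transvection_congE aj cj !mulr0 !mul0r !addr0.
Qed.

Lemma measurable_transvection_part l : measurable_fun [set: symmx R d] (transvection_part l).
Proof.
apply: measurable_fun_symmx => a c; under eq_fun do rewrite transvection_partE.
case: (in_part l a c); last exact: measurable_symmx_entry.
exact: measurable_mulmx_entry.
Qed.

Lemma ge0_integral_transvection_upd (k : 'I_d) (f : symmx R d -> \bar R) : (0 < b)%R ->
  measurable_fun [set: symmx R d] f -> (forall S, 0 <= f S) ->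
  \int[@lebesgue_symmx R d]_S f S = (b ^+ (k == j).+1)%:E *
    \int[@lebesgue_symmx R d]_S f (symupd j k ((symcong B S : 'M[R]_d) j k) S).
Proof.
move=> b0 mf f0.
(* For i = j the entries of row j are multiplied by b and the diagonal one by b^2, without offset;
   for i different from j one has b = 1 and the update is a translation. *)
pose c (S : symmx R d) : R := (if i == j then 0 else
  s * S i k + (k == j)%:R * (s * S j i + s ^+ 2 * S i i))%R.
have mc : measurable_fun [set: symmx R d] c.
  rewrite /c; case: (i == j) => //; apply: measurable_funD; last apply: measurable_funM => //.
    by apply: measurable_funM => //; exact: measurable_symmx_entry.
  by apply: measurable_funD; apply: measurable_funM => //; exact: measurable_symmx_entry.
rewrite (@ge0_integral_symupd j k (b ^+ (k == j).+1)%R c)//.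
- congr (_ * _); apply: eq_integral => S _; congr (f (symupd _ _ _ _)).
  rewrite [RHS]transvection_congE eqxx /c.
  have [ij|ij] := eqVneq i j.
    subst i; case: eqP => [->|_] /=; rewrite ?expr1 ?expr2; ring.
  rewrite /=; case: eqP => [->|_] /=; last by rewrite mulr0 addr0 expr1; ring.
  by rewrite mulr0 addr0 expr1n; ring.
- exact: exprn_gt0.
- move=> x S; rewrite /c; have [//|ij] := eqVneq i j.
  rewrite !symupdE !upper_pair_eq; have [kj|kj] := eqVneq k j.
    by rewrite !(negPf ij) !andbF /= kj !(negPf ij) ?andbF.
  by rewrite !(negPf ij) /= ?andbF ?mul0r.
Qed.

Lemma ge0_integral_transvection_part (l : seq 'I_d) (f : symmx R d -> \bar R) :
  (0 < b)%R -> uniq l -> j \notin l ->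
  measurable_fun [set: symmx R d] f -> (forall S, 0 <= f S) ->
  \int[@lebesgue_symmx R d]_S f S =
  (b ^+ size l)%:E * \int[@lebesgue_symmx R d]_S f (transvection_part l S).
Proof.
move=> b0; elim: l f => [|k l IH] f.
  move=> _ _ mf f0; rewrite expr0 mul1e; apply: eq_integral => S _; congr f.
  by apply: symmx_eq; apply/matrixP => a c; rewrite transvection_partE /in_part !andbF.
rewrite /= inE negb_or => /andP[kl ul] /andP[jk jl] mf f0.
rewrite IH// (@ge0_integral_transvection_upd k (f \o transvection_part l))//.
- rewrite [k == j]eq_sym (negPf jk) expr1 muleA -EFinM -exprSr; congr (_ * _).
  by apply: eq_integral => S _ /=; rewrite transvection_part_upd.
- exact: (measurableT_comp mf (measurable_transvection_part l)).
- by move=> S; exact: f0.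
Qed.

(** The d - 1 off-diagonal entries of row j contribute b each and the diagonal entry b^2. As b is
    the determinant of the transvection, the factor b^(d+1) is the Jacobian of a congruence on
    symmetric matrices. *)
Lemma ge0_integral_transvection (f : symmx R d -> \bar R) : (0 < b)%R ->
  measurable_fun [set: symmx R d] f -> (forall S, 0 <= f S) ->
  \int[@lebesgue_symmx R d]_S f S =
  (b ^+ d.+1)%:E * \int[@lebesgue_symmx R d]_S f (symcong B S).
Proof.
move=> b0 mf f0; pose l := rem j (enum 'I_d).
have ul : uniq l by apply: rem_uniq; exact: enum_uniq.
have jl : j \notin l by rewrite mem_rem_uniq ?enum_uniq// inE eqxx.
have sl : ((size l).+2 = d.+1)%N.
  rewrite size_rem ?mem_enum// size_enum_ord prednK//.
  by case: (d) j => [[]|].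
rewrite (ge0_integral_transvection_part b0 ul jl)//.
rewrite (@ge0_integral_transvection_upd j (f \o transvection_part l))//.
- rewrite eqxx muleA -EFinM -exprD addn2 sl; congr (_ * _).
  apply: eq_integral => S _ /=; rewrite transvection_part_upd// transvection_part_full//.
  move=> k; rewrite inE; case: eqP => //= /eqP kj.
  by rewrite mem_rem_uniq ?enum_uniq// inE kj mem_enum.
- exact: (measurableT_comp mf (measurable_transvection_part l)).
- by move=> S; exact: f0.
Qed.

End transvection.

Lemma ge0_integral_symscale (a : R) (f : symmx R d -> \bar R) : (0 < a)%R ->
  measurable_fun [set: symmx R d] f -> (forall S, 0 <= f S) ->
  \int[@lebesgue_symmx R d]_S f S =
  (a ^+ size (upper_pairs d))%:E * \int[@lebesgue_symmx R d]_S f (a *: S).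
Proof.
move=> a0 mf f0.
have ms : measurable_fun [set: symmx R d] (fun S => a *: S).
  apply: measurable_fun_symmx => i j; under eq_fun do rewrite mxE.
  by apply: measurable_funM => //; exact: measurable_symmx_entry.
rewrite !ge0_integral_lebesgue_symmx//; last exact: (measurableT_comp mf ms).
rewrite (ge0_integral_power_scale a0)//; last exact: (measurableT_comp mf).
congr (_ * _); apply: eq_integral => t _; congr f.
apply: symmx_eq; apply/matrixP => i j.
by rewrite symmx_of_upperE tnth_mktuple mxE symmx_of_upperE.
Qed.

End congruence.

Section transvection_det.
Context (R : realType) (d : nat).

Lemma det_transvection (i j : 'I_d) (s : R) :
  \det (transvection i j s) = 1 + s * (i == j)%:R.
Proof.
have E k l : transvection i j s k l = (k == l)%:R + s * ((k == i) && (l == j))%:R.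
  by rewrite !mxE.
have prodE : \prod_k (transvection i j s) k k = 1 + s * (i == j)%:R.
  rewrite (bigD1 i)//= big1 ?mulr1 => [|k /negPf ki].
    by rewrite E !eqxx.
  by rewrite E ki eqxx mulr0 addr0.
have [ij|ij] := leqP j i.
  rewrite det_trig//; apply/is_trig_mxP => k l kl; rewrite E.
  rewrite -(inj_eq val_inj) /= ltn_eqF// add0r.
  case: (k =P i) => [ki|]; rewrite /= ?mulr0//.
  case: (l =P j) => [lj|]; rewrite /= ?mulr0//.
  by move: kl; rewrite ki lj ltnNge ij.
rewrite -det_tr det_trig; last first.
  apply/is_trig_mxP => k l kl; rewrite mxE E.
  rewrite -(inj_eq val_inj) /= gtn_eqF// add0r.
  case: (l =P i) => [ki|]; rewrite /= ?mulr0//.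
  case: (k =P j) => [lj|]; rewrite /= ?mulr0//.
  by move: kl; rewrite ki lj ltnNge (ltnW ij).
by rewrite -prodE; apply: eq_bigr => k _; rewrite mxE.
Qed.

End transvection_det.

(** * Integration by parts for the Wishart law *)

Section wishart_identity.
Context (R : realType) (d : nat).
Variables (alpha : R) (Sigma : symmx R d).
Hypothesis Sigma_pd : posdefmx Sigma.
Variable mu : probability (symmx R d) R.
Hypothesis muE : forall A : set (symmx R d), measurable A -> mu A =
  (\int[@lebesgue_symmx R d]_(X in A `&` [set X | posdefmx X])
     (wishart_pdf alpha Sigma X)%:E)%E.

Local Notation Si := (invmx (Sigma : 'M[R]_d)).
Local Notation PD := [set X : symmx R d | posdefmx X].
Local Notation pdf := (wishart_pdf alpha Sigma).

Definition wishart_tr (S : symmx R d) : R := \tr (Si *m S).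

Lemma measurable_wishart_tr : measurable_fun [set: symmx R d] wishart_tr.
Proof.
apply: measurable_sum => i; have := @measurable_mulmx_entry R d Si 1%:M i i.
by apply: eq_measurable_fun => S _; rewrite mulmx1.
Qed.

Lemma measurable_wishart_pdf : measurable_fun [set: symmx R d] pdf.
Proof.
apply: measurable_funM => //; apply: measurable_funM.
  apply: (@measurableT_comp _ _ _ _ _ _ (@powR R ^~ (alpha / 2 - (d%:R + 1) / 2))).
    exact: measurable_powR.
  exact: measurable_det.
apply: measurableT_comp => //; apply: measurable_funM => //.
apply: measurableT_comp => //; exact: measurable_wishart_tr.
Qed.

Lemma Gamma_ge0 (x : R) : 0 <= Gamma x.
Proof. by apply: Rintegral_ge0 => t _; rewrite mulr_ge0 ?powR_ge0 ?expR_ge0. Qed.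

Lemma wishart_pdf_ge0 S : 0 <= pdf S.
Proof.
rewrite divr_ge0// ?mulr_ge0 ?powR_ge0 ?expR_ge0//.
by apply: prodr_ge0 => k _; exact: Gamma_ge0.
Qed.

Definition wishart_dens : symmx R d -> R := pdf \_ PD.

Lemma wishart_densE S : posdefmx S -> wishart_dens S = pdf S.
Proof. by move=> pS; rewrite /wishart_dens patchE mem_set. Qed.

Lemma wishart_dens0 S : ~ posdefmx S -> wishart_dens S = 0.
Proof. by move=> pS; rewrite /wishart_dens patchE memNset. Qed.

Lemma wishart_dens_ge0 S : 0 <= wishart_dens S.
Proof.
rewrite /wishart_dens patchE; case: ifP => // _; exact: wishart_pdf_ge0.
Qed.

Lemma measurable_wishart_dens : measurable_fun [set: symmx R d] wishart_dens.
Proof.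
apply/(measurable_restrictT pdf (@measurable_posdefmx R d)).
exact: measurable_funTS measurable_wishart_pdf.
Qed.

Lemma ge0_integral_wishart (f : symmx R d -> \bar R) :
  measurable_fun [set: symmx R d] f -> (forall S, 0 <= f S)%E ->
  (\int[mu]_S f S = \int[@lebesgue_symmx R d]_S (f S * (wishart_dens S)%:E))%E.
Proof.
move=> mf f0; apply: ge0_integral_density => //.
- exact: measurable_wishart_dens.
- exact: wishart_dens_ge0.
move=> A mA; apply: etrans (muE mA) _; rewrite integral_mkcondr.
by apply: eq_integral => S _; rewrite /wishart_dens restrict_EFin.
Qed.

Lemma posdefmx_symcong (B : 'M[R]_d) (S : symmx R d) : B \in unitmx ->
  posdefmx (symcong B S) <-> posdefmx S.
Proof.
move=> Bu; split=> pS; last exact: pdmx_congr pS.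
have Biu : invmx B \in unitmx by rewrite unitmx_inv.
have := pdmx_congr Biu pS; rewrite /= trmx_inv !mulmxA mulVmx ?unitmx_tr// mul1mx.
by rewrite -mulmxA mulmxV// mulmx1.
Qed.

(** The Jacobian det B^(d+1) cancels the part -(d+1)/2 of the exponent of the determinant, so that
    only det B^alpha survives. This is the origin of the term alpha tr M in the integration by
    parts. *)
Lemma wishart_dens_symcong (B : 'M[R]_d) (S : symmx R d) : 0 < \det B ->
  \det B ^+ d.+1 * wishart_dens (symcong B S) =
  wishart_dens S * (\det B `^ alpha *
    expR (- (wishart_tr (symcong B S) - wishart_tr S) / 2)).
Proof.
move=> b0; have Bu : B \in unitmx by rewrite unitmxE unitfE gt_eqF.
have [pS|nS] := pselect (posdefmx S); last first.
  rewrite (wishart_dens0 nS) mul0r wishart_dens0 ?mulr0//.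
  by move=> h; apply: nS; apply/(posdefmx_symcong S Bu).
rewrite (wishart_densE pS) wishart_densE; last exact/(posdefmx_symcong S Bu).
rewrite /wishart_pdf -/(wishart_tr S) -/(wishart_tr (symcong B S)).
have dS := pdmx_det_gt0 (trmx_symmx S) pS.
have -> : \det (symcong B S : 'M[R]_d) = \det B ^+ 2 * \det (S : 'M[R]_d).
  by rewrite /= !det_mulmx det_tr; ring.
rewrite powRM ?sqr_ge0//; last exact: ltW.
have -> : - (wishart_tr (symcong B S) - wishart_tr S) / 2 =
  - wishart_tr (symcong B S) / 2 + wishart_tr S / 2 by field.
have h : - wishart_tr S / 2 + wishart_tr S / 2 = 0 by field.
have h' : expR (- wishart_tr S / 2) * expR (wishart_tr S / 2) = 1.
  by rewrite -expRD h expR0.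
have hb : \det B `^ alpha = \det B ^+ d.+1 * (\det B ^+ 2) `^ (alpha / 2 - (d%:R + 1) / 2).
  rewrite -!powR_mulrn ?ltW// -powRrM -powRD; last by apply/implyP => _; rewrite gt_eqF.
  by congr powR; rewrite -[d.+1%:R]natr1; field.
rewrite hb expRD.
set x := expR (- wishart_tr S / 2) in h' *; set y := expR (wishart_tr S / 2) in h' *.
set D := (_ `^ _ * _)^-1.
transitivity ((\det B ^+ d.+1 * ((\det B ^+ 2) `^ (alpha / 2 - (d%:R + 1) / 2) *
  \det S `^ (alpha / 2 - (d%:R + 1) / 2) *
    expR (- wishart_tr (symcong B S) / 2) * D)) * (x * y)).
  by rewrite h' mulr1.
by ring.
Qed.

(** Jacobian of the congruence times the ratio of the densities after and before it. *)
Definition transvection_weight i j x (S : symmx R d) : R :=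
  (1 + x * (i == j)%:R) `^ alpha *
  expR (- (wishart_tr (symcong (transvection i j x) S) - wishart_tr S) / 2).

Lemma measurable_transvection_weight i j x :
  measurable_fun [set: symmx R d] (transvection_weight i j x).
Proof.
apply: measurable_funM => //; apply: measurableT_comp => //.
apply: measurable_funM => //; apply: measurableT_comp => //; apply: measurable_funB.
  exact: (measurableT_comp measurable_wishart_tr (measurable_symcong _)).
exact: measurable_wishart_tr.
Qed.

Lemma wishart_transvection i j x (f : symmx R d -> R) : 0 < 1 + x * (i == j)%:R ->
  rintegrable mu f ->
  rintegrable mu (fun S => f (symcong (transvection i j x) S) * transvection_weight i j x S)
  /\ \int[mu]_S (f (symcong (transvection i j x) S) * transvection_weight i j x S) =
    \int[mu]_S f S.
Proof.
move=> b0 fi.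
apply: (weighted_transport (measurable_symcong _) (measurable_transvection_weight i j x) _ _ fi).
  by move=> S; rewrite mulr_ge0 ?powR_ge0 ?expR_ge0.
move=> F mF F0.
have mdens : measurable_fun [set: symmx R d] (fun S => (wishart_dens S)%:E).
  by apply/measurable_EFinP; exact: measurable_wishart_dens.
have mFq : measurable_fun [set: symmx R d] (fun S => F S * (wishart_dens S)%:E)%E.
  exact: emeasurable_funM.
rewrite ge0_integral_wishart// ge0_integral_wishart//; last 2 first.
- apply: emeasurable_funM; last first.
    by apply/measurable_EFinP; exact: measurable_transvection_weight.
  exact: (measurableT_comp mF (measurable_symcong _)).
- by move=> S; rewrite mule_ge0// lee_fin mulr_ge0 ?powR_ge0 ?expR_ge0.
rewrite (ge0_integral_transvection b0)//; last first.
  by move=> S; rewrite mule_ge0// lee_fin wishart_dens_ge0.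
rewrite -ge0_integralZl//; last 3 first.
- exact: (measurableT_comp mFq (measurable_symcong _)).
- by move=> S _; rewrite mule_ge0// lee_fin wishart_dens_ge0.
- by rewrite lee_fin exprn_ge0// ltW.
apply: eq_integral => S _.
rewrite muleCA -muleA; congr (_ * _)%E; rewrite -!EFinM; congr EFin.
rewrite /transvection_weight -!det_transvection wishart_dens_symcong ?det_transvection//.
by rewrite mulrC.
Qed.

(* The dilation [S |-> S / 4] turns the normalization of the density into an exponential moment. *)
Lemma wishart_expR_tr_lty : (\int[mu]_S (expR (3 / 8 * wishart_tr S))%:E < +oo)%E.
Proof.
have mdens : measurable_fun [set: symmx R d] (fun S => (wishart_dens S)%:E).
  by apply/measurable_EFinP; exact: measurable_wishart_dens.
have mexp : measurable_fun [set: symmx R d] (fun S => (expR (3 / 8 * wishart_tr S))%:E).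
  apply/measurable_EFinP; apply: measurableT_comp => //; apply: measurable_funM => //.
  exact: measurable_wishart_tr.
rewrite ge0_integral_wishart//.
have T1 : mu [set: symmx R d] = 1%E by exact: probability_setT.
(* Under S / 4 the exponent - tr / 2 becomes - tr / 8 = 3/8 tr - tr / 2, which explains the constant
   3/8. *)
have q0 : 0 < (4 : R)^-1 by rewrite invr_gt0.
pose e := alpha / 2 - (d%:R + 1) / 2.
pose c := ((4 : R)^-1 ^+ size (upper_pairs d)) * ((4 : R)^-1 ^+ d) `^ e.
have c0 : 0 < c by rewrite mulr_gt0 ?exprn_gt0// powR_gt0// exprn_gt0.
have E S : (4 : R)^-1 ^+ size (upper_pairs d) * wishart_dens ((4 : R)^-1 *: S) =
   c * (expR (3 / 8 * wishart_tr S) * wishart_dens S).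
  have [pS|nS] := pselect (posdefmx S); last first.
    rewrite (wishart_dens0 nS) !mulr0 wishart_dens0 ?mulr0//.
    move=> h; apply: nS => x x0; have := h x x0.
    by rewrite -scalemxAr -scalemxAl mxE pmulr_rgt0.
  rewrite (wishart_densE pS) wishart_densE; last first.
    by move=> x x0; rewrite /= -scalemxAr -scalemxAl mxE pmulr_rgt0// pS.
  have dS := pdmx_det_gt0 (trmx_symmx S) pS.
  rewrite /wishart_pdf /= detZ -scalemxAr mxtraceZ -/(wishart_tr S).
  rewrite powRM ?exprn_ge0 ?ltW// -/e /c.
  have -> : - (4^-1 * wishart_tr S) / 2 = 3 / 8 * wishart_tr S + - wishart_tr S / 2 by field.
  by rewrite expRD; ring.
have : (\int[mu]_S (cst 1%E S) = 1)%E by rewrite integral_cst// mul1e; exact: T1.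
rewrite ge0_integral_wishart//.
rewrite (ge0_integral_symscale q0)//; last 2 first.
- exact: emeasurable_funM.
- by move=> S; rewrite mule_ge0// lee_fin ?wishart_dens_ge0.
have ms : measurable_fun [set: symmx R d] (fun S : symmx R d => (4 : R)^-1 *: S).
  apply: measurable_fun_symmx => i j; under eq_fun do rewrite mxE.
  by apply: measurable_funM => //; exact: measurable_symmx_entry.
have md4 : measurable_fun [set: symmx R d] (fun S => (wishart_dens ((4 : R)^-1 *: S))%:E).
  exact: (measurableT_comp mdens ms).
under eq_integral do rewrite mul1e.
rewrite -ge0_integralZl//; try by [rewrite lee_fin exprn_ge0// ltW|
  move=> S _; rewrite lee_fin wishart_dens_ge0].
under eq_integral do rewrite -EFinM E EFinM.
rewrite ge0_integralZl//; try by [rewrite lee_fin ltW|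
  under eq_fun do rewrite EFinM; exact: emeasurable_funM|
  move=> S _; rewrite lee_fin mulr_ge0 ?expR_ge0 ?wishart_dens_ge0].
under eq_integral do rewrite EFinM.
(* [c] times the integral equals 1 with [c] positive, which excludes the value +oo. *)
case: (\int[_]_S _)%E => [r _|H|_]; first by rewrite ltry.
  by move: H; rewrite gt0_muley ?lte_fin.
by rewrite ltNye.
Qed.

(** On positive definite matrices [pdmx_frob_le] bounds the Frobenius norm by tr Sigma times
    [wishart_tr], so the exponential moment of the trace passes to the norm. *)
Lemma wishart_exp_moment : exists2 delta : R, 0 < delta &
  rintegrable mu (fun S => expR (delta * frob_norm S)).
Proof.
have mtr : 0 <= \tr (Sigma : 'M[R]_d).
  have [Q [QT _ QQ]] := pdmx_sqrt (trmx_symmx Sigma) Sigma_pd.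
  by rewrite -QQ -{1}QT -sqr_frob_norm sqr_ge0.
pose delta := 3 / 8 / (\tr (Sigma : 'M[R]_d) + 1).
have t0 : 0 < \tr (Sigma : 'M[R]_d) + 1 by rewrite ltr_wpDl.
have d0 : 0 < delta by rewrite !divr_gt0.
exists delta => //.
have mexp : measurable_fun [set: symmx R d] (fun S : symmx R d => expR (delta * frob_norm S)).
  apply: measurableT_comp => //; apply: measurable_funM => //.
  exact: measurable_frob_norm.
apply: ge0_rintegrable => //.
apply: le_lt_trans wishart_expR_tr_lty.
have mdens : measurable_fun [set: symmx R d] (fun S => (wishart_dens S)%:E).
  by apply/measurable_EFinP; exact: measurable_wishart_dens.
have mexp2 : measurable_fun [set: symmx R d] (fun S => (expR (3 / 8 * wishart_tr S))%:E).
  apply/measurable_EFinP; apply: measurableT_comp => //; apply: measurable_funM => //.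
  exact: measurable_wishart_tr.
have mexp1 : measurable_fun [set: symmx R d] (fun S : symmx R d => (expR (delta * frob_norm S))%:E).
  exact/measurable_EFinP.
rewrite !ge0_integral_wishart//; try by move=> S; rewrite lee_fin expR_ge0.
apply: ge0_le_integral => //; try by [exact: emeasurable_funM|
  move=> S _; rewrite mule_ge0 ?lee_fin ?expR_ge0 ?wishart_dens_ge0].
(* Off the positive definite matrices the comparison of exponents may fail, but there the density
   vanishes. *)
move=> S _; have [pS|nS] := pselect (posdefmx S); last first.
  by rewrite (wishart_dens0 nS) !mule0.
rewrite lee_wpmul2r ?lee_fin ?wishart_dens_ge0// ler_expR /delta.
have h := pdmx_frob_le (trmx_symmx Sigma) Sigma_pd (trmx_symmx S) pS.
have tau0 := pdmx_trace_ge0 (trmx_symmx Sigma) Sigma_pd (trmx_symmx S) pS.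
rewrite mulrAC ler_pdivrMr// -/(wishart_tr S) in h tau0 *.
move: h; rewrite (_ : 3 / 8 * wishart_tr S * (\tr Sigma + 1) =
  3 / 8 * (\tr Sigma * wishart_tr S + wishart_tr S)); last by ring.
by rewrite -/(wishart_tr S); lra.
Qed.

End wishart_identity.

(** * Directional derivatives of Lipschitz functions *)

Section gateaux.
Context (R : realType) (d : nat).
Implicit Types (f : symmx R d -> R) (Df : symmx R d -> symmx R d -> R).

Definition frob_lipschitz f (L : R) := forall S T : symmx R d,
  `|f S - f T| <= L * frob_norm ((S : 'M[R]_d) - T).

(** Directional derivatives are enough: for a Lipschitz function they also give the derivative along
    curves, by [gateaux_curve]. Linearity in the direction does not follow from this and is the
    separate condition [linear_form]. *)
Definition gateaux f Df := forall S V : symmx R d,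
  x^-1 * (f (S + x *: V) - f S) @[x --> 0^'] --> Df S V.

Definition linear_form Df := forall (S : symmx R d) (a : R) (U V : symmx R d),
  Df S (a *: U + V) = a * Df S U + Df S V.

Lemma linear_formZ Df S a U : linear_form Df -> Df S (a *: U) = a * Df S U.
Proof.
move=> h; have h0 : Df S 0 = 0.
  by have := h S 1 0 0; rewrite scale1r addr0; lra.
by rewrite -[a *: U]addr0 h h0 addr0.
Qed.

Lemma linear_formD Df S U V : linear_form Df -> Df S (U + V) = Df S U + Df S V.
Proof. by move=> h; rewrite -[U in LHS]scale1r h mul1r. Qed.

Lemma linear_form_sum Df S (I : finType) (F : I -> symmx R d) : linear_form Df ->
  Df S (\sum_i F i) = \sum_i Df S (F i).
Proof.
move=> h; elim/big_rec2: _ => [|i x y _ <-]; last exact: linear_formD.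
by rewrite -(scale0r 0) linear_formZ// mul0r.
Qed.

Lemma frob_lipschitz_ge0 f L : (0 < d)%N -> frob_lipschitz f L -> 0 <= L.
Proof.
move=> d0 /(_ (sympart 1%:M) 0).
rewrite subr0 => /(le_trans (normr_ge0 _)); rewrite pmulr_lge0//.
rewrite lt_neqAle frob_norm_ge0 andbT eq_sym; apply/eqP => /frob_norm_eq0.
move=> /matrixP/(_ (Ordinal d0) (Ordinal d0)); rewrite !mxE eqxx /=; lra.
Qed.

Lemma frob_lipschitz_growth f L S : frob_lipschitz f L -> 0 <= L ->
  `|f S| <= (`|f 0| + L) * (1 + frob_norm S).
Proof.
move=> fL L0; have := fL S 0; rewrite subr0 => h.
have := ler_normD (f S - f 0) (f 0); rewrite subrK => /le_trans; apply.
have f0 := normr_ge0 (f 0); have s0 := frob_norm_ge0 (S : 'M[R]_d).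
have := mulr_ge0 f0 s0; move: h; lra.
Qed.

(** A congruence by a transvection is quadratic in x. Its x^2 term moves a Lipschitz [f] by O(x^2),
    hence contributes nothing to the limit of the quotient. *)
Lemma gateaux_curve f Df L (S V U : symmx R d) : frob_lipschitz f L -> gateaux f Df ->
  x^-1 * (f (S + x *: V + x ^+ 2 *: U) - f S) @[x --> 0^'] --> Df S V.
Proof.
move=> fL fD.
pose r (x : R) := x^-1 * (f (S + x *: V + x ^+ 2 *: U) - f (S + x *: V)).
have r0 : r x @[x --> 0^'] --> (0 : R).
  apply/norm_cvg0P; apply: (@squeeze_cvgr _ _ _ _ (cst 0) (fun x : R => `|x| * (L * frob_norm U))).
  - near=> x; rewrite normr_ge0 /= /r normrM.
    have x0 : x != 0 by near: x; exact: nbhs_dnbhs_neq.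
    have := fL (S + x *: V + x ^+ 2 *: U) (S + x *: V).
    rewrite (_ : (_ - _ : 'M[R]_d) = x ^+ 2 *: (U : 'M[R]_d)); last by rewrite /= addrC addKr.
    rewrite frob_normZ normrX => h.
    apply: le_trans (ler_wpM2l (normr_ge0 _) h) _.
    rewrite normfV expr2 [L * _]mulrCA -!mulrA mulKf ?normr_eq0//.
  - exact: cvg_cst.
  - rewrite -[X in _ --> X](mul0r (L * frob_norm U)); apply: cvgM; last exact: cvg_cst.
    by rewrite -[X in _ --> X](@normr0 _ R); apply: cvg_norm; exact: cvg_within.
have -> : (fun x => x^-1 * (f (S + x *: V + x ^+ 2 *: U) - f S)) =
   (fun x => r x + x^-1 * (f (S + x *: V) - f S)).
  by apply/funext => x; rewrite /r -mulrDr; congr (_ * _); ring.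
by rewrite -[X in _ --> X]add0r; apply: cvgD.
Unshelve. all: by end_near. Qed.

Lemma gateaux_le f Df L (S V : symmx R d) : frob_lipschitz f L -> gateaux f Df ->
  `|Df S V| <= L * frob_norm V.
Proof.
move=> fL fD; have h : `|x^-1 * (f (S + x *: V) - f S)| @[x --> (0:R)^'] --> `|Df S V|.
  exact: cvg_norm (fD S V).
apply: (cvgr_to_le h).
near=> x; have x0 : x != 0 by near: x; exact: nbhs_dnbhs_neq.
rewrite normrM normfV mulrC ler_pdivrMr ?normr_gt0//.
have := fL (S + x *: V) S.
rewrite (_ : (_ - _ : 'M[R]_d) = x *: (V : 'M[R]_d)); last by rewrite /= addrC addKr.
by rewrite frob_normZ mulrA [L * _ * _]mulrAC.
Unshelve. all: by end_near. Qed.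

Lemma gateaux_affine f Df L (T : symmx R d) (k : R) :
  frob_lipschitz f L -> gateaux f Df -> linear_form Df ->
  [/\ frob_lipschitz (fun S => f (k *: S + T)) (L * `|k|),
   gateaux (fun S => f (k *: S + T)) (fun S V => Df (k *: S + T) (k *: V)) &
   linear_form (fun S V => Df (k *: S + T) (k *: V))].
Proof.
move=> fL fD fl; split.
- move=> S S'; rewrite (le_trans (fL _ _))// -mulrA -frob_normZ.
  rewrite (_ : (_ - _ : 'M[R]_d) = k *: ((S : 'M[R]_d) - S'))//.
  by rewrite /= scalerBr opprD addrACA subrr addr0.
- move=> S V.
  have := fD (k *: S + T) (k *: V).
  rewrite (_ : (fun x : R => _) = fun x => x^-1 * (f (k *: (S + x *: V) + T) - f (k *: S + T)))//.
  by apply/funext => x; rewrite scalerDr !scalerA [k * x]mulrC addrAC.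
- move=> S a U V; rewrite scalerDr scalerA mulrC -scalerA.
  exact: fl.
Qed.

(** The velocity at x = 0 of the congruence of [S] by 1 + x M. Going through [sympart] makes it
    symmetric by construction; [dirME] gives the usual formula. *)
Definition dirM (M : 'M[R]_d) (S : symmx R d) : symmx R d := 2 *: sympart (S *m M).

Lemma dirME M S : (dirM M S : 'M[R]_d) = S *m M + M^T *m S.
Proof.
by rewrite /= scalerA divff// scale1r trmx_mul trmx_symmx.
Qed.

Lemma dirM_sum M S : dirM M S = \sum_i \sum_j M i j *: dirM (delta_mx i j) S.
Proof.
apply: symmx_eq; rewrite {1}(matrix_sum_delta M).
have valsum (I : finType) (F : I -> symmx R d) :
    ((\sum_i F i : symmx R d) : 'M[R]_d) = \sum_i (F i : 'M[R]_d).
  exact: (raddf_sum (val : symmx R d -> 'M[R]_d)).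
rewrite valsum dirME mulmx_sumr [X in _ + X *m _]raddf_sum mulmx_suml -big_split /=.
apply: eq_bigr => i _.
rewrite valsum mulmx_sumr [X in _ + X *m _]raddf_sum mulmx_suml -big_split /=.
apply: eq_bigr => j _.
rewrite -[RHS]/(M i j *: (dirM (delta_mx i j) S : 'M[R]_d)) dirME.
by rewrite [X in _ + X *m _ = _]linearZ /= -scalemxAr -scalemxAl scalerDr.
Qed.

Lemma frob_norm_dirM (M : 'M[R]_d) (S : symmx R d) : frob_norm (dirM M S) <= 2 * frob_norm M * frob_norm S.
Proof.
rewrite -[dirM M S : 'M[R]_d]/(2 *: (sympart (S *m M) : 'M[R]_d)) frob_normZ.
rewrite ger0_norm// -mulrA ler_wpM2l// (le_trans (frob_norm_sympart _))//.
by rewrite mulrC frob_normM.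
Qed.

Lemma frob_norm_symcong (M : 'M[R]_d) (S : symmx R d) : frob_norm (symcong M S) <= frob_norm M ^+ 2 * frob_norm S.
Proof.
rewrite /= (le_trans (frob_normM _ _))// expr2 -mulrA [leLHS]mulrC.
rewrite ler_wpM2l ?frob_norm_ge0// (le_trans (frob_normM _ _))// frob_norm_tr//.
Qed.

Lemma symcong_transvection i j (x : R) (S : symmx R d) : symcong (transvection i j x) S =
  S + x *: dirM (delta_mx i j) S + x ^+ 2 *: symcong (delta_mx i j) S.
Proof.
apply: symmx_eq.
rewrite -[RHS]/((S : 'M[R]_d) + x *: (dirM (delta_mx i j) S : 'M[R]_d) +
  x ^+ 2 *: (symcong (delta_mx i j) S : 'M[R]_d)) dirME /= /transvection.
have -> : (1%:M + x *: delta_mx i j)^T = 1%:M + x *: (delta_mx i j)^T :> 'M[R]_d.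
  by rewrite [LHS]linearD /= [X in _ + X = _]linearZ /= trmx1.
rewrite [(1%:M + _) *m _]mulmxDl mul1mx mulmxDr mulmx1 -scalemxAr mulmxDl.
rewrite -!scalemxAl !scalerDr !scalerA expr2 !addrA; congr (_ + _).
by rewrite -!addrA; congr (_ + _); rewrite addrC.
Qed.

End gateaux.

Section logarithm.
Context (R : realType).

Lemma norm_ln1D_le (x : R) : `|x| <= 2^-1 -> `|ln (1 + x)| <= 2 * `|x|.
Proof.
move=> x2; have [x1 x1'] : - 2^-1 <= x /\ x <= 2^-1 by apply/andP; rewrite -ler_norml.
have h0 : 0 < 1 + x by lra.
have l1 : ln (1 + x) <= x.
  by rewrite -ler_expR lnK ?posrE//; exact: expR_ge1Dx.
have l2 : - (2 * `|x|) <= ln (1 + x).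
  rewrite -ler_expR lnK ?posrE// expRN.
  have e0 := expR_ge1Dx (2 * `|x|).
  have a0 := normr_ge0 x.
  rewrite (@le_trans _ _ (1 + 2 * `|x|)^-1)//.
    by rewrite lef_pV2 ?posrE ?expR_gt0//; lra.
  rewrite -[X in _ <= X]mul1r -ler_pdivrMr// -invfM -[leRHS]invr1 lef_pV2 ?posrE//; last first.
    by rewrite mulr_gt0//; lra.
  have [xp|xn] := leP 0 x; first by rewrite ger0_norm//; nra.
  by rewrite ltr0_norm//; rewrite ltr0_norm// in x2; nra.
rewrite ler_norml l2 /=; apply: (le_trans l1).
by have := ler_norm x; have := normr_ge0 x; lra.
Qed.

Lemma is_derive_log_quad (a e b c : R) :
  is_derive (0 : R) 1 (fun x : R => a * ln (1 + x * e) + b * x + c * x ^+ 2) (a * e + b).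
Proof.
have h1 : is_derive (0 : R) 1 (fun x : R => 1 + x * e) e.
  have -> : (fun x : R => 1 + x * e) = (cst 1 + (e \*: (@id R))).
    by apply/funext => y /=; rewrite !fctE mulrC.
  by apply: is_derive_eq; rewrite add0r /GRing.scale /= mulr1.
have h2 : is_derive (0 : R) 1 (@ln R \o (fun x : R => 1 + x * e)) e.
  have l1 : is_derive (1 + 0 * e : R) 1 (@ln R) (1 + 0 * e)^-1.
    by apply: is_derive1_ln; rewrite mul0r addr0.
  have := @is_derive1_comp R (@ln R) (fun x : R => 1 + x * e) 0 _ _ l1 h1.
  by rewrite mul0r addr0 invr1 mul1r.
have h3 := is_derive_quad b c 0.
have := is_deriveD (is_deriveZ a h2) h3.
rewrite (_ : _ + _ = fun x : R => a * ln (1 + x * e) + b * x + c * x ^+ 2); last first.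
  by apply/funext => x; rewrite !fctE /= addrA.
by rewrite mulr0 mulr0 addr0.
Qed.

End logarithm.

Section wishart_ibp.
Context (R : realType) (d : nat).
Variables (alpha : R) (Sigma : symmx R d).
Hypothesis d_gt0 : (0 < d)%N.
Hypothesis Sigma_pd : posdefmx Sigma.
Variable mu : probability (symmx R d) R.
Hypothesis muE : forall A : set (symmx R d), measurable A -> mu A =
  (\int[@lebesgue_symmx R d]_(X in A `&` [set X | posdefmx X])
     (wishart_pdf alpha Sigma X)%:E)%E.

Local Notation Si := (invmx (Sigma : 'M[R]_d)).

Lemma le1D_expR (eta y : R) : 0 < eta -> 0 <= y -> 1 + y <= (1 + eta^-1) * expR (eta * y).
Proof.
move=> e0 y0; rewrite mulrDl mul1r lerD//.
  by rewrite -expR0 ler_expR mulr_ge0// ltW.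
by rewrite -ler_pdivrMl ?invr_gt0// invrK le_expR_norm.
Qed.

Lemma rintegrable_wishart_growth (f : symmx R d -> R) (C : R) : 0 <= C ->
  measurable_fun [set: symmx R d] f ->
  (forall S, `|f S| <= C * (1 + frob_norm S) ^+ 2) -> rintegrable mu f.
Proof.
move=> C0 mf fC; have [delta d0 ie] := wishart_exp_moment Sigma_pd muE.
have e0 : 0 < delta / 2 by rewrite divr_gt0.
apply: (rintegrable_le mf (rintegrableZ (C * (1 + (delta / 2)^-1) ^+ 2) ie)) => S.
rewrite (le_trans (fC S))// -mulrA ler_wpM2l//.
rewrite (_ : delta * frob_norm S = delta / 2 * frob_norm S + delta / 2 * frob_norm S); last by field.
rewrite expRD -expr2 -exprMn ler_sqr ?nnegrE; last 2 first.
- by rewrite addr_ge0// frob_norm_ge0.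
- by rewrite mulr_ge0 ?expR_ge0// addr_ge0// invr_ge0 ltW.
exact/le1D_expR/frob_norm_ge0.
Qed.

Lemma rintegrable_wishart_lin_growth (f : symmx R d -> R) (C : R) : 0 <= C ->
  measurable_fun [set: symmx R d] f ->
  (forall S, `|f S| <= C * (1 + frob_norm S)) -> rintegrable mu f.
Proof.
move=> C0 mf fC; apply: (rintegrable_wishart_growth C0) => // S.
rewrite (le_trans (fC S))// ler_wpM2l// expr2 ler_peMr ?addr_ge0 ?frob_norm_ge0//.
by rewrite lerDl frob_norm_ge0.
Qed.

Lemma trmx_Si : Si^T = Si.
Proof. by rewrite trmx_inv trmx_symmx. Qed.

Lemma wishart_tr_le S : `|wishart_tr Sigma S| <= frob_norm Si * frob_norm S.
Proof. by rewrite /wishart_tr -{1}trmx_Si mxtrace_mul_le. Qed.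

Lemma wishart_trD S T : wishart_tr Sigma (S + T) = wishart_tr Sigma S + wishart_tr Sigma T.
Proof. by rewrite /wishart_tr /= mulmxDr raddfD. Qed.

Lemma wishart_trZ a S : wishart_tr Sigma (a *: S) = a * wishart_tr Sigma S.
Proof. by rewrite /wishart_tr /= -scalemxAr mxtraceZ. Qed.

Lemma wishart_tr_dirM M S : wishart_tr Sigma (dirM M S) = 2 * \tr (Si *m S *m M).
Proof.
rewrite /wishart_tr dirME mulmxDr raddfD /= !mulmxA.
have -> : \tr (Si *m M^T *m S) = \tr (Si *m S *m M).
  rewrite -mxtrace_tr !trmx_mul trmxK trmx_Si trmx_symmx.
  by rewrite mxtrace_mulC -mulmxA mxtrace_mulC.
by ring.
Qed.

(* Differentiate [wishart_transvection] at [x = 0]. *)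
Lemma wishart_ibp_elem i j f Df L : frob_lipschitz f L -> gateaux f Df ->
  [/\ rintegrable mu (fun S => Df S (dirM (delta_mx i j) S)),
    rintegrable mu (fun S => f S * (\tr (Si *m S *m delta_mx i j) - alpha * (i == j)%:R)) &
    \int[mu]_S Df S (dirM (delta_mx i j) S) =
    \int[mu]_S (f S * (\tr (Si *m S *m delta_mx i j) - alpha * (i == j)%:R))].
Proof.
move=> fL fD.
have L0 := frob_lipschitz_ge0 d_gt0 fL.
have mf := measurable_lipschitz fL.
pose E : 'M[R]_d := delta_mx i j; pose e : R := (i == j)%:R.
have e01 : `|e| <= 1 by rewrite /e; case: (i == j); rewrite ?normr1 ?normr0.
pose v S := dirM E S; pose U S := symcong E S.
pose kE := frob_norm E; have kE0 : 0 <= kE by exact: frob_norm_ge0.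
pose kS := frob_norm Si; have kS0 : 0 <= kS by exact: frob_norm_ge0.
pose kappa := kS * (kE + kE ^+ 2).
have kE20 : 0 <= kE ^+ 2 by exact: sqr_ge0.
have kappa0 : 0 <= kappa by rewrite mulr_ge0// addr_ge0.
pose F := `|f 0| + L; have F0 : 0 <= F by rewrite addr_ge0.
have fF S : `|f S| <= F * (1 + frob_norm S) by exact: frob_lipschitz_growth.
have fi : rintegrable mu f by exact: (rintegrable_wishart_lin_growth F0 mf fF).
have [delta d0 ie] := wishart_exp_moment Sigma_pd muE.
(* The bound 2^-1 keeps 1 + x e away from 0, so that its logarithm is at most 2 |x|. The other bound
   lets the weight spend only half of the exponential moment [delta]. *)
pose d1 : R := Num.min 2^-1 (delta / 2 / (kappa + 1)).
have k1 : 0 < kappa + 1 by rewrite ltr_wpDl.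
have d10 : 0 < d1 by rewrite lt_min invr_gt0 ltr0n /= !divr_gt0.
have d1h : d1 <= 2^-1 by rewrite ge_min lexx.
have d1k : d1 * kappa <= delta / 2.
  apply: (@le_trans _ _ (delta / 2 / (kappa + 1) * kappa)).
    by rewrite ler_wpM2r// ge_min lexx orbT.
  by rewrite mulrAC ler_pdivrMr// ler_wpM2l ?divr_ge0 ?ltW//; rewrite ltrDl.
(* The logarithm of [transvection_weight] for small x; the linear part of the trace is kept apart
   from the quadratic one. *)
pose rho (x : R) S := alpha * ln (1 + x * e) +
  - (wishart_tr Sigma (v S) / 2) * x + - (wishart_tr Sigma (U S) / 2) * x ^+ 2.
have near_e x : `|x| <= d1 -> `|x * e| <= 2^-1.
  move=> xd; rewrite normrM (le_trans _ d1h)// (le_trans _ xd)//.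
  by rewrite ler_piMr.
have pos_e x : `|x| <= d1 -> 0 < 1 + x * e.
  by move=> /near_e; rewrite ler_norml => /andP[h _]; lra.
have wE x S : `|x| <= d1 -> transvection_weight alpha Sigma i j x S = expR (rho x S).
  move=> xd; have p := pos_e x xd.
  rewrite /transvection_weight -/e /powR gt_eqF// -expRD; congr expR.
  rewrite symcong_transvection /rho -/E -/(v S) -/(U S).
  by move: (v S) (U S) => vS US; rewrite !wishart_trD !wishart_trZ; field.
have rhoL x S : `|x| <= d1 -> `|rho x S| <= `|x| * (2 * `|alpha| + kappa * frob_norm S).
  move=> xd; have xh : `|x| <= 2^-1 by exact: le_trans d1h.
  have x1 : `|x| <= 1 by apply: (le_trans xh); lra.
  have n0 := frob_norm_ge0 (S : 'M[R]_d).
  have b1 : `|alpha * ln (1 + x * e)| <= `|x| * (2 * `|alpha|).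
    rewrite normrM mulrA [leRHS]mulrC ler_wpM2l//.
    rewrite (le_trans (norm_ln1D_le (near_e x xd)))// normrM mulrC ler_wpM2r//.
    by rewrite ler_piMr.
  have b2 : `|- (wishart_tr Sigma (v S) / 2) * x| <= `|x| * (kS * kE * frob_norm S).
    rewrite mulNr normrN normrM mulrC ler_wpM2l// normrM [`|2^-1|]ger0_norm ?invr_ge0//.
    rewrite ler_pdivrMr// (le_trans (wishart_tr_le _))//.
    have := ler_wpM2l kS0 (frob_norm_dirM E S); rewrite -/(v S) -/kE.
    move=> /le_trans; apply; rewrite le_eqVlt; apply/orP; left; apply/eqP; ring.
  have b3 : `|- (wishart_tr Sigma (U S) / 2) * x ^+ 2| <= `|x| * (kS * kE ^+ 2 * frob_norm S).
    rewrite mulNr normrN normrM normrX normrM [`|2^-1|]ger0_norm ?invr_ge0//.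
    have t1 : `|wishart_tr Sigma (U S)| <= kS * (kE ^+ 2 * frob_norm S).
      by rewrite (le_trans (wishart_tr_le _))// ler_wpM2l// frob_norm_symcong.
    have t0 := normr_ge0 (wishart_tr Sigma (U S)); have x0 := normr_ge0 x.
    have q1 : `|wishart_tr Sigma (U S)| * 2^-1 <= kS * kE ^+ 2 * frob_norm S.
      by move: t1; rewrite mulrA; lra.
    have q2 : `|x| ^+ 2 <= `|x| by rewrite expr2 ler_piMl.
    by rewrite [leRHS]mulrC ler_pM// ?mulr_ge0 ?sqr_ge0 ?invr_ge0.
  rewrite (le_trans (ler_normD _ _))// (_ : `|x| * _ = `|x| * (2 * `|alpha|) +
     `|x| * (kS * kE * frob_norm S) + `|x| * (kS * kE ^+ 2 * frob_norm S)).
    by rewrite lerD// (le_trans (ler_normD _ _))// lerD.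
  by rewrite /kappa; ring.
pose K1 := L * (2 * kE + kE ^+ 2).
have K10 : 0 <= K1 by rewrite mulr_ge0// addr_ge0// mulr_ge0.
pose C := (K1 + F * (2 * `|alpha| + kappa)) * expR (2 * `|alpha|) * (1 + (delta / 4)^-1) ^+ 2.
have C0 : 0 <= C.
  apply: mulr_ge0; last exact: sqr_ge0.
  apply: mulr_ge0; last exact: expR_ge0.
  apply: addr_ge0 => //; apply: mulr_ge0 => //; apply: addr_ge0 => //.
pose Fq (x : R) S := x^-1 * (f (symcong (transvection i j x) S) *
  transvection_weight alpha Sigma i j x S - f S).
have FqE x S : `|x| <= d1 -> Fq x S =
    x^-1 * (f (S + x *: v S + x ^+ 2 *: U S) - f S) * expR (rho x S)
    + f S * (x^-1 * (expR (rho x S) - 1)).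
  by move=> xd; rewrite /Fq wE// symcong_transvection -/E -/(v S) -/(U S); ring.
have dom x S : x != 0 -> `|x| <= d1 -> `|Fq x S| <= C * expR (delta * frob_norm S).
  move=> x0 xd; rewrite FqE//.
  have n0 := frob_norm_ge0 (S : 'M[R]_d); set y := frob_norm S in n0 *.
  have x1 : `|x| <= 1 by apply: (le_trans xd); lra.
  have xx : `|x^-1| * `|x| = 1 by rewrite -normrM mulVf// normr1.
  have r1 := rhoL x S xd; rewrite -/y in r1.
  have LR0 : 0 <= 2 * `|alpha| + kappa * y by rewrite addr_ge0// mulr_ge0.
  have rM : `|rho x S| <= 2 * `|alpha| + delta / 2 * y.
    rewrite (le_trans r1)// mulrDr lerD//; first by rewrite ler_piMl// mulr_ge0.
    by rewrite mulrA ler_wpM2r// (le_trans _ d1k)// ler_wpM2r.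
  pose X := expR (2 * `|alpha|) * expR (delta / 2 * y).
  have eX : expR `|rho x S| <= X by rewrite /X -expRD ler_expR.
  have X0 : 0 <= X by rewrite mulr_ge0 ?expR_ge0.
  have b1 : `|x^-1 * (f (S + x *: v S + x ^+ 2 *: U S) - f S) * expR (rho x S)| <= K1 * y * X.
    rewrite !normrM (gtr0_norm (expR_gt0 _)) ler_pM//; last first.
      by apply: le_trans eX; rewrite ler_expR ler_norm.
    have := fL (S + x *: v S + x ^+ 2 *: U S) S.
    rewrite (_ : (_ - _ : 'M[R]_d) = x *: (v S : 'M[R]_d) + x ^+ 2 *: (U S : 'M[R]_d)); last first.
      by rewrite /= addrC -addrA addKr.
    move=> h; apply: (le_trans (ler_wpM2l (normr_ge0 _) h)).
    apply: (@le_trans _ _ (`|x^-1| * (`|x| * (K1 * y)))); last by rewrite mulrA xx mul1r.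
    rewrite ler_wpM2l// /K1 -mulrA [leRHS]mulrCA ler_wpM2l//.
    have g1 := frob_norm_dirM E S; have g2 := frob_norm_symcong E S.
    rewrite -/(v S) -/kE -/y in g1; rewrite -/(U S) -/kE -/y in g2.
    move: (v S) (U S) g1 g2 => vS US g1 g2.
    rewrite (le_trans (frob_normD _ _))// !frob_normZ normrX.
    rewrite mulrDl mulrDr lerD//; first by rewrite ler_wpM2l.
    rewrite expr2 -mulrA ler_wpM2l// (le_trans _ g2)// ler_piMl// ?frob_norm_ge0//.
  have b2 : `|f S * (x^-1 * (expR (rho x S) - 1))| <=
      F * (1 + y) * ((2 * `|alpha| + kappa * y) * X).
    rewrite normrM ler_pM//.
    rewrite normrM; apply: (le_trans (ler_wpM2l (normr_ge0 x^-1) (norm_expRB1_le (rho x S)))).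
    apply: (@le_trans _ _ (`|x^-1| * ((`|x| * (2 * `|alpha| + kappa * y)) * X))).
      by rewrite ler_wpM2l// ler_pM.
    by rewrite mulrA mulrA xx mul1r.
  apply: (le_trans (ler_normD _ _)); apply: (le_trans (lerD b1 b2)).
  have -> : F * (1 + y) * ((2 * `|alpha| + kappa * y) * X) =
    F * (1 + y) * (2 * `|alpha| + kappa * y) * X by ring.
  rewrite -mulrDl.
  have p1 : K1 * y + F * (1 + y) * (2 * `|alpha| + kappa * y) <=
      (K1 + F * (2 * `|alpha| + kappa)) * (1 + y) ^+ 2.
    have a0 := normr_ge0 alpha.
    rewrite [leRHS]mulrDl lerD//.
      by rewrite ler_wpM2l// expr2; nra.
    rewrite (_ : F * (1 + y) * _ = F * ((1 + y) * (2 * `|alpha| + kappa * y))); last by ring.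
    rewrite -[leRHS]mulrA ler_wpM2l// expr2 [leRHS]mulrCA ler_wpM2l ?addr_ge0//.
    nra.
  (* The second half of the exponent absorbs the polynomial growth of [f] and of the congruence, a
     quarter for each factor 1 + y. *)
  have p2 : (1 + y) ^+ 2 <= (1 + (delta / 4)^-1) ^+ 2 * expR (delta / 2 * y).
    have d4 : 0 < delta / 4 by rewrite divr_gt0.
    rewrite (_ : delta / 2 * y = delta / 4 * y + delta / 4 * y); last by field.
    rewrite expRD -expr2 -exprMn ler_sqr ?nnegrE; last 2 first.
    - by rewrite addr_ge0.
    - by rewrite mulr_ge0 ?expR_ge0// addr_ge0// invr_ge0 ltW.
    exact: le1D_expR.
  apply: (@le_trans _ _ ((K1 + F * (2 * `|alpha| + kappa)) *
      ((1 + (delta / 4)^-1) ^+ 2 * expR (delta / 2 * y)) * X)).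
    rewrite ler_wpM2r// (le_trans p1)// ler_wpM2l//.
    by rewrite addr_ge0// mulr_ge0// addr_ge0// mulr_ge0.
  rewrite le_eqVlt; apply/orP; left; apply/eqP.
  rewrite (_ : delta * y = delta / 2 * y + delta / 2 * y); last by field.
  by rewrite expRD /C /X; ring.
have tr_v S : wishart_tr Sigma (v S) / 2 = \tr (Si *m S *m E).
  by rewrite wishart_tr_dirM; field.
have lim S : Fq x S @[x --> 0^'] --> Df S (v S) - f S * (\tr (Si *m S *m E) - alpha * e).
  have dr := is_derive_log_quad alpha e (- (wishart_tr Sigma (v S) / 2))
    (- (wishart_tr Sigma (U S) / 2)).
  have der := @is_derive1_comp R expR _ 0 _ _ (is_derive_expR _) dr.
  have r00 : alpha * ln (1 + 0 * e) + - (wishart_tr Sigma (v S) / 2) * 0 +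
     - (wishart_tr Sigma (U S) / 2) * 0 ^+ 2 = 0.
    by rewrite mul0r addr0 ln1 !mulr0 expr0n mulr0 !addr0.
  rewrite r00 expR0 mul1r in der.
  have c1 : x^-1 * (expR (rho x S) - 1) @[x --> 0^'] -->
      alpha * e - wishart_tr Sigma (v S) / 2.
    by have := is_derive_diff_quotient der; rewrite /= r00 expR0.
  have c2 : expR (rho x S) @[x --> 0^'] --> (1 : R).
    have : {for (0:R), continuous (fun x => expR (rho x S))}.
      by apply/differentiable_continuous/derivable1_diffP; case: der.
    move=> /continuous_withinNx /=.
    by rewrite /rho r00 expR0.
  have c3 := gateaux_curve (S := S) (V := v S) (U S) fL fD.
  have c4 : x^-1 * (f (S + x *: v S + x ^+ 2 *: U S) - f S) * expR (rho x S)
    + f S * (x^-1 * (expR (rho x S) - 1)) @[x --> 0^'] -->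
     Df S (v S) * 1 + f S * (alpha * e - wishart_tr Sigma (v S) / 2).
    apply: cvgD; first exact: cvgM.
    by apply: cvgM => //; exact: cvg_cst.
  have -> : Df S (v S) - f S * (\tr (Si *m S *m E) - alpha * e) =
      Df S (v S) * 1 + f S * (alpha * e - wishart_tr Sigma (v S) / 2).
    by rewrite tr_v; ring.
  apply: cvg_trans c4; apply: near_eq_cvg.
  near=> x; rewrite FqE//.
  near: x; exact: dnbhs0_le.
have mFq x : x != 0 -> `|x| <= d1 -> measurable_fun [set: symmx R d] (Fq x).
  move=> _ _; apply: measurable_funM => //; apply: measurable_funB => //.
  apply: measurable_funM; first exact: (measurableT_comp mf (measurable_symcong _)).
  exact: measurable_transvection_weight.
have [iD cD] := @cvg_Rintegral_dnbhs _ _ _ mu Fq _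
  (fun S => C * expR (delta * frob_norm S)) d1 d10 mFq dom (rintegrableZ C ie) lim.
have Fq0 x : `|x| <= d1 -> \int[mu]_S Fq x S = 0.
  move=> xd; have [i1 e1] := wishart_transvection muE (pos_e x xd) fi.
  rewrite RintegralTZ; last exact: rintegrableB.
  by rewrite RintegralTB// e1 subrr mulr0.
have I0 : \int[mu]_S (Df S (v S) - f S * (\tr (Si *m S *m E) - alpha * e)) = 0.
  have c0 : \int[mu]_S Fq x S @[x --> 0^'] --> (0 : R).
    apply: cvg_near_cst; near=> x; apply: Fq0; near: x; exact: dnbhs0_le.
  exact: (cvg_unique _ cD c0).
have i2 : rintegrable mu (fun S => f S * (\tr (Si *m S *m E) - alpha * e)).
  apply: (@rintegrable_wishart_growth _ (F * (kS * kE + `|alpha|))).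
  - by rewrite mulr_ge0// addr_ge0// mulr_ge0.
  - apply: measurable_funM => //; apply: measurable_funB => //.
    apply: measurable_sum => k; exact: measurable_mulmx_entry.
  - move=> S; rewrite normrM expr2 mulrACA ler_pM//.
    rewrite (le_trans (ler_normB _ _))// mulrDl lerD//; last first.
      rewrite normrM (@le_trans _ _ (`|alpha| * 1))// ler_wpM2l//.
      by rewrite lerDl frob_norm_ge0.
    have h := mxtrace_mul_le (Si *m S)^T E; rewrite trmxK in h.
    rewrite (le_trans h)// frob_norm_tr mulrAC.
    rewrite (@le_trans _ _ (kS * frob_norm S * kE))// ?ler_wpM2r ?frob_normM//.
    by rewrite ler_wpM2l// lerDr.
have i1 : rintegrable mu (fun S => Df S (v S)).
  apply: eq_integrable (rintegrableD iD i2) => // S _ /=.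
  by rewrite subrK.
split => //; apply/eqP; rewrite -subr_eq0 -RintegralTB//.
exact/eqP.
Unshelve. all: by end_near. Qed.

(** Both sides are linear in [M], the left one because [Df] is a linear form in its direction, so
    the case of matrix units suffices. *)
Lemma wishart_ibp M f Df L : frob_lipschitz f L -> gateaux f Df -> linear_form Df ->
  [/\ rintegrable mu (fun S => Df S (dirM M S)),
    rintegrable mu (fun S => f S * (\tr (Si *m S *m M) - alpha * \tr M)) &
    \int[mu]_S Df S (dirM M S) =
    \int[mu]_S (f S * (\tr (Si *m S *m M) - alpha * \tr M))].
Proof.
move=> fL fD fl.
have E1 S : Df S (dirM M S) = \sum_(p : 'I_d * 'I_d) M p.1 p.2 * Df S (dirM (delta_mx p.1 p.2) S).
  rewrite dirM_sum pair_big /= linear_form_sum//; apply: eq_bigr => p _.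
  by rewrite linear_formZ.
have E2 S : f S * (\tr (Si *m S *m M) - alpha * \tr M) = \sum_(p : 'I_d * 'I_d)
    M p.1 p.2 * (f S * (\tr (Si *m S *m delta_mx p.1 p.2) - alpha * (p.1 == p.2)%:R)).
  have trd (p : 'I_d * 'I_d) : \tr (delta_mx p.1 p.2 : 'M[R]_d) = (p.1 == p.2)%:R.
    rewrite /mxtrace (bigD1 p.1)//= mxE eqxx big1 ?addr0// => k /negPf kp.
    by rewrite mxE kp.
  rewrite {1 2}(matrix_sum_delta M) pair_big /= mulmx_sumr !raddf_sum /= mulr_sumr -sumrB mulr_sumr.
  apply: eq_bigr => p _; rewrite -scalemxAr !mxtraceZ trd; ring.
have h p := wishart_ibp_elem p.1 p.2 fL fD.
have i1 (p : 'I_d * 'I_d) : rintegrable mu (fun S => M p.1 p.2 * Df S (dirM (delta_mx p.1 p.2) S)).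
  by apply: rintegrableZ; have [] := h p.
have i2 (p : 'I_d * 'I_d) : rintegrable mu (fun S => M p.1 p.2 *
   (f S * (\tr (Si *m S *m delta_mx p.1 p.2) - alpha * (p.1 == p.2)%:R))).
  by apply: rintegrableZ; have [] := h p.
split.
- by apply: eq_integrable (rintegrable_sum i1) => // S _ /=; rewrite E1.
- by apply: eq_integrable (rintegrable_sum i2) => // S _ /=; rewrite E2.
under eq_Rintegral do rewrite E1; under [RHS]eq_Rintegral do rewrite E2.
rewrite !Rintegral_sum//; apply: eq_bigr => p _.
have [j1 j2 ep] := h p.
by rewrite !RintegralTZ// ep.
Qed.

End wishart_ibp.

(** * Symmetric Gaussian matrices and mollification *)

Section real_integral_inequalities.
Context d (T : measurableType d) (R : realType) (mu : {measure set T -> \bar R}).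

Lemma ler_RintegralT (f g : T -> R) : rintegrable mu f -> rintegrable mu g ->
  (forall x, f x <= g x) -> \int[mu]_x f x <= \int[mu]_x g x.
Proof. by move=> fi gi fg; apply: le_Rintegral => // x _; exact: fg. Qed.

Lemma norm_RintegralT_le (f g : T -> R) : rintegrable mu f -> rintegrable mu g ->
  (forall x, `|f x| <= g x) -> `|\int[mu]_x f x| <= \int[mu]_x g x.
Proof.
move=> fi gi fg; apply: (le_trans (le_normr_Rintegral _ fi)) => //.
by apply: ler_RintegralT => //; exact: rintegrable_norm.
Qed.

Hypothesis mu1 : mu [set: T] = 1%E.

Lemma rintegrable_cst (c : R) : rintegrable mu (fun=> c).
Proof.
apply/integrableP; split; first exact: measurable_cst.
by rewrite (eq_integral (cst `|c|%:E))// integral_cst// mu1 mule1 ltry.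
Qed.

Lemma RintegralT_cst (c : R) : \int[mu]_x c = c.
Proof. by rewrite /Rintegral integral_cst//= mu1 mule1. Qed.

(** The variance of [f] is nonnegative; total mass 1 enters through the constant term of the
    square. *)
Lemma sqr_Rintegral_le (f : T -> R) :
  rintegrable mu f -> rintegrable mu (fun x => f x ^+ 2) ->
  (\int[mu]_x f x) ^+ 2 <= \int[mu]_x (f x ^+ 2).
Proof.
move=> fi f2i; set m := \int[mu]_x f x.
have : 0 <= \int[mu]_x (f x ^+ 2 - 2 * m * f x + m ^+ 2).
  by apply: Rintegral_ge0 => x _; rewrite (_ : _ + _ = (f x - m) ^+ 2) ?sqr_ge0//; ring.
have i1 := rintegrableZ (2 * m) fi; have i2 := rintegrable_cst (m ^+ 2).
rewrite RintegralTD//; last exact: rintegrableB.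
rewrite RintegralTB// RintegralTZ// RintegralT_cst -/m.
by rewrite (_ : _ + _ = \int[mu]_x (f x ^+ 2) - m ^+ 2) ?subr_ge0//; ring.
Qed.

End real_integral_inequalities.

Section product_integrals.
Context d1 d2 (T1 : measurableType d1) (T2 : measurableType d2) (R : realType).
Variable mu : {sigma_finite_measure set T1 -> \bar R}.
Variable nu : {sigma_finite_measure set T2 -> \bar R}.

Lemma rintegrable_prod (a : T1 -> R) (b : T2 -> R) (F : T1 * T2 -> R) :
  rintegrable mu a -> rintegrable nu b -> (forall x, 0 <= a x) ->
  measurable_fun [set: T1 * T2] F ->
  (forall x y, `|F (x, y)| <= a x * b y) -> rintegrable (mu \x nu)%E F.
Proof.
move=> ai bi a0 mF Fab; apply/integrable12ltyP; first exact/measurable_EFinP.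
apply: (@le_lt_trans _ _ (\int[mu]_x (a x * \int[nu]_y b y)%:E)%E); last first.
  have i1 := rintegrableZ (\int[nu]_y b y) ai.
  by under eq_integral do rewrite mulrC; rewrite rintegrable_fin// ltry.
apply: ge0_le_integral => //.
- by move=> x _; exact: integral_ge0.
- apply: (measurable_fun_fubini_tonelli_F (fun z => `|(F z)%:E|)%E) => //.
  by apply: measurableT_comp => //; exact/measurable_EFinP.
- by apply/measurable_EFinP/measurable_funM => //; exact: rintegrable_meas ai.
- move=> x _; rewrite -RintegralTZ// -rintegrable_fin; last exact: rintegrableZ.
  apply: ge0_le_integral => //.
  + apply: measurableT_comp => //; apply/measurable_EFinP.
    exact: measurableT_comp.
  + by apply/measurable_EFinP/measurable_funM => //; exact: rintegrable_meas bi.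
  + by move=> y _; rewrite lee_fin.
Qed.

(** Sections are assumed integrable for every x rather than almost every x, so that the inner real
    integral agrees with the extended one everywhere. *)
Lemma Rintegral_prodl (F : T1 * T2 -> R) : rintegrable (mu \x nu)%E F ->
  (forall x, rintegrable nu (fun y => F (x, y))) ->
  rintegrable mu (fun x => \int[nu]_y F (x, y)) /\
  \int[(mu \x nu)%E]_z F z = \int[mu]_x \int[nu]_y F (x, y).
Proof.
move=> Fi Fx.
have E x : ((\int[nu]_y F (x, y))%:E = \int[nu]_y (F (x, y))%:E)%E by rewrite rintegrable_fin.
split.
  by apply: eq_integrable (integrable_fubini_F Fi) => // x _ /=; rewrite E.
rewrite [LHS]/Rintegral -integral12_prod_meas1//; congr fine.
by apply: eq_integral => x _; rewrite E.
Qed.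

Lemma Rintegral_prodr (F : T1 * T2 -> R) : rintegrable (mu \x nu)%E F ->
  (forall y, rintegrable mu (fun x => F (x, y))) ->
  rintegrable nu (fun y => \int[mu]_x F (x, y)) /\
  \int[(mu \x nu)%E]_z F z = \int[nu]_y \int[mu]_x F (x, y).
Proof.
move=> Fi Fy.
have E y : ((\int[mu]_x F (x, y))%:E = \int[mu]_x (F (x, y))%:E)%E by rewrite rintegrable_fin.
split.
  apply: (@eq_integrable _ _ _ nu _ measurableT (fubini_G mu (EFin \o F))).
    by move=> y _ /=; rewrite E.
  have mF := measurable_int _ Fi.
  apply/integrableP; split.
    exact: measurable_fubini_G Fi.
  have h := (@integrable21ltyP _ _ _ _ _ mu nu _ mF).1 Fi.
  apply: le_lt_trans h; apply: ge0_le_integral => //.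
  - by apply: measurableT_comp => //; exact: (measurable_fubini_G Fi).
  - apply: (measurable_fun_fubini_tonelli_G (abse \o (EFin \o F))) ; last by move=> z; exact: abse_ge0.
    exact: measurableT_comp.
  - move=> y _; apply: le_abse_integral => //.
    exact: measurableT_comp.
rewrite [LHS]/Rintegral -integral21_prod_meas1//; congr fine.
by apply: eq_integral => x _; rewrite E.
Qed.

End product_integrals.

Section symmetric_gaussian.
Context (R : realType) (d : nat).
Variable Sigma : symmx R d.
Hypothesis Sigma_pd : posdefmx Sigma.
Local Notation TR := (measurableTypeR R).
Local Notation n := #|{: 'I_d * 'I_d}|.
Local Notation Q := (sqrt_symmx Sigma).
Local Notation Si := (invmx (Sigma : 'M[R]_d)).

Definition tuple_mx (t : n.-tuple TR) : 'M[R]_d := \matrix_(i, j) tnth t (enum_rank (i, j)).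

(** The centered matrix (Z - alpha Sigma) / sqrt alpha of the statement: since sqrt (2 alpha) / sqrt
    alpha = sqrt 2, it no longer involves alpha. *)
Definition gaussmx (t : n.-tuple TR) : symmx R d :=
  Num.sqrt 2 *: symconj Q (sympart (tuple_mx t)).

(* Moving the tuple along [gauss_dir V] moves [gaussmx] along [V]. *)
Definition gauss_dir (V : symmx R d) (k : 'I_n) : R :=
  ((Num.sqrt 2)^-1 *: (invmx Q *m V *m invmx Q)) (enum_val k).1 (enum_val k).2.

Let Q_unit : (Q : 'M[R]_d) \in unitmx.
Proof. by have [/pdmx_unit] := sqrt_symmxP Sigma_pd. Qed.

Let QQ : (Q : 'M[R]_d) *m Q = Sigma.
Proof. by have [] := sqrt_symmxP Sigma_pd. Qed.

Let SiQ : Si = invmx Q *m invmx Q.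
Proof. exact: invmx_sqr. Qed.

Let sqrt2 : Num.sqrt 2 ^+ 2 = 2 :> R.
Proof. by rewrite sqr_sqrtr. Qed.

Let sqrt2_neq0 : Num.sqrt 2 != 0 :> R.
Proof. by rewrite gt_eqF// sqrtr_gt0. Qed.

Lemma sum_tuple_pair (F : 'I_d -> 'I_d -> R) :
  \sum_(k < n) F (enum_val k).1 (enum_val k).2 = \sum_i \sum_j F i j.
Proof.
rewrite pair_big /= (reindex (@enum_rank {: 'I_d * 'I_d})) /=; last first.
  by apply: onW_bij; exact: enum_rank_bij.
by apply: eq_bigr => p _; rewrite enum_rankK.
Qed.

Lemma tuple_mx_shift (m : 'M[R]_d) (x : R) (t : n.-tuple TR) :
  tuple_mx (tuple_shift (fun k => x * m (enum_val k).1 (enum_val k).2) t) =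
  tuple_mx t + x *: m.
Proof. by apply/matrixP => i j; rewrite !mxE tnth_mktuple enum_rankK. Qed.

Lemma gaussmx_shift (V : symmx R d) (x : R) (t : n.-tuple TR) :
  gaussmx (tuple_shift (fun k => x * gauss_dir V k) t) = gaussmx t + x *: V.
Proof.
have VT : (V : 'M[R]_d)^T = V by exact: trmx_symmx.
have QT : (invmx Q)^T = invmx Q by rewrite trmx_inv trmx_symmx.
apply: symmx_eq; rewrite /gaussmx /= tuple_mx_shift.
set m := _ *: (invmx Q *m V *m invmx Q).
have mT : m^T = m by rewrite /m [LHS]linearZ /= !trmx_mul VT QT mulmxA.
have -> : 2^-1 *: (tuple_mx t + x *: m + (tuple_mx t + x *: m)^T) =
    2^-1 *: (tuple_mx t + (tuple_mx t)^T) + x *: m.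
  move: m mT => m mT; apply/matrixP => i j; have mij := congr1 (fun A : 'M[R]_d => A i j) mT.
  by rewrite mxE in mij; rewrite !mxE mij; field.
rewrite mulmxDr mulmxDl scalerDr; congr (_ + _).
rewrite -scalemxAr -scalemxAl /m -scalemxAr -scalemxAl !mulmxA mulmxV// mul1mx.
rewrite -mulmxA mulVmx// mulmx1 !scalerA; congr (_ *: _).
by rewrite mulrC divfK.
Qed.

Lemma tuple_linE (m : 'M[R]_d) (t : n.-tuple TR) :
  tuple_lin (fun k => m (enum_val k).1 (enum_val k).2) t = \tr (m^T *m tuple_mx t).
Proof.
rewrite mxtrace_mulTmx -(pair_big xpredT xpredT (fun i j => m i j * tuple_mx t i j)) /=.
rewrite -(sum_tuple_pair (fun i j => m i j * tuple_mx t i j)).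
by apply: eq_bigr => k _; rewrite mxE -surjective_pairing enum_valK.
Qed.

Lemma mxtrace_sympart (m : 'M[R]_d) (A : 'M[R]_d) : m^T = m ->
  \tr (m *m sympart A) = \tr (m *m A).
Proof.
move=> mT; rewrite /= -scalemxAr mxtraceZ mulmxDr raddfD /=.
have -> : \tr (m *m A^T) = \tr (m *m A).
  by rewrite -mxtrace_tr trmx_mul trmxK mT mxtrace_mulC.
by field.
Qed.

(** The weight produced by a shift along [V] is a bilinear form in [V] and the Gaussian matrix that
    is symmetric by cyclicity of the trace. Exchanging the roles of the two matrices is what matches
    it with the Wishart weight. *)
Lemma tuple_lin_gauss_dir (V : symmx R d) (t : n.-tuple TR) :
  tuple_lin (gauss_dir V) t = 2^-1 * \tr (Si *m V *m Si *m gaussmx t).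
Proof.
have VT : (V : 'M[R]_d)^T = V by exact: trmx_symmx.
have QT : (invmx Q)^T = invmx Q by rewrite trmx_inv trmx_symmx.
rewrite /gauss_dir (tuple_linE (_ *: (invmx Q *m V *m invmx Q))).
set B := invmx Q *m V *m invmx Q.
have BT : B^T = B by rewrite /B !trmx_mul VT QT mulmxA.
have -> : ((Num.sqrt 2)^-1 *: B)^T = (Num.sqrt 2)^-1 *: B by rewrite [LHS]linearZ /= BT.
rewrite -scalemxAl mxtraceZ.
have -> : (gaussmx t : 'M[R]_d) = Num.sqrt 2 *: (Q *m sympart (tuple_mx t) *m Q) by [].
rewrite -[in RHS]scalemxAr [in RHS]mxtraceZ mulrA -(mxtrace_sympart _ BT).
congr (_ * _).
  by rewrite -[X in _ = X^-1 * _]sqrt2 expr2 invfM -mulrA mulVf// mulr1.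
have -> : Si *m V *m Si *m (Q *m sympart (tuple_mx t) *m Q) =
   invmx Q *m (B *m (invmx Q *m Q) *m sympart (tuple_mx t) *m Q).
  by rewrite SiQ /B !mulmxA.
by rewrite mulVmx// mulmx1 [RHS]mxtrace_mulC -[_ *m Q *m _]mulmxA mulmxV// mulmx1.
Qed.

Lemma measurable_gaussmx : measurable_fun [set: n.-tuple TR] gaussmx.
Proof.
apply: measurable_fun_symmx => i j.
rewrite /gaussmx; under eq_fun do rewrite /= !mxE.
apply: measurable_funM => //.
apply: measurable_sum => k; under eq_fun do rewrite mxE.
apply: measurable_funM => //; apply: measurable_sum => l.
under eq_fun do rewrite !mxE.
apply: measurable_funM => //; apply: measurable_funM => //.
by apply: measurable_funD; exact: measurable_tnth.
Qed.

Lemma frob_norm_tuple_mx (t : n.-tuple TR) : frob_norm (tuple_mx t) <= tuple_norm1 t.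
Proof.
rewrite (le_trans (frob_norm_le_sum _))// -sum_tuple_pair le_eqVlt; apply/orP; left.
apply/eqP; apply: eq_bigr => k _.
by rewrite mxE -surjective_pairing enum_valK.
Qed.

Definition gaussmx_bound : R := Num.sqrt 2 * frob_norm Q ^+ 2.

Lemma gaussmx_bound_ge0 : 0 <= gaussmx_bound.
Proof. by rewrite mulr_ge0 ?sqrtr_ge0 ?sqr_ge0. Qed.

Lemma frob_norm_gaussmx (t : n.-tuple TR) :
  frob_norm (gaussmx t) <= gaussmx_bound * tuple_norm1 t.
Proof.
rewrite /gaussmx frob_normZ ger0_norm ?sqrtr_ge0// /gaussmx_bound -mulrA.
rewrite ler_wpM2l ?sqrtr_ge0// (le_trans (frob_normM _ _))//.
rewrite expr2 mulrAC ler_wpM2r ?frob_norm_ge0//.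
rewrite (le_trans (frob_normM _ _))// ler_wpM2l ?frob_norm_ge0//.
exact: le_trans (frob_norm_sympart _) (frob_norm_tuple_mx t).
Qed.

Lemma rintegrable_gaussmx_growth (f : n.-tuple TR -> R) (C : R) : 0 <= C ->
  measurable_fun [set: n.-tuple TR] f ->
  (forall t, `|f t| <= C * (1 + frob_norm (gaussmx t)) ^+ 2) -> rintegrable (gauss R n) f.
Proof.
move=> C0 mf fC.
pose K := 1 + gaussmx_bound; have K0 : 0 <= K by rewrite addr_ge0// gaussmx_bound_ge0.
apply: (@rintegrable_gauss_growth _ _ f (C * K ^+ 2) 2) => // t.
rewrite (le_trans (fC t))// -mulrA ler_wpM2l//.
have -> : 2 * tuple_norm1 t = tuple_norm1 t + tuple_norm1 t by ring.
rewrite expRD -expr2 -exprMn ler_sqr ?nnegrE ?addr_ge0 ?frob_norm_ge0//; last first.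
  by rewrite mulr_ge0// expR_ge0.
have t0 := tuple_norm1_ge0 t; have g0 := gaussmx_bound_ge0.
rewrite mulrDl mul1r lerD//; first by rewrite -expR0 ler_expR.
by rewrite (le_trans (frob_norm_gaussmx t))// ler_wpM2l// le_expR_norm.
Qed.

Lemma gaussmx_entry (t : n.-tuple TR) i j : (gaussmx t) i j =
  tuple_lin (fun p => ((Num.sqrt 2)^-1 *: \matrix_(k, l) (Q i k * Q l j +
    Q i l * Q k j)) (enum_val p).1 (enum_val p).2) t.
Proof.
rewrite (tuple_linE (_ *: _)) mxtrace_mulTmx.
rewrite -(pair_big xpredT xpredT (fun k l => ((Num.sqrt 2)^-1 *: \matrix_(k, l) (Q i k * Q l j +
    Q i l * Q k j)) k l * tuple_mx t k l)) /=.
rewrite [LHS]mxE mxE mulr_sumr.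
have -> : \sum_i0 Num.sqrt 2 * ((Q *m sympart (tuple_mx t) : 'M[R]_d) i i0 * (Q : 'M[R]_d) i0 j) =
   (Num.sqrt 2)^-1 * (\sum_k \sum_l Q i k * tuple_mx t k l * Q l j +
     \sum_k \sum_l Q i l * tuple_mx t k l * Q k j).
  have s2 : Num.sqrt 2 * 2^-1 = (Num.sqrt 2)^-1 :> R.
    by rewrite -{2}sqrt2 expr2 invfM mulrA mulfV// mul1r.
  rewrite -s2 exchange_big -big_split /= mulr_sumr; apply: eq_bigr => l _.
  rewrite mxE mulr_suml mulr_sumr -big_split mulr_sumr; apply: eq_bigr => k _ /=.
  by rewrite !mxE; ring.
rewrite -big_split mulr_sumr; apply: eq_bigr => k _ /=.
rewrite -big_split mulr_sumr; apply: eq_bigr => l _ /=.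
by rewrite !mxE; ring.
Qed.

Lemma gaussmx_covariance i j k l :
  rintegrable (gauss R n) (fun t => (gaussmx t) i j * (gaussmx t) k l) /\
  \int[gauss R n]_t ((gaussmx t) i j * (gaussmx t) k l) =
  Sigma i k * Sigma j l + Sigma i l * Sigma j k.
Proof.
under eq_fun do rewrite !gaussmx_entry.
set a := fun p : 'I_n => _; set b := fun p : 'I_n => _.
have [i1 ->] := gauss_covariance b a; split => //.
pose q := (Q : 'M[R]_d).
have qT x y : q x y = q y x by exact: symmx_sym.
have S2 x y : Sigma x y = \sum_z q x z * q z y by rewrite -QQ mxE.
rewrite /a /b (sum_tuple_pair (fun x y => ((Num.sqrt 2)^-1 *: \matrix_(k, l) (q i k * q l j + q i l * q k j)) x y
   * ((Num.sqrt 2)^-1 *: \matrix_(k0, l0) (q k k0 * q l0 l + q k l0 * q k0 l)) x y)).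
have P w x y z : \sum_a0 \sum_b0 (q w a0 * q a0 x) * (q y b0 * q b0 z) =
    Sigma w x * Sigma y z.
  by rewrite !S2 big_distrl /=; apply: eq_bigr => u _; rewrite big_distrr.
(* Pairing two symmetrized coefficient matrices produces four products; each sums to one of these
   terms by [P], and they coincide in pairs. *)
rewrite (_ : _ + _ = 2^-1 * (Sigma i k * Sigma j l +
  Sigma i l * Sigma j k + Sigma j k * Sigma i l +
  Sigma j l * Sigma i k)); last by field.
rewrite -!P -!big_split /= mulr_sumr; apply: eq_bigr => x _.
rewrite -!big_split /= mulr_sumr; apply: eq_bigr => y _.
rewrite !mxE (qT y j) (qT x j) (qT y l) (qT x l) (qT x k) (qT y k).
have s2 : 2^-1 = (Num.sqrt 2)^-1 * (Num.sqrt 2)^-1 :> R by rewrite -invfM -expr2 sqrt2.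
by rewrite s2; ring.
Qed.

End symmetric_gaussian.

Section measurable_symmx_maps.
Context (R : realType) (d : nat) dT (T : measurableType dT).

Lemma measurable_symmxD (Y V : T -> symmx R d) :
  measurable_fun [set: T] Y -> measurable_fun [set: T] V ->
  measurable_fun [set: T] (fun p => Y p + V p).
Proof.
move=> mY mV; apply: measurable_fun_symmx => i j; under eq_fun do rewrite /= mxE.
by apply: measurable_funD; exact: (measurableT_comp (@measurable_symmx_entry R d i j)).
Qed.

Lemma measurable_symmxZ (a : R) (Y : T -> symmx R d) :
  measurable_fun [set: T] Y -> measurable_fun [set: T] (fun p => a *: Y p).
Proof.
move=> mY; apply: measurable_fun_symmx => i j; under eq_fun do rewrite /= mxE.
by apply: measurable_funM => //; exact: (measurableT_comp (@measurable_symmx_entry R d i j)).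
Qed.

Lemma measurable_frob_norm_comp (Y : T -> symmx R d) : measurable_fun [set: T] Y ->
  measurable_fun [set: T] (fun p => frob_norm (Y p)).
Proof. by move=> mY; exact: (measurableT_comp (@measurable_frob_norm R d)). Qed.

(** Nothing is assumed on the measurability of [Df]: its values are limits of quotients dominated by
    L times the norm of the direction. *)
Lemma rintegrable_gateaux (mu : {measure set T -> \bar R}) f Df (L : R) (Y V : T -> symmx R d) :
  frob_lipschitz f L -> gateaux f Df ->
  measurable_fun [set: T] Y -> measurable_fun [set: T] V ->
  rintegrable mu (fun p => frob_norm (V p)) -> rintegrable mu (fun p => Df (Y p) (V p)).
Proof.
move=> fL fD mY mV Vi; have mf := measurable_lipschitz fL.
have [] := @cvg_Rintegral_dnbhs _ _ _ mu (fun x p => x^-1 * (f (Y p + x *: V p) - f (Y p)))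
  (fun p => Df (Y p) (V p)) (fun p => L * frob_norm (V p)) 1 ltr01.
- move=> x _ _; apply: measurable_funM => //; apply: measurable_funB.
    by apply: (measurableT_comp mf); apply: measurable_symmxD => //; exact: measurable_symmxZ.
  exact: (measurableT_comp mf).
- move=> x p x0 _; rewrite normrM normfV ler_pdivrMl ?normr_gt0//.
  rewrite (le_trans (fL _ _))// (_ : (_ - _ : 'M[R]_d) = x *: (V p : 'M[R]_d)).
    by rewrite frob_normZ mulrCA.
  by rewrite /= addrC addKr.
- exact: rintegrableZ.
- by move=> p; exact: fD.
- by [].
Qed.

End measurable_symmx_maps.

Section mollification.
Context (R : realType) (d : nat).
Variable Sigma : symmx R d.
Hypothesis Sigma_pd : posdefmx Sigma.
Hypothesis d_gt0 : (0 < d)%N.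
Local Notation TR := (measurableTypeR R).
Local Notation n := #|{: 'I_d * 'I_d}|.
Local Notation Z := (gaussmx Sigma).
Local Notation gauss := (gauss R n).

Lemma rintegrable_frob_gaussmx : rintegrable gauss (fun t => frob_norm (Z t)).
Proof.
apply: (@rintegrable_gaussmx_growth _ _ Sigma _ 1) => //.
  exact: (measurable_frob_norm_comp (measurable_gaussmx Sigma)).
move=> t; have n0 := frob_norm_ge0 (Z t : 'M[R]_d).
by rewrite mul1r ger0_norm//; nra.
Qed.

Variables (h : symmx R d -> R) (L : R).
Hypothesis hL : frob_lipschitz h L.

Let mh : measurable_fun [set: symmx R d] h.
Proof. exact: measurable_lipschitz hL. Qed.

Let L0 : 0 <= L.
Proof. exact: frob_lipschitz_ge0 hL. Qed.

Let mhZ (e : R) S : measurable_fun [set: n.-tuple TR] (fun t => h (S + e *: Z t)).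
Proof.
apply: (measurableT_comp mh); apply: measurable_symmxD; first exact: measurable_cst.
by apply: measurable_symmxZ; exact: measurable_gaussmx.
Qed.

Lemma frob_lipschitz_gaussmx_growth (e : R) S t : `|h (S + e *: Z t)| <=
  (`|h S| + L * (`|e| * gaussmx_bound Sigma)) * expR (1 * tuple_norm1 t).
Proof.
have t0 := tuple_norm1_ge0 t; have g0 := gaussmx_bound_ge0 Sigma.
have := hL (S + e *: Z t) S.
rewrite (_ : (_ - _ : 'M[R]_d) = e *: (Z t : 'M[R]_d)); last by rewrite /= addrC addKr.
rewrite frob_normZ => h1.
have h2 : `|h (S + e *: Z t)| <= `|h S| + L * (`|e| * frob_norm (Z t)).
  by rewrite -lerBlDl (le_trans (lerB_dist _ _)).
rewrite (le_trans h2)// mul1r mulrDl lerD//.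
  by rewrite ler_peMr// -expR0 ler_expR.
rewrite -mulrA ler_wpM2l// -mulrA ler_wpM2l// (le_trans (frob_norm_gaussmx _ _))//.
by rewrite ler_wpM2l// le_expR_norm.
Qed.

Lemma rintegrable_lipschitz_gaussmx (e : R) S : rintegrable gauss (fun t => h (S + e *: Z t)).
Proof.
by apply: (@rintegrable_gauss_growth _ _ _ _ 1) => // t; exact: frob_lipschitz_gaussmx_growth.
Qed.

Definition mollify (e : R) S : R := \int[gauss]_t h (S + e *: Z t).

(* Shifting the Gaussian tuple moves the increment of the argument of [h] to the
   Gaussian weight, which is smooth. *)
Definition mollify_deriv (e : R) S V : R :=
  \int[gauss]_t (h (S + e *: Z t) * (e^-1 * tuple_lin (gauss_dir Sigma V) t)).

Lemma mollify_lipschitz e : frob_lipschitz (mollify e) L.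
Proof.
move=> S T; rewrite /mollify -RintegralTB; try exact: rintegrable_lipschitz_gaussmx.
rewrite -[leRHS](@Rintegral_gauss_cst R n).
apply: norm_RintegralT_le; last 2 first.
- exact: rintegrable_gauss_cst.
- move=> t; rewrite (le_trans (hL _ _))//= (_ : _ + _ - _ = (S : 'M[R]_d) - T)//.
  by rewrite opprD addrACA subrr addr0.
by apply: rintegrableB; exact: rintegrable_lipschitz_gaussmx.
Qed.

Lemma mollify_dist e S : `|mollify e S - h S| <= `|e| * L * \int[gauss]_t frob_norm (Z t).
Proof.
rewrite /mollify -[X in _ - X](@Rintegral_gauss_cst R n) -RintegralTB.
- rewrite -RintegralTZ; last exact: rintegrable_frob_gaussmx.
  apply: norm_RintegralT_le.
  + apply: rintegrableB; first exact: rintegrable_lipschitz_gaussmx.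
    exact: rintegrable_gauss_cst.
  + exact/rintegrableZ/rintegrable_frob_gaussmx.
  move=> t; rewrite (le_trans (hL _ _))// (_ : (_ - _ : 'M[R]_d) = e *: (Z t : 'M[R]_d)).
    by rewrite frob_normZ mulrCA mulrA.
  by rewrite /= addrC addKr.
- exact: rintegrable_lipschitz_gaussmx.
- exact: rintegrable_gauss_cst.
Qed.

Lemma gauss_dirP (a : R) U V k : gauss_dir Sigma (a *: U + V) k =
  a * gauss_dir Sigma U k + gauss_dir Sigma V k.
Proof.
rewrite /gauss_dir /= mulmxDr mulmxDl -scalemxAr -scalemxAl.
by move: (_ *m U *m _) (_ *m V *m _) => u v; rewrite !mxE; ring.
Qed.

Lemma rintegrable_mollify_deriv e S V :
  rintegrable gauss (fun t => h (S + e *: Z t) * (e^-1 * tuple_lin (gauss_dir Sigma V) t)).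
Proof.
set a := gauss_dir Sigma V; set C := (`|h S| + L * (`|e| * gaussmx_bound Sigma)).
have g0 := gaussmx_bound_ge0 Sigma.
have C0 : 0 <= C by rewrite addr_ge0// mulr_ge0// mulr_ge0.
pose A := \sum_i `|a i|; have A0 : 0 <= A by exact: sumr_ge0.
apply: (@rintegrable_gauss_growth _ _ _ (C * (`|e^-1| * A)) 2) => //.
  apply: measurable_funM; first exact: mhZ.
  by apply: measurable_funM => //; exact: measurable_tuple_lin.
move=> t; have t0 := tuple_norm1_ge0 t.
rewrite (_ : 2 * tuple_norm1 t = 1 * tuple_norm1 t + tuple_norm1 t); last by ring.
rewrite normrM expRD mulrACA ler_pM//; first exact: frob_lipschitz_gaussmx_growth.
rewrite normrM -mulrA ler_wpM2l// (le_trans (norm_tuple_lin_le _ _))//.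
by rewrite ler_wpM2l// le_expR_norm.
Qed.

Lemma mollify_linear e : linear_form (mollify_deriv e).
Proof.
move=> S a U V; rewrite /mollify_deriv -RintegralTZ; last exact: rintegrable_mollify_deriv.
rewrite -RintegralTD; last 2 first.
- exact/rintegrableZ/rintegrable_mollify_deriv.
- exact: rintegrable_mollify_deriv.
apply: eq_Rintegral => t _.
rewrite (_ : tuple_lin (gauss_dir Sigma (a *: U + V)) t =
  a * tuple_lin (gauss_dir Sigma U) t + tuple_lin (gauss_dir Sigma V) t); first by ring.
rewrite /tuple_lin mulr_sumr -big_split; apply: eq_bigr => k _ /=.
by rewrite gauss_dirP; ring.
Qed.

(** The shift by - (x / e) times [gauss_dir] moves e Z by - x V and cancels the increment of the
    argument, leaving x in an exponential only. *)
Lemma mollify_shift e S V (x : R) : e != 0 ->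
  let a := gauss_dir Sigma V in
  rintegrable gauss (fun t => h (S + e *: Z t) *
    expR (x / e * tuple_lin a t - (x / e) ^+ 2 * (\sum_i a i ^+ 2) / 2)) /\
  mollify e (S + x *: V) = \int[gauss]_t (h (S + e *: Z t) *
    expR (x / e * tuple_lin a t - (x / e) ^+ 2 * (\sum_i a i ^+ 2) / 2)).
Proof.
move=> e0 a.
have [] := gauss_shift (fun k => - (x / e) * a k) (rintegrable_lipschitz_gaussmx e (S + x *: V)).
have E t : h (S + x *: V + e *: Z (tuple_shift (fun k => - (x / e) * a k) t)) *
    expR (- tuple_lin (fun k => - (x / e) * a k) t - (\sum_i (- (x / e) * a i) ^+ 2) / 2) =
    h (S + e *: Z t) * expR (x / e * tuple_lin a t - (x / e) ^+ 2 * (\sum_i a i ^+ 2) / 2).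
  congr (h _ * expR _).
    rewrite gaussmx_shift//; move: (Z t) => z; rewrite scalerDr scalerA mulrN mulrCA mulfV// mulr1 scaleNr.
    by rewrite addrACA subrr addr0.
  congr (_ - _ / 2).
    by rewrite /tuple_lin mulr_sumr -sumrN; apply: eq_bigr => k _; ring.
  by rewrite mulr_sumr; apply: eq_bigr => k _; ring.
under eq_fun do rewrite E.
by move=> i1 e1; split.
Qed.

Lemma mollify_gateaux e : 0 < e -> gateaux (mollify e) (mollify_deriv e).
Proof.
move=> e0 S V; have en0 : e != 0 by rewrite gt_eqF.
set a := gauss_dir Sigma V; set C := (`|h S| + L * (`|e| * gaussmx_bound Sigma)).
have g0 := gaussmx_bound_ge0 Sigma.
have C0 : 0 <= C by rewrite addr_ge0// mulr_ge0// mulr_ge0.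
pose A := e^-1 * \sum_i `|a i|.
have A0 : 0 <= A by rewrite mulr_ge0 ?invr_ge0 ?(ltW e0)//; exact: sumr_ge0.
pose A2 := (e^-1) ^+ 2 * (\sum_i a i ^+ 2) / 2.
have A20 : 0 <= A2.
  by rewrite divr_ge0// mulr_ge0 ?sqr_ge0//; apply: sumr_ge0 => k _; exact: sqr_ge0.
pose rho (x : R) (t : n.-tuple TR) : R := (e^-1 * tuple_lin a t) * x + (- A2) * x ^+ 2.
pose F (x : R) (t : n.-tuple TR) : R := x^-1 * (h (S + e *: Z t) * (expR (rho x t) - 1)).
have rE x t : x / e * tuple_lin a t - (x / e) ^+ 2 * (\sum_i a i ^+ 2) / 2 = rho x t.
  by rewrite /rho /A2; move: (tuple_lin a t) (\sum_i _) => u v; field.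
have lin_le t : `|e^-1 * tuple_lin a t| <= A * tuple_norm1 t.
  rewrite normrM gtr0_norm ?invr_gt0// /A -mulrA ler_wpM2l ?invr_ge0 ?(ltW e0)//.
  exact: norm_tuple_lin_le.
have rhoL x t : `|x| <= 1 -> `|rho x t| <= `|x| * (A * tuple_norm1 t + A2).
  move=> x1; rewrite (le_trans (ler_normD _ _))// mulrDr lerD//.
    by rewrite normrM mulrC ler_wpM2l.
  rewrite normrM normrN (ger0_norm A20) mulrC ler_wpM2r// normrX expr2.
  by rewrite ler_piMl.
have bnd (t : n.-tuple TR) : A * tuple_norm1 t + A2 <= A2 + A * expR (1 * tuple_norm1 t).
  by rewrite addrC lerD2l ler_wpM2l// mul1r le_expR_norm.
have mF x : measurable_fun [set: n.-tuple TR] (F x).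
  apply: measurable_funM => //; apply: measurable_funM; first exact: mhZ.
  apply: measurable_funB => //; apply: measurableT_comp => //.
  apply: measurable_funD => //; apply: measurable_funM => //; apply: measurable_funM => //.
  exact: measurable_tuple_lin.
(* One unit for the growth of [h], one for the linear factor of the quotient, and [A] for the
   exponential weight. *)
pose k := 1 + 1 + A; have k0 : 0 <= k by rewrite addr_ge0.
pose G (t : n.-tuple TR) : R := C * (A2 + A) * expR A2 * expR (k * tuple_norm1 t).
have dom x t : x != 0 -> `|x| <= 1 -> `|F x t| <= G t.
    move=> x0 x1; have t0 := tuple_norm1_ge0 t.
    have r1 := rhoL x t x1.
    have AA : 0 <= A * tuple_norm1 t + A2 by rewrite addr_ge0// mulr_ge0.
    have e1 : `|expR (rho x t) - 1| <= `|x| * (A * tuple_norm1 t + A2) * expR (A * tuple_norm1 t + A2).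
      rewrite (le_trans (norm_expRB1_le _))// ler_pM// ler_expR (le_trans r1)//.
      by rewrite ler_piMl.
    rewrite /F !normrM normfV ler_pdivrMl ?normr_gt0//.
    apply: (le_trans (ler_pM _ _ (frob_lipschitz_gaussmx_growth e S t) e1)) => //.
    rewrite -/C /G.
    have -> : k * tuple_norm1 t = 1 * tuple_norm1 t + 1 * tuple_norm1 t + A * tuple_norm1 t.
      by rewrite /k; ring.
    rewrite !expRD.
    move: (expR_gt0 (A * tuple_norm1 t)) (expR_gt0 A2) => p1 p2.
    have p3 : 1 <= expR (1 * tuple_norm1 t) by rewrite mul1r -[leLHS]expR0 ler_expR.
    have p4 := bnd t.
    have p5 : A * tuple_norm1 t + A2 <= (A2 + A) * expR (1 * tuple_norm1 t).
      by rewrite (le_trans p4)// mulrDl lerD2r ler_peMr.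
    have x0' := normr_ge0 x.
    rewrite (_ : `|x| * (C * (A2 + A) * expR A2 * _) =
      C * expR (1 * tuple_norm1 t) * (`|x| * ((A2 + A) * expR (1 * tuple_norm1 t)) *
       (expR (A * tuple_norm1 t) * expR A2))); last by ring.
    rewrite ler_wpM2l ?mulr_ge0 ?expR_ge0// ler_wpM2r ?mulr_ge0 ?expR_ge0//.
    by rewrite ler_wpM2l.
have Gi : rintegrable gauss G by apply: rintegrableZ; exact: rintegrable_gauss_expR.
have lim t : F x t @[x --> 0^'] --> h (S + e *: Z t) * (e^-1 * tuple_lin a t).
    have dr := is_derive_expR_quad (e^-1 * tuple_lin a t) (- A2).
    have c0 := is_derive_diff_quotient dr.
    rewrite /= !mulr0 expr0n mulr0 addr0 expR0 in c0.
    rewrite /F; under eq_fun do rewrite mulrCA.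
    by apply: cvgM => //; exact: cvg_cst.
have [_ cE] := cvg_Rintegral_dnbhs ltr01 (fun x _ _ => mF x) dom Gi lim.
apply: cvg_trans cE; apply: near_eq_cvg; near=> x.
have [i1 ->] := mollify_shift S V x en0.
rewrite /mollify -RintegralTB//; last exact: rintegrable_lipschitz_gaussmx.
rewrite -RintegralTZ; last exact: (rintegrableB i1 (rintegrable_lipschitz_gaussmx e S)).
by apply: eq_Rintegral => t _; rewrite rE /F; ring.
Unshelve. all: by end_near. Qed.

End mollification.

(** * Interpolation along the quarter circle *)

Section wishart_moments.
Context (R : realType) (d : nat).
Variables (alpha : R) (Sigma : symmx R d).
Hypothesis d_gt0 : (0 < d)%N.
Hypothesis alpha_gt0 : 0 < alpha.
Hypothesis Sigma_pd : posdefmx Sigma.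
Variable mu : probability (symmx R d) R.
Hypothesis muE : forall A : set (symmx R d), measurable A -> mu A =
  (\int[@lebesgue_symmx R d]_(X in A `&` [set X | posdefmx X])
     (wishart_pdf alpha Sigma X)%:E)%E.
Local Notation Si := (invmx (Sigma : 'M[R]_d)).

Let mu1 : mu [set: symmx R d] = 1%E.
Proof. exact: probability_setT. Qed.

Let Sigma_unit : (Sigma : 'M[R]_d) \in unitmx.
Proof. exact: pdmx_unit. Qed.

Definition std_symmx (S : symmx R d) : symmx R d :=
  (Num.sqrt alpha)^-1 *: (S - alpha *: Sigma).
Local Notation X := std_symmx.

Let sa_gt0 : 0 < Num.sqrt alpha.
Proof. by rewrite sqrtr_gt0. Qed.

Let sa2 : Num.sqrt alpha ^+ 2 = alpha.
Proof. by rewrite sqr_sqrtr// ltW. Qed.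

(** The choice M = E_ji Sigma turns the weight into the centered entry (i, j). *)
Lemma wishart_entry_ibp i j f Df L : frob_lipschitz f L -> gateaux f Df -> linear_form Df ->
  [/\ rintegrable mu (fun S => Df S (dirM (delta_mx j i *m Sigma) S)),
    rintegrable mu (fun S => f S * (S i j - alpha * Sigma i j)) &
    \int[mu]_S Df S (dirM (delta_mx j i *m Sigma) S) =
    \int[mu]_S (f S * (S i j - alpha * Sigma i j))].
Proof.
move=> fL fD fl; have [i1 i2 e2] := wishart_ibp d_gt0 Sigma_pd muE (delta_mx j i *m Sigma) fL fD fl.
have trd (A : 'M[R]_d) : \tr (delta_mx j i *m A) = A i j.
  rewrite /mxtrace (bigD1 j)//= mxE (bigD1 i)//= mxE !eqxx mul1r.
  rewrite big1 ?addr0; last first.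
    by move=> k /negPf kj; rewrite mxE eqxx kj mul0r.
  rewrite big1 ?addr0// => k /negPf kj.
  by rewrite mxE big1// => l _; rewrite mxE kj mul0r.
have E S : \tr (Si *m S *m (delta_mx j i *m Sigma)) - alpha * \tr (delta_mx j i *m Sigma) =
    S i j - alpha * Sigma i j.
  rewrite mxtrace_mulC -!mulmxA (mulmxA (Sigma : 'M[R]_d)) mulmxV// mul1mx.
  by rewrite !trd.
split => //; first by apply: eq_integrable i2 => // S _ /=; rewrite E.
by rewrite e2; apply: eq_Rintegral => S _; rewrite E.
Qed.

(** Integration by parts for the constant 1. The variance below uses the centered entry itself as
    [f], whose derivative involves only these means. *)
Lemma wishart_mean i j : rintegrable mu (fun S => S i j) /\
  \int[mu]_S S i j = alpha * Sigma i j.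
Proof.
have fL : @frob_lipschitz R d (cst 1) 0.
  by move=> S T; rewrite /= subrr normr0 mul0r.
have fD : @gateaux R d (cst 1) (fun _ _ => 0).
  by move=> S V; under eq_fun do rewrite /= subrr mulr0; exact: cvg_cst.
have fl : @linear_form R d (fun _ _ => 0) by move=> S a U V; rewrite mulr0 addr0.
have [_ i2 e2] := wishart_entry_ibp i j fL fD fl.
have ic := rintegrable_cst mu1 (alpha * Sigma i j).
have i3 : rintegrable mu (fun S => S i j).
  apply: eq_integrable (rintegrableD i2 ic) => // S _ /=.
  by rewrite mul1r subrK.
split => //.
have e3 : \int[mu]_S (S i j - alpha * Sigma i j) = 0.
  transitivity (\int[mu]_S (cst 1 S * (S i j - alpha * Sigma i j))).
    by apply: eq_Rintegral => S _; rewrite mul1r.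
  by rewrite -e2 RintegralT_cst.
by apply/eqP; rewrite -subr_eq0 -e3 RintegralTB// RintegralT_cst.
Qed.

Lemma wishart_variance i j :
  rintegrable mu (fun S => (S i j - alpha * Sigma i j) ^+ 2) /\
  \int[mu]_S (S i j - alpha * Sigma i j) ^+ 2 =
  alpha * (Sigma i j ^+ 2 + Sigma i i * Sigma j j).
Proof.
pose f (S : symmx R d) : R := S i j - alpha * Sigma i j.
have fL : frob_lipschitz f 1.
  move=> S T; rewrite mul1r /f (_ : _ - _ = ((S : 'M[R]_d) - T) i j) ?le_frob_norm//.
  by rewrite !mxE; ring.
have fD : gateaux f (fun _ V => V i j).
  move=> S V; apply: cvg_near_cst; near=> x.
  rewrite /f /= !mxE; have x0 : x != 0 by near: x; exact: nbhs_dnbhs_neq.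
  by field.
have fl : @linear_form R d (fun _ V => V i j).
  by move=> S a U V; rewrite /= !mxE.
have [i1 i2 e2] := wishart_entry_ibp i j fL fD fl.
have E S : (dirM (delta_mx j i *m Sigma) S : 'M[R]_d) i j =
    Sigma i j * S i j + Sigma i i * S j j.
  rewrite dirME trmx_mul trmx_delta trmx_symmx mulmxA !mxE; congr (_ + _).
    rewrite (bigD1 i)//= big1 ?addr0; last first.
      move=> k /negPf ki; rewrite !mxE big1 ?mul0r// => l _.
      by rewrite !mxE ki andbF mulr0.
    rewrite mxE (bigD1 j)//= big1 ?addr0; last first.
      by move=> l /negPf lj; rewrite !mxE lj mulr0.
    by rewrite !mxE !eqxx mulr1 mulrC.
  rewrite (bigD1 j)//= big1 ?addr0; last first.
    move=> k /negPf kj; rewrite !mxE big1 ?mul0r// => l _.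
    by rewrite !mxE kj andbF mulr0.
  rewrite mxE (bigD1 i)//= big1 ?addr0; last first.
    by move=> l /negPf lj; rewrite !mxE lj mulr0.
  by rewrite !mxE !eqxx mulr1.
split; first exact: i2.
rewrite -[LHS]/(\int[mu]_S (f S * f S)) -e2.
under eq_Rintegral do rewrite E.
have [ij eij] := wishart_mean i j; have [jj ejj] := wishart_mean j j.
rewrite RintegralTD; try exact: rintegrableZ.
by rewrite !RintegralTZ// eij ejj; ring.
Unshelve. all: by end_near. Qed.

(** Sum of the entry variances. It is the second factor under the square root of the final bound. *)
Lemma wishart_sqr_norm : rintegrable mu (fun S => frob_norm (X S) ^+ 2) /\
  \int[mu]_S (frob_norm (X S) ^+ 2) = frob_norm Sigma ^+ 2 + \tr Sigma ^+ 2.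
Proof.
have E S : frob_norm (X S) ^+ 2 = \sum_(p : 'I_d * 'I_d) alpha^-1 *
    (S p.1 p.2 - alpha * Sigma p.1 p.2) ^+ 2.
  rewrite /X /= sqr_frob_normE pair_big /=; apply: eq_bigr => p _.
  by rewrite !mxE exprMn exprVn sa2.
have h (p : 'I_d * 'I_d) := wishart_variance p.1 p.2.
have ip (p : 'I_d * 'I_d) : rintegrable mu (fun S => alpha^-1 *
    (S p.1 p.2 - alpha * Sigma p.1 p.2) ^+ 2).
  by apply: rintegrableZ; have [] := h p.
under eq_fun do rewrite E; split; first exact: rintegrable_sum.
rewrite Rintegral_sum// sqr_frob_normE pair_big /=.
have -> : \tr Sigma ^+ 2 = \sum_(p : 'I_d * 'I_d) Sigma p.1 p.1 * Sigma p.2 p.2.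
  by rewrite -(pair_big xpredT xpredT (fun i j => Sigma i i * Sigma j j)) /=
    expr2 /mxtrace big_distrl; apply: eq_bigr => i _; rewrite big_distrr.
rewrite -big_split; apply: eq_bigr => p _ /=.
by have [i1 e1] := h p; rewrite RintegralTZ// e1 mulKf// gt_eqF.
Qed.

Lemma measurable_std_symmx : measurable_fun [set: symmx R d] X.
Proof.
by apply: measurable_symmxZ; apply: measurable_symmxD; [exact: measurable_id|exact: measurable_cst].
Qed.

Lemma rintegrable_norm_std : rintegrable mu (fun S => frob_norm (X S)).
Proof.
have [i2 _] := wishart_sqr_norm.
apply: (rintegrable_le _ (rintegrableD (rintegrable_cst mu1 1) i2)).
  exact: (measurable_frob_norm_comp measurable_std_symmx).
by move=> S; have n0 := frob_norm_ge0 (X S : 'M[R]_d); rewrite ger0_norm//; nra.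
Qed.

Lemma wishart_norm_le : (\int[mu]_S frob_norm (X S)) ^+ 2 <= frob_norm Sigma ^+ 2 + \tr Sigma ^+ 2.
Proof.
have [i2 <-] := wishart_sqr_norm.
by apply: sqr_Rintegral_le => //; exact: rintegrable_norm_std.
Qed.

Lemma std_symmxE S : S = alpha *: Sigma + Num.sqrt alpha *: X S.
Proof.
by rewrite /X scalerA mulfV ?gt_eqF// scale1r addrC subrK.
Qed.

(** With M = Sigma^-1 T / 2 and S = alpha Sigma + sqrt alpha X, the direction S M + M^T S equals
    alpha T + sqrt alpha [sympart] (X Sigma^-1 T). The first part is the Gaussian direction; the
    second, of relative order 1 / sqrt alpha, is the whole discrepancy between the two laws. *)
Lemma wishart_std_ibp g Dg L (s : R) (T U : symmx R d) :
  frob_lipschitz g L -> gateaux g Dg -> linear_form Dg ->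
  [/\ rintegrable mu (fun S => Dg (s *: X S + U)
        (s *: T + (s / Num.sqrt alpha) *: sympart (X S *m Si *m T))),
    rintegrable mu (fun S => g (s *: X S + U) * (2^-1 * \tr (Si *m X S *m Si *m T))) &
    \int[mu]_S Dg (s *: X S + U) (s *: T + (s / Num.sqrt alpha) *: sympart (X S *m Si *m T)) =
    \int[mu]_S (g (s *: X S + U) * (2^-1 * \tr (Si *m X S *m Si *m T)))].
Proof.
move=> gL gD gl; pose k := s / Num.sqrt alpha; pose U' := U - (s * Num.sqrt alpha) *: Sigma.
pose M := 2^-1 *: (Si *m T).
have sa0 : Num.sqrt alpha != 0 by rewrite gt_eqF.
have YE S : k *: S + U' = s *: X S + U.
  rewrite /U' addrCA addrC; congr (_ + _).
  rewrite /std_symmx scalerA scalerBr scalerA; congr (_ - _ *: _).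
  by rewrite -[X in _ = _ * X]sa2; field.
have [fL fD fl] := gateaux_affine U' k gL gD gl.
have [i1 i2 e2] := wishart_ibp d_gt0 Sigma_pd muE M fL fD fl.
have E1 S : Dg (k *: S + U') (k *: dirM M S) = Num.sqrt alpha *
    Dg (s *: X S + U) (s *: T + (s / Num.sqrt alpha) *: sympart (X S *m Si *m T)).
  rewrite YE -linear_formZ//; congr (Dg _ _); have := congr1 (@symmx_val R d) (std_symmxE S).
  move: (X S) => V /= ST; apply: symmx_eq; rewrite /= [in LHS]/M.
  have -> : (S : 'M[R]_d) *m (2^-1 *: (Si *m T)) = (alpha / 2) *: (T : 'M[R]_d) +
      (Num.sqrt alpha / 2) *: (V *m Si *m T).
    rewrite ST -scalemxAr mulmxDl -!scalemxAl scalerDr !scalerA !mulmxA mulmxV// mul1mx.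
    by rewrite ![2^-1 * _]mulrC.
  have TT : (T : 'M[R]_d)^T = T by exact: trmx_symmx.
  move: (V *m Si *m T : 'M[R]_d) (T : 'M[R]_d) TT => A B BT.
  apply/matrixP => a b; have Bab := congr1 (fun C : 'M[R]_d => C a b) BT.
  rewrite mxE in Bab; rewrite !mxE Bab /k -[X in X / 2]sa2.
  by move: (Num.sqrt alpha) sa0 => r r0; field.
have E2 S : g (k *: S + U') * (\tr (Si *m S *m M) - alpha * \tr M) = Num.sqrt alpha *
    (g (s *: X S + U) * (2^-1 * \tr (Si *m X S *m Si *m T))).
  rewrite YE mulrCA; congr (_ * _); rewrite /M.
  have -> : Si *m S = alpha%:M + Num.sqrt alpha *: (Si *m X S).
    rewrite {1}[S]std_symmxE /= mulmxDr -!scalemxAr mulVmx//.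
    by congr (_ + _); rewrite scalemx1.
  rewrite mulmxDl raddfD /= mul_scalar_mx mxtraceZ addrC addKr.
  by rewrite -scalemxAl mxtraceZ -scalemxAr mxtraceZ !mulmxA.
have i1' : rintegrable mu (fun S => Dg (s *: X S + U)
    (s *: T + (s / Num.sqrt alpha) *: sympart (X S *m Si *m T))).
  apply: eq_integrable (rintegrableZ (Num.sqrt alpha)^-1 i1) => // S _ /=.
  by rewrite E1 mulKf.
have i2' : rintegrable mu (fun S => g (s *: X S + U) * (2^-1 * \tr (Si *m X S *m Si *m T))).
  apply: eq_integrable (rintegrableZ (Num.sqrt alpha)^-1 i2) => // S _ /=.
  by rewrite E2 mulKf.
split => //; apply: (mulfI sa0); rewrite -!RintegralTZ//.
transitivity (\int[mu]_S Dg (k *: S + U') (k *: dirM M S)).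
  by apply: eq_Rintegral => S _; rewrite E1.
by rewrite e2; apply: eq_Rintegral => S _; rewrite E2.
Qed.

End wishart_moments.

Section quarter_circle.
Context (R : realType).

Lemma is_derive_of_quotient (f : R -> R) (x l : R) :
  h^-1 * (f (x + h) - f x) @[h --> 0^'] --> l -> is_derive x 1 f l.
Proof.
move=> fl; have fl' : h^-1 *: (f (h *: 1 + x) - f x) @[h --> 0^'] --> l.
  apply: cvg_trans fl; apply: near_eq_cvg; near=> h.
  by rewrite /= [h *: 1]mulr1 [x + h]addrC.
by apply: DeriveDef; [exact: cvgP fl'|exact: cvg_lim fl'].
Unshelve. all: by end_near. Qed.

Lemma quotient_of_is_derive (f : R -> R) (x l : R) : is_derive x 1 f l ->
  h^-1 * (f (x + h) - f x) @[h --> 0^'] --> l.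
Proof.
move=> [df fl]; have : h^-1 *: (f (h *: 1 + x) - f x) @[h --> 0^'] --> l.
  by rewrite -fl; exact: df.
apply: cvg_trans; apply: near_eq_cvg; near=> h.
by rewrite /= [h *: 1]mulr1 [x + h]addrC.
Unshelve. all: by end_near. Qed.

Lemma cvg_quotient_bounded (q : R -> R) (l : R) : q h @[h --> 0^'] --> l ->
  exists2 delta, 0 < delta & forall h, h != 0 -> `|h| <= delta -> `|q h| <= `|l| + 1.
Proof.
move=> /cvgrPdist_lt /(_ 1 ltr01) [e /= e0 H].
exists (e / 2); first by rewrite divr_gt0.
move=> h h0 he; have : `|l - q h| < 1.
  apply: H => //=; rewrite sub0r normrN (le_lt_trans he)//.
  by rewrite ltr_pdivrMr// ltr_pMr// ltr1n.
move=> h1; rewrite -lerBlDl; rewrite distrC in h1.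
by rewrite (le_trans _ (ltW h1))// lerB_dist.
Qed.

(** By the mean value theorem f + K cos does not increase over the quarter circle, and cos drops
    there from 1 to 0. This replaces an integration of sin theta. *)
Lemma quarter_circle_increment (f df : R -> R) (K : R) :
  (forall x : R, is_derive x 1 f (df x)) ->
  (forall x : R, 0 <= x -> x <= pi / 2 -> `|df x| <= sin x * K) ->
  f (pi / 2) - f 0 <= K.
Proof.
move=> fd dfK; have p0 := @pi_gt0 R.
have p2 : (0 : R) < pi / 2 by rewrite divr_gt0.
pose F (x : R) : R := f x + K * cos x.
have Fd (x : R) : is_derive x 1 F (df x - K * sin x).
  have h1 := fd x.
  have h2 : is_derive x 1 (fun y : R => K * cos y) (K * - sin x).
    by apply: is_derive_eq.
  by rewrite -mulrN; exact: is_deriveD.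
have cF : {within `[0, pi / 2], continuous F}.
  apply: derivable_within_continuous => x _.
  by case: (Fd x).
have [c cI cE] := MVT_segment (ltW p2) (fun x _ => Fd x) cF.
move: cI; rewrite in_itv /= => /andP[c0 c1].
have dc := dfK c c0 c1.
have neg : df c - K * sin c <= 0.
  by rewrite subr_le0 mulrC (le_trans (ler_norm _)).
have : F (pi / 2) - F 0 <= 0 by rewrite cE subr0 mulr_le0_ge0// ltW.
by rewrite /F cos_pihalf cos0 mulr0 addr0 mulr1 opprD addrA subr_le0.
Qed.

End quarter_circle.

Section interpolation.
Context (R : realType) (d : nat).
Variables (alpha : R) (Sigma : symmx R d).
Hypothesis d_gt0 : (0 < d)%N.
Hypothesis alpha_gt0 : 0 < alpha.
Hypothesis Sigma_pd : posdefmx Sigma.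
Variable mu : probability (symmx R d) R.
Hypothesis muE : forall A : set (symmx R d), measurable A -> mu A =
  (\int[@lebesgue_symmx R d]_(X in A `&` [set X | posdefmx X])
     (wishart_pdf alpha Sigma X)%:E)%E.
Local Notation Si := (invmx (Sigma : 'M[R]_d)).
Local Notation TR := (measurableTypeR R).
Local Notation n := #|{: 'I_d * 'I_d}|.
Local Notation Z := (gaussmx Sigma).
Local Notation X := (std_symmx alpha Sigma).
Local Notation gs := (gauss R n).
Local Notation pm := (mu \x gs)%E.
Local Notation P := (symmx R d * n.-tuple TR)%type.

Let mu1 : mu [set: symmx R d] = 1%E.
Proof. exact: probability_setT. Qed.

Lemma gauss_gateaux_ibp g Dg L (c : R) (U V : symmx R d) :
  frob_lipschitz g L -> gateaux g Dg ->
  [/\ rintegrable gs (fun t => Dg (U + c *: Z t) (c *: V)),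
    rintegrable gs (fun t => g (U + c *: Z t) * (2^-1 * \tr (Si *m V *m Si *m Z t))) &
    \int[gs]_t Dg (U + c *: Z t) (c *: V) =
    \int[gs]_t (g (U + c *: Z t) * (2^-1 * \tr (Si *m V *m Si *m Z t)))].
Proof.
move=> gL gD.
have mg := measurable_lipschitz gL.
have zE t x : U + c *: Z (tuple_shift (fun k => x * gauss_dir Sigma V k) t) =
    U + c *: Z t + x *: (c *: V).
  by rewrite gaussmx_shift//; move: (Z t) => z; rewrite scalerDr addrA !scalerA mulrC.
have mF : measurable_fun [set: n.-tuple TR] (fun t => g (U + c *: Z t)).
  apply: (measurableT_comp mg); apply: measurable_symmxD; first exact: measurable_cst.
  by apply: measurable_symmxZ; exact: measurable_gaussmx.
have gr t : `|g (U + c *: Z t)| <=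
    (`|g U| + L * (`|c| * gaussmx_bound Sigma)) * expR (1 * tuple_norm1 t).
  exact: (frob_lipschitz_gaussmx_growth Sigma d_gt0 gL).
have li t x : `|g (U + c *: Z (tuple_shift (fun k => x * gauss_dir Sigma V k) t)) -
    g (U + c *: Z t)| <= L * frob_norm (c *: V : symmx R d) * `|x|.
  rewrite zE (le_trans (gL _ _))// -mulrA; move: (Z t) (c *: V) => z v.
  rewrite (_ : (_ - _ : 'M[R]_d) = x *: (v : 'M[R]_d)); first by rewrite frob_normZ [`|x| * _]mulrC.
  by rewrite /= [_ + x *: _]addrC addrK.
have lim t : x^-1 * (g (U + c *: Z (tuple_shift (fun k => x * gauss_dir Sigma V k) t)) -
    g (U + c *: Z t)) @[x --> 0^'] --> Dg (U + c *: Z t) (c *: V).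
  by under eq_fun do rewrite zE; exact: gD.
have [i1 i2 e] := gauss_ibp ler01 mF gr li lim.
split => //.
- by apply: eq_integrable i2 => // t _ /=; rewrite tuple_lin_gauss_dir.
- by rewrite e; apply: eq_Rintegral => t _; rewrite tuple_lin_gauss_dir.
Qed.

Lemma rintegrable_pm (F : P -> R) (C : R) : 0 <= C -> measurable_fun [set: P] F ->
  (forall p, `|F p| <= C * ((1 + frob_norm (X p.1)) ^+ 2 * (1 + frob_norm (Z p.2)) ^+ 2)) ->
  rintegrable pm F.
Proof.
move=> C0 mF FC.
have [i2 _] := wishart_sqr_norm d_gt0 alpha_gt0 Sigma_pd muE.
have i1 := rintegrable_norm_std d_gt0 alpha_gt0 Sigma_pd muE.
have iX : rintegrable mu (fun S => C * (1 + frob_norm (X S)) ^+ 2).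
  apply: rintegrableZ.
  apply: eq_integrable (rintegrableD (rintegrable_cst mu1 1)
    (rintegrableD (rintegrableZ 2 i1) i2)) => // S _ /=.
  by congr EFin; ring.
have iZ : rintegrable gs (fun t => (1 + frob_norm (Z t)) ^+ 2).
  apply: (@rintegrable_gaussmx_growth _ _ Sigma _ 1) => //.
    apply: measurable_funX; apply: measurable_funD => //.
    exact: (measurable_frob_norm_comp (measurable_gaussmx Sigma)).
  by move=> t; rewrite mul1r ger0_norm// sqr_ge0.
apply: (rintegrable_prod iX iZ) => //.
  by move=> S; rewrite mulr_ge0// sqr_ge0.
by move=> S t; rewrite -mulrA; exact: FC.
Qed.

Lemma measurable_std_fst : measurable_fun [set: P] (fun p => X p.1).
Proof. exact: (measurableT_comp (measurable_std_symmx alpha Sigma) measurable_fst). Qed.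

Lemma measurable_gaussmx_snd : measurable_fun [set: P] (fun p => Z p.2).
Proof. exact: (measurableT_comp (measurable_gaussmx Sigma) measurable_snd). Qed.

Definition qarc (s c : R) (p : P) : symmx R d := s *: X p.1 + c *: Z p.2.

Lemma measurable_qarc s c : measurable_fun [set: P] (qarc s c).
Proof.
apply: measurable_symmxD; apply: measurable_symmxZ.
  exact: measurable_std_fst.
exact: measurable_gaussmx_snd.
Qed.

Lemma frob_norm_qarc s c p : frob_norm (qarc s c p) <=
  (`|s| + `|c|) * ((1 + frob_norm (X p.1)) * (1 + frob_norm (Z p.2))).
Proof.
rewrite /qarc; have x0 := frob_norm_ge0 (X p.1 : 'M[R]_d).
have z0 := frob_norm_ge0 (Z p.2 : 'M[R]_d).
move: (X p.1) (Z p.2) x0 z0 => V T x0 z0.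
rewrite (le_trans (frob_normD _ _))// !frob_normZ mulrDl lerD// ler_wpM2l//; nra.
Qed.

Definition crossmx (p : P) : symmx R d := sympart (X p.1 *m Si *m Z p.2).

Lemma measurable_crossmx : measurable_fun [set: P] crossmx.
Proof.
have mX := measurable_std_fst; have mZ := measurable_gaussmx_snd.
apply: measurable_fun_symmx => i j.
have mE a b : measurable_fun [set: P] (fun p => (X p.1 *m Si *m Z p.2 : 'M[R]_d) a b).
  under eq_fun do rewrite mxE; apply: measurable_sum => k; apply: measurable_funM.
    under eq_fun do rewrite mxE; apply: measurable_sum => l; apply: measurable_funM => //.
    exact: (measurableT_comp (@measurable_symmx_entry R d _ _) mX).
  exact: (measurableT_comp (@measurable_symmx_entry R d _ _) mZ).
rewrite (_ : (fun p => _) = (fun p => 2^-1 * ((X p.1 *m Si *m Z p.2 : 'M[R]_d) i j +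
   (X p.1 *m Si *m Z p.2 : 'M[R]_d) j i))).
  by apply: measurable_funM => //; exact: measurable_funD.
by apply/funext => p; rewrite /crossmx /=; move: (_ *m _ *m _) => A; rewrite !mxE.
Qed.

Lemma frob_norm_crossmx p : frob_norm (crossmx p) <= frob_norm (X p.1 *m Si *m Z p.2).
Proof. exact: frob_norm_sympart. Qed.

Lemma frob_norm_cross_le p : frob_norm (X p.1 *m Si *m Z p.2) <=
  frob_norm Si * (frob_norm (X p.1) * frob_norm (Z p.2)).
Proof.
rewrite (le_trans (frob_normM _ _))// mulrCA mulrA ler_wpM2r ?frob_norm_ge0//.
exact: frob_normM.
Qed.

End interpolation.

Section interpolation_derivative.
Context (R : realType) (d : nat).
Variables (alpha : R) (Sigma : symmx R d).
Hypothesis d_gt0 : (0 < d)%N.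
Hypothesis alpha_gt0 : 0 < alpha.
Hypothesis Sigma_pd : posdefmx Sigma.
Variable mu : probability (symmx R d) R.
Hypothesis muE : forall A : set (symmx R d), measurable A -> mu A =
  (\int[@lebesgue_symmx R d]_(X in A `&` [set X | posdefmx X])
     (wishart_pdf alpha Sigma X)%:E)%E.
Local Notation Si := (invmx (Sigma : 'M[R]_d)).
Local Notation TR := (measurableTypeR R).
Local Notation n := #|{: 'I_d * 'I_d}|.
Local Notation Z := (gaussmx Sigma).
Local Notation X := (std_symmx alpha Sigma).
Local Notation gs := (gauss R n).
Local Notation pm := (mu \x gs)%E.
Local Notation P := (symmx R d * n.-tuple TR)%type.
Local Notation qarc := (@qarc R d alpha Sigma).
Local Notation crossmx := (@crossmx R d alpha Sigma).

Variables (g : symmx R d -> R) (Dg : symmx R d -> symmx R d -> R) (L : R).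
Hypotheses (gL : frob_lipschitz g L) (gD : gateaux g Dg) (gl : linear_form Dg).

Let mg : measurable_fun [set: symmx R d] g.
Proof. exact: measurable_lipschitz gL. Qed.

Let L0 : 0 <= L.
Proof. exact: frob_lipschitz_ge0 gL. Qed.

Let x0 S : 0 <= frob_norm (X S). Proof. exact: frob_norm_ge0. Qed.
Let z0 t : 0 <= frob_norm (Z t). Proof. exact: frob_norm_ge0. Qed.

Lemma rintegrable_pm_lin (V : P -> symmx R d) (C : R) : 0 <= C ->
  measurable_fun [set: P] V ->
  (forall p, frob_norm (V p) <= C * ((1 + frob_norm (X p.1)) * (1 + frob_norm (Z p.2)))) ->
  rintegrable pm (fun p => frob_norm (V p)).
Proof.
move=> C0 mV VC; apply: (rintegrable_pm d_gt0 alpha_gt0 Sigma_pd muE C0).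
  exact: measurable_frob_norm_comp.
move=> p; rewrite ger0_norm ?frob_norm_ge0// (le_trans (VC p))// ler_wpM2l//.
by rewrite -exprMn expr2 ler_peMl// ?mulr_ge0 ?addr_ge0//; have := x0 p.1; have := z0 p.2; nra.
Qed.

Lemma rintegrable_pm_gateaux s c (V : P -> symmx R d) (C : R) : 0 <= C ->
  measurable_fun [set: P] V ->
  (forall p, frob_norm (V p) <= C * ((1 + frob_norm (X p.1)) * (1 + frob_norm (Z p.2)))) ->
  rintegrable pm (fun p => Dg (qarc s c p) (V p)).
Proof.
move=> C0 mV VC; apply: (rintegrable_gateaux gL gD) => //; first exact: measurable_qarc.
exact: rintegrable_pm_lin VC.
Qed.

Lemma rintegrable_pm_arc s c : rintegrable pm (fun p => g (qarc s c p)).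
Proof.
apply: (@rintegrable_le _ _ _ _ _ (fun p => `|g 0| * 1 + L * frob_norm (qarc s c p))).
- by apply: (measurableT_comp mg); exact: measurable_qarc.
- apply: rintegrableD.
    apply: rintegrableZ; apply: (rintegrable_pm d_gt0 alpha_gt0 Sigma_pd muE ler01) => //.
    move=> p; rewrite normr1 mul1r -exprMn expr2; have := x0 p.1; have := z0 p.2; nra.
  apply: rintegrableZ; apply: (rintegrable_pm_lin (C := `|s| + `|c|)) => //.
  + exact: measurable_qarc.
  + by move=> p; exact: frob_norm_qarc.
- move=> p; have := gL (qarc s c p) 0; rewrite /= subr0 => h.
  by rewrite mulr1 -lerBlDl (le_trans _ h)// lerB_dist.
Qed.

Lemma frob_norm_fst_le (p : P) : frob_norm (X p.1) <=
  1 * ((1 + frob_norm (X p.1)) * (1 + frob_norm (Z p.2))).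
Proof. by have := x0 p.1; have := z0 p.2; nra. Qed.

Lemma frob_norm_snd_le (p : P) : frob_norm (Z p.2) <=
  1 * ((1 + frob_norm (X p.1)) * (1 + frob_norm (Z p.2))).
Proof. by have := x0 p.1; have := z0 p.2; nra. Qed.

Lemma frob_norm_cross_growth (p : P) : frob_norm (X p.1 *m Si *m Z p.2) <=
  frob_norm Si * ((1 + frob_norm (X p.1)) * (1 + frob_norm (Z p.2))).
Proof.
rewrite (le_trans (frob_norm_cross_le _ _ _))// ler_wpM2l ?frob_norm_ge0//.
by have := x0 p.1; have := z0 p.2; nra.
Qed.

Lemma rintegrable_cross : rintegrable pm (fun p => frob_norm (X p.1 *m Si *m Z p.2)).
Proof.
apply: (rintegrable_pm d_gt0 alpha_gt0 Sigma_pd muE (frob_norm_ge0 Si)).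
  have mX := measurable_std_fst alpha Sigma; have mZ := measurable_gaussmx_snd Sigma.
  rewrite (_ : (fun p => _) = (fun p => Num.sqrt (\sum_i \sum_j (X p.1 *m Si *m Z p.2 : 'M[R]_d) i j ^+ 2))).
    apply: measurableT_comp; first by apply: continuous_measurable_fun; exact: sqrt_continuous.
    apply: measurable_sum => i; apply: measurable_sum => j; apply: measurable_funX.
    under eq_fun do rewrite mxE; apply: measurable_sum => k; apply: measurable_funM.
      under eq_fun do rewrite mxE; apply: measurable_sum => l; apply: measurable_funM => //.
      exact: (measurableT_comp (@measurable_symmx_entry R d _ _) mX).
    exact: (measurableT_comp (@measurable_symmx_entry R d _ _) mZ).
  by apply/funext => p; rewrite -sqr_frob_normE sqrtr_sqr ger0_norm ?frob_norm_ge0.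
move=> p; rewrite ger0_norm ?frob_norm_ge0// (le_trans (frob_norm_cross_growth p))//.
rewrite ler_wpM2l ?frob_norm_ge0//.
by rewrite -exprMn expr2 ler_peMl// ?mulr_ge0 ?addr_ge0//; have := x0 p.1; have := z0 p.2; nra.
Qed.

(* Integrating by parts in [p.2] for the part along [X p.1], and in [p.1] for the
   part along [Z p.2], gives the same integral. *)
Lemma interpolation_identity s c :
  [/\ rintegrable pm (fun p => Dg (qarc s c p) (c *: X p.1 - s *: Z p.2)),
    rintegrable pm (fun p => Dg (qarc s c p) ((s / Num.sqrt alpha) *: crossmx p)) &
    \int[pm]_p Dg (qarc s c p) (c *: X p.1 - s *: Z p.2) =
    \int[pm]_p Dg (qarc s c p) ((s / Num.sqrt alpha) *: crossmx p)].
Proof.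
have mX := measurable_std_fst alpha Sigma; have mZ := measurable_gaussmx_snd Sigma.
pose k := s / Num.sqrt alpha.
have bX p : frob_norm (c *: X p.1 : symmx R d) <=
    `|c| * ((1 + frob_norm (X p.1)) * (1 + frob_norm (Z p.2))).
  by rewrite frob_normZ ler_wpM2l//; have := frob_norm_fst_le p; rewrite mul1r.
have bZ p : frob_norm (s *: Z p.2 : symmx R d) <=
    `|s| * ((1 + frob_norm (X p.1)) * (1 + frob_norm (Z p.2))).
  by rewrite frob_normZ ler_wpM2l//; have := frob_norm_snd_le p; rewrite mul1r.
have bC p : frob_norm (k *: crossmx p : symmx R d) <=
    `|k| * frob_norm Si * ((1 + frob_norm (X p.1)) * (1 + frob_norm (Z p.2))).
  rewrite frob_normZ -mulrA ler_wpM2l// (le_trans (frob_norm_crossmx _ _ _))//.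
  exact: frob_norm_cross_growth.
have i1 := rintegrable_pm_gateaux s c (normr_ge0 c) (measurable_symmxZ c mX) bX.
have i2 := rintegrable_pm_gateaux s c (normr_ge0 s) (measurable_symmxZ s mZ) bZ.
have kS0 : 0 <= `|k| * frob_norm Si by rewrite mulr_ge0// frob_norm_ge0.
have i3 := rintegrable_pm_gateaux s c kS0
  (measurable_symmxZ k (measurable_crossmx alpha Sigma)) bC.
(* [H] is the common right-hand side of the two integrations by parts; its trace is symmetric in X
   and Z. *)
pose H (p : P) : R := g (qarc s c p) * (2^-1 * \tr (Si *m X p.1 *m Si *m Z p.2)).
have iH : rintegrable pm H.
  pose K := `|g 0| + L * (`|s| + `|c|).
  have K0 : 0 <= K by rewrite addr_ge0// mulr_ge0// addr_ge0.
  apply: (rintegrable_pm d_gt0 alpha_gt0 Sigma_pd muE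
    (C := K * (frob_norm Si ^+ 2))).
  - by rewrite mulr_ge0// sqr_ge0.
  - apply: measurable_funM; first by apply: (measurableT_comp mg); exact: measurable_qarc.
    apply: measurable_funM => //.
    have mE a b (Y : P -> symmx R d) : measurable_fun [set: P] Y ->
        measurable_fun [set: P] (fun p => (Si *m Y p : 'M[R]_d) a b).
      move=> mY; under eq_fun do rewrite mxE; apply: measurable_sum => l.
      by apply: measurable_funM => //; exact: (measurableT_comp (@measurable_symmx_entry R d _ _) mY).
    apply: measurable_sum => a; under eq_fun do rewrite -mulmxA mxE.
    apply: measurable_sum => b; apply: measurable_funM; exact: mE.
  - move=> p; have a0 := x0 p.1; have b0 := z0 p.2.
    have g1 : `|g (qarc s c p)| <= K * ((1 + frob_norm (X p.1)) * (1 + frob_norm (Z p.2))).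
      have := gL (qarc s c p) 0; rewrite /= subr0 => h.
      have h2 := ler_wpM2l L0 (frob_norm_qarc alpha Sigma s c p).
      have h3 : `|g (qarc s c p)| <= `|g 0| + L * frob_norm (qarc s c p).
        by rewrite -lerBlDl (le_trans _ h)// lerB_dist.
      rewrite (le_trans h3)// /K mulrDl lerD// -?mulrA//.
      by rewrite ler_peMr//; nra.
    have g2 : `|2^-1 * \tr (Si *m X p.1 *m Si *m Z p.2)| <=
        frob_norm Si ^+ 2 * (frob_norm (X p.1) * frob_norm (Z p.2)).
      have := mxtrace_mul_le (Si *m X p.1 *m Si)^T (Z p.2); rewrite trmxK frob_norm_tr => h.
      have h2 : frob_norm (Si *m X p.1 *m Si) <= frob_norm Si ^+ 2 * frob_norm (X p.1).
        rewrite (le_trans (frob_normM _ _))// expr2 mulrAC ler_wpM2r ?frob_norm_ge0//.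
        exact: frob_normM.
      have h3 := ler_wpM2r b0 h2.
      rewrite normrM gtr0_norm ?invr_gt0// mulrA.
      have t0 := normr_ge0 (\tr (Si *m X p.1 *m Si *m Z p.2)).
      by move: h h3 t0; lra.
    rewrite normrM (le_trans (ler_pM _ _ g1 g2))//.
    have S0 := sqr_ge0 (frob_norm Si).
    rewrite [leLHS](_ : _ = K * frob_norm Si ^+ 2 * ((1 + frob_norm (X p.1)) * (1 + frob_norm (Z p.2)) *
       (frob_norm (X p.1) * frob_norm (Z p.2)))); last by ring.
    apply: ler_wpM2l; first by rewrite mulr_ge0.
    rewrite -exprMn expr2 ler_wpM2l ?mulr_ge0 ?addr_ge0//.
    nra.
have eA : \int[pm]_p Dg (qarc s c p) (c *: X p.1) = \int[pm]_p H p.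
  have h S := gauss_gateaux_ibp d_gt0 Sigma_pd c (s *: X S) (X S) gL gD.
  have [_ ->] := Rintegral_prodl i1 (fun S => let: And3 a _ _ := h S in a).
  have [_ ->] := Rintegral_prodl iH (fun S => let: And3 _ a _ := h S in a).
  by apply: eq_Rintegral => S _; have [_ _] := h S.
have iB : rintegrable pm (fun p => Dg (qarc s c p) (s *: Z p.2 + k *: crossmx p)).
  apply: eq_integrable (rintegrableD i2 i3) => // p _ /=.
  by rewrite linear_formD.
have eB : \int[pm]_p Dg (qarc s c p) (s *: Z p.2 + k *: crossmx p) = \int[pm]_p H p.
  have h t := wishart_std_ibp d_gt0 alpha_gt0 Sigma_pd muE s (Z t) (c *: Z t) gL gD gl.
  have [_ ->] := Rintegral_prodr iB (fun t => let: And3 a _ _ := h t in a).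
  have [_ ->] := Rintegral_prodr iH (fun t => let: And3 _ a _ := h t in a).
  by apply: eq_Rintegral => t _; have [_ _] := h t.
have E1 p : Dg (qarc s c p) (c *: X p.1 - s *: Z p.2) =
    Dg (qarc s c p) (c *: X p.1) - Dg (qarc s c p) (s *: Z p.2).
  by rewrite linear_formD// -scaleN1r [X in _ + X]linear_formZ// mulN1r.
split => //.
  by apply: eq_integrable (rintegrableB i1 i2) => // p _ /=; rewrite E1.
under eq_Rintegral do rewrite E1.
rewrite RintegralTB// eA -eB.
under eq_Rintegral do rewrite linear_formD//.
by rewrite RintegralTD// addrC addKr.
Qed.

Lemma arc_derivative_le s c : `|\int[pm]_p Dg (qarc s c p) (c *: X p.1 - s *: Z p.2)| <=
  `|s| * (L / Num.sqrt alpha * \int[pm]_p frob_norm (X p.1 *m Si *m Z p.2)).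
Proof.
have [_ i2 ->] := interpolation_identity s c.
have sa0 : 0 <= (Num.sqrt alpha)^-1 by rewrite invr_ge0 sqrtr_ge0.
rewrite mulrA -RintegralTZ; last exact: rintegrable_cross.
apply: norm_RintegralT_le => //; first by apply: rintegrableZ; exact: rintegrable_cross.
move=> p; rewrite (le_trans (gateaux_le _ _ gL gD))// frob_normZ normrM (ger0_norm sa0).
rewrite [leRHS](_ : _ = L * (`|s| / Num.sqrt alpha * frob_norm (X p.1 *m Si *m Z p.2))); last by ring.
by rewrite ler_wpM2l// ler_wpM2l ?mulr_ge0// frob_norm_crossmx.
Qed.

Definition arc_mean (x : R) : R := \int[pm]_p g (qarc (sin x) (cos x) p).

(** Differentiation under the integral. The quotients of sine and cosine are bounded near 0, so the
    Lipschitz property of [g] gives a dominating function linear in the two norms. *)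
Lemma is_derive_arc_mean (x : R) : is_derive x 1 arc_mean
  (\int[pm]_p Dg (qarc (sin x) (cos x) p) (cos x *: X p.1 - sin x *: Z p.2)).
Proof.
have mX := measurable_std_fst alpha Sigma; have mZ := measurable_gaussmx_snd Sigma.
pose qs (h : R) := h^-1 * (sin (x + h) - sin x).
pose qc (h : R) := h^-1 * (cos (x + h) - cos x).
have qsl : qs h @[h --> 0^'] --> cos x by exact: (quotient_of_is_derive (is_derive_sin x)).
have qcl : qc h @[h --> 0^'] --> - sin x by exact: (quotient_of_is_derive (is_derive_cos x)).
have [d1 d10 qsb] := cvg_quotient_bounded qsl.
have [d2 d20 qcb] := cvg_quotient_bounded qcl.
pose A := `|cos x| + 1; pose B := `|- sin x| + 1.
have A0 : 0 <= A by rewrite addr_ge0.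
have B0 : 0 <= B by rewrite addr_ge0.
pose Y := qarc (sin x) (cos x).
pose F (h : R) (p : P) : R := h^-1 * (g (qarc (sin (x + h)) (cos (x + h)) p) - g (Y p)).
have YE h p : h != 0 -> qarc (sin (x + h)) (cos (x + h)) p =
    Y p + h *: (qs h *: X p.1 + qc h *: Z p.2).
  move=> h0; rewrite /Y /qarc scalerDr !scalerA addrACA -!scalerDl /qs /qc.
  by rewrite !mulVKf// ![_ + (_ - _)]addrC !subrK.
apply: is_derive_of_quotient.
have mF h : h != 0 -> `|h| <= Num.min d1 d2 -> measurable_fun [set: P] (F h).
  move=> _ _; apply: measurable_funM => //; apply: measurable_funB.
    by apply: (measurableT_comp mg); exact: measurable_qarc.
  by apply: (measurableT_comp mg); exact: measurable_qarc.
have dom h p : h != 0 -> `|h| <= Num.min d1 d2 ->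
    `|F h p| <= L * (A * frob_norm (X p.1) + B * frob_norm (Z p.2)).
  move=> h0; rewrite le_min => /andP[h1 h2].
  rewrite /F YE// normrM normfV ler_pdivrMl ?normr_gt0// (le_trans (gL _ _))//.
  have b1 := qsb h h0 h1; have b2 := qcb h h0 h2.
  have a0 := x0 p.1; have c0 := z0 p.2; move: (X p.1) (Z p.2) a0 c0 => V T a0 c0.
  rewrite (_ : (_ - _ : 'M[R]_d) = h *: (qs h *: (V : 'M[R]_d) + qc h *: (T : 'M[R]_d))); last first.
    by rewrite /= addrC addKr.
  rewrite frob_normZ mulrCA ler_wpM2l// ler_wpM2l// (le_trans (frob_normD _ _))//.
  by rewrite !frob_normZ lerD// ler_wpM2r.
have iG : rintegrable pm (fun p => L * (A * frob_norm (X p.1) + B * frob_norm (Z p.2))).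
  apply: rintegrableZ; apply: rintegrableD; apply: rintegrableZ.
    exact: (rintegrable_pm_lin ler01 mX frob_norm_fst_le).
  exact: (rintegrable_pm_lin ler01 mZ frob_norm_snd_le).
have lim p : F h p @[h --> 0^'] --> Dg (Y p) (cos x *: X p.1 - sin x *: Z p.2).
  pose V := cos x *: X p.1 - sin x *: Z p.2.
  (* The chord direction of the circle is replaced by the tangent one; as [g] is Lipschitz, the
     error is controlled by the distance between the two directions. *)
  pose r (h : R) : R := h^-1 * (g (Y p + h *: (qs h *: X p.1 + qc h *: Z p.2)) - g (Y p + h *: V)).
  pose nX := frob_norm (X p.1); pose nZ := frob_norm (Z p.2).
  have r0 : r h @[h --> 0^'] --> (0 : R).
    apply/norm_cvg0P; apply: (@squeeze_cvgr _ _ _ _ (cst 0) (fun h : R =>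
      L * (`|qs h - cos x| * nX + `|qc h - - sin x| * nZ))).
    - near=> h; rewrite normr_ge0 /= /r normrM.
      have h0 : h != 0 by near: h; exact: nbhs_dnbhs_neq.
      rewrite normfV ler_pdivrMl ?normr_gt0// (le_trans (gL _ _))//.
      rewrite /V /nX /nZ; move: (Y p) (X p.1) (Z p.2) => y v t.
      rewrite (_ : (_ - _ : 'M[R]_d) = h *: ((qs h - cos x) *: (v : 'M[R]_d) + (qc h - - sin x) *: (t : 'M[R]_d))).
        rewrite frob_normZ mulrCA ler_wpM2l// ler_wpM2l// (le_trans (frob_normD _ _))//.
        by rewrite !frob_normZ.
      by apply/matrixP => a b; rewrite !mxE; ring.
    - exact: cvg_cst.
    - rewrite [X in _ --> X](_ : 0 = L * (`|cos x - cos x| * nX + `|- sin x - - sin x| * nZ)).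
        apply: cvgM; first exact: cvg_cst.
        apply: cvgD; apply: cvgM; try exact: cvg_cst.
          by apply: cvg_norm; apply: cvgB => //; exact: cvg_cst.
        by apply: cvg_norm; apply: cvgB => //; exact: cvg_cst.
      by rewrite !subrr normr0 !mul0r addr0 mulr0.
  have c1 : r h + h^-1 * (g (Y p + h *: V) - g (Y p)) @[h --> 0^'] --> 0 + Dg (Y p) V.
    by apply: cvgD => //; exact: gD.
  rewrite add0r in c1; apply: cvg_trans c1; apply: near_eq_cvg; near=> h.
  have h0 : h != 0 by near: h; exact: nbhs_dnbhs_neq.
  by rewrite /r /F YE//; ring.
have dd0 : 0 < Num.min d1 d2 by rewrite lt_min d10.
have [_ cE] := cvg_Rintegral_dnbhs dd0 mF dom iG lim.
apply: cvg_trans cE; apply: near_eq_cvg; near=> h.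
rewrite /arc_mean -RintegralTB; try exact: rintegrable_pm_arc.
rewrite -RintegralTZ//; apply: rintegrableB; exact: rintegrable_pm_arc.
Unshelve. all: by end_near. Qed.

Lemma smooth_gap : \int[mu]_S g (X S) - \int[gs]_t g (Z t) <=
  L / Num.sqrt alpha * \int[pm]_p frob_norm (X p.1 *m Si *m Z p.2).
Proof.
have := quarter_circle_increment is_derive_arc_mean
  (K := L / Num.sqrt alpha * \int[pm]_p frob_norm (X p.1 *m Si *m Z p.2)).
have e1 : arc_mean (pi / 2) = \int[mu]_S g (X S).
  rewrite /arc_mean sin_pihalf cos_pihalf.
  have E S t : g (qarc 1 0 (S, t)) = g (X S).
    by rewrite /qarc scale1r scale0r addr0.
  have [||_ ->] := @Rintegral_prodl _ _ _ _ _ mu gs (fun p => g (qarc 1 0 p)).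
  - exact: rintegrable_pm_arc.
  - by move=> S; under eq_fun do rewrite E; exact: rintegrable_gauss_cst.
  by apply: eq_Rintegral => S _; under eq_Rintegral do rewrite E; rewrite Rintegral_gauss_cst.
have e0 : arc_mean 0 = \int[gs]_t g (Z t).
  rewrite /arc_mean sin0 cos0.
  have E t S : g (qarc 0 1 (S, t)) = g (Z t).
    by rewrite /qarc scale1r scale0r add0r.
  have mu1 : mu [set: symmx R d] = 1%E by exact: probability_setT.
  have [||_ ->] := @Rintegral_prodr _ _ _ _ _ mu gs (fun p => g (qarc 0 1 p)).
  - exact: rintegrable_pm_arc.
  - by move=> t; under eq_fun do rewrite E; exact: rintegrable_cst.
  by apply: eq_Rintegral => t _; under eq_Rintegral do rewrite E; rewrite RintegralT_cst.
rewrite e1 e0; apply => x x_ge0 x_le.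
rewrite (le_trans (arc_derivative_le _ _))// ger0_norm// sin_ge0_pi//.
by rewrite x_ge0 (le_trans x_le)// ler_pdivrMr// ler_peMr ?pi_ge0// ler1n.
Qed.

End interpolation_derivative.

(** * The upper bound *)

Section gaussian_product_norm.
Context (R : realType) (d : nat).
Variable Sigma : symmx R d.
Hypothesis Sigma_pd : posdefmx Sigma.
Local Notation TR := (measurableTypeR R).
Local Notation n := #|{: 'I_d * 'I_d}|.
Local Notation Z := (gaussmx Sigma).
Local Notation Si := (invmx (Sigma : 'M[R]_d)).

Lemma measurable_norm_mul_gaussmx (B : 'M[R]_d) :
  measurable_fun [set: n.-tuple TR] (fun t => frob_norm (B *m Z t)).
Proof.
rewrite (_ : (fun t => _) = (fun t => Num.sqrt (\sum_i \sum_j (B *m Z t : 'M[R]_d) i j ^+ 2))).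
  apply: measurableT_comp; first by apply: continuous_measurable_fun; exact: sqrt_continuous.
  apply: measurable_sum => i; apply: measurable_sum => j; apply: measurable_funX.
  under eq_fun do rewrite mxE; apply: measurable_sum => k; apply: measurable_funM => //.
  exact: (measurableT_comp (@measurable_symmx_entry R d _ _) (measurable_gaussmx Sigma)).
by apply/funext => t; rewrite -sqr_frob_normE sqrtr_sqr ger0_norm ?frob_norm_ge0.
Qed.

Lemma rintegrable_norm_mul_gaussmx (B : 'M[R]_d) :
  rintegrable (gauss R n) (fun t => frob_norm (B *m Z t)).
Proof.
apply: (rintegrable_le (measurable_norm_mul_gaussmx B)
  (rintegrableZ (frob_norm B) (rintegrable_frob_gaussmx Sigma))) => t.
by rewrite ger0_norm ?frob_norm_ge0// frob_normM.
Qed.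

Lemma gauss_sqr_norm_mul (B : 'M[R]_d) :
  rintegrable (gauss R n) (fun t => frob_norm (B *m Z t) ^+ 2) /\
  \int[gauss R n]_t (frob_norm (B *m Z t) ^+ 2) =
  \tr Sigma * \tr (B *m Sigma *m B^T) + frob_norm (B *m Sigma) ^+ 2.
Proof.
pose Idx := (('I_d * 'I_d) * ('I_d * 'I_d))%type.
pose F (p : Idx) t : R := B p.1.1 p.2.1 * B p.1.1 p.2.2 *
  ((Z t) p.2.1 p.1.2 * (Z t) p.2.2 p.1.2).
have E t : frob_norm (B *m Z t) ^+ 2 = \sum_p F p t.
  rewrite sqr_frob_normE pair_big /= -(pair_big xpredT xpredT (fun p q => F (p, q) t)) /=.
  apply: eq_bigr => -[i j] _ /=; rewrite mxE expr2 big_distrl /=.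
  rewrite -(pair_big xpredT xpredT (fun a c => F ((i, j), (a, c)) t)) /=.
  apply: eq_bigr => a _; rewrite big_distrr /=; apply: eq_bigr => c _.
  by rewrite /F /=; move: ((Z t) a j) ((Z t) c j) => u v; ring.
have Fi p : rintegrable (gauss R n) (F p).
  by apply: rintegrableZ; have [] := gaussmx_covariance Sigma_pd p.2.1 p.1.2 p.2.2 p.1.2.
under eq_fun do rewrite E; split; first exact: rintegrable_sum.
rewrite Rintegral_sum//.
pose S := (Sigma : 'M[R]_d).
have FE p : \int[gauss R n]_t F p t = B p.1.1 p.2.1 * B p.1.1 p.2.2 *
    (S p.2.1 p.2.2 * S p.1.2 p.1.2 + S p.2.1 p.1.2 * S p.1.2 p.2.2).
  have [i1 e1] := gaussmx_covariance Sigma_pd p.2.1 p.1.2 p.2.2 p.1.2.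
  by rewrite RintegralTZ// e1.
under eq_bigr do rewrite FE.
rewrite -(pair_big xpredT xpredT (fun p q : 'I_d * 'I_d => B p.1 q.1 * B p.1 q.2 *
  (S q.1 q.2 * S p.2 p.2 + S q.1 p.2 * S p.2 q.2))) /=.
rewrite -(pair_big xpredT xpredT (fun i j => \sum_(q : 'I_d * 'I_d) B i q.1 * B i q.2 *
  (S q.1 q.2 * S j j + S q.1 j * S j q.2))) /=.
rewrite sqr_frob_normE /mxtrace mulr_sumr -big_split /=; apply: eq_bigr => i _.
rewrite mulr_suml -big_split /=; apply: eq_bigr => j _.
rewrite -(pair_big xpredT xpredT (fun a c => B i a * B i c *
  (S a c * S j j + S a j * S j c))) /=.
have -> : (B *m Sigma *m B^T) i i = \sum_a \sum_c B i a * S a c * B i c.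
  rewrite mxE exchange_big /=; apply: eq_bigr => c _; rewrite !mxE mulr_suml.
  by apply: eq_bigr => a _.
rewrite expr2 [in X in _ + X]mxE big_distrl /= mulr_sumr -big_split; apply: eq_bigr => a _ /=.
rewrite big_distrr mulr_sumr -big_split; apply: eq_bigr => c _ /=.
by rewrite (symmx_sym Sigma c j) -/S; ring.
Qed.

(** Cauchy-Schwarz, then the second moment with B = V Sigma^-1, for which B Sigma = V and B Sigma
    B^T = V Sigma^-1 V. *)
Lemma gauss_norm_cross_le (V : symmx R d) : (0 < d)%N ->
  (\int[gauss R n]_t frob_norm (V *m Si *m Z t)) ^+ 2 <=
  (1 + spectral_norm Si * \tr Sigma) * frob_norm V ^+ 2.
Proof.
move=> d0; have [i2 e2] := gauss_sqr_norm_mul (V *m Si).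
have U : (Sigma : 'M[R]_d) \in unitmx by exact: pdmx_unit.
have SiT : Si^T = Si by rewrite trmx_inv trmx_symmx.
apply: (le_trans (sqr_Rintegral_le _ (rintegrable_norm_mul_gaussmx _) i2)).
  exact: gauss_setT.
rewrite e2 mulmxKV// trmx_mul SiT !trmx_symmx.
have h := mxtrace_quad_le Si V d0; rewrite trmx_symmx in h.
have t0 : 0 <= \tr Sigma.
  apply: sumr_ge0 => i _; have nz : (delta_mx i 0 : 'cV[R]_d) != 0.
    by apply/eqP => /matrixP /(_ i 0) /eqP; rewrite !mxE !eqxx oner_eq0.
  by have := Sigma_pd nz; rewrite trmx_delta -rowE -colE !mxE; exact: ltW.
rewrite addrC mulrDl mul1r lerD2l mulmxA.
rewrite [leRHS](_ : _ = \tr Sigma * (spectral_norm Si * frob_norm V ^+ 2)); last by ring.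
exact: ler_wpM2l.
Qed.

End gaussian_product_norm.

Section dimension_one.
Context (R : realType).
Variable Sigma : symmx R 1.
Hypothesis Sigma_pd : posdefmx Sigma.
Local Notation TR := (measurableTypeR R).
Local Notation n := #|{: 'I_1 * 'I_1}|.
Local Notation Z := (gaussmx Sigma).
Local Notation Si := (invmx (Sigma : 'M[R]_1)).

(** In dimension one Z = sqrt 2 Sigma N with N standard normal, and (E |N|)^2 = 2 / pi, whence 4 /
    pi. *)
Lemma gauss_norm_cross1 (V : symmx R 1) :
  (\int[gauss R n]_t frob_norm (V *m Si *m Z t)) ^+ 2 = 4 / pi * frob_norm V ^+ 2.
Proof.
have U : (Sigma : 'M[R]_1) \in unitmx by exact: pdmx_unit.
have [_ QQ] := sqrt_symmxP Sigma_pd.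
pose k : 'I_n := enum_rank (ord0, ord0 : 'I_1).
have n1 (A : 'M[R]_1) : frob_norm A = `|A 0 0|.
  by rewrite -[LHS]ger0_norm ?frob_norm_ge0// -sqrtr_sqr sqr_frob_normE !big_ord1 sqrtr_sqr.
have SS : Si 0 0 * Sigma 0 0 = 1.
  by have := congr1 (fun A : 'M[R]_1 => A 0 0) (mulVmx U); rewrite mxE big_ord1 => ->; rewrite mxE eqxx.
have qq : (sqrt_symmx Sigma) 0 0 * (sqrt_symmx Sigma) 0 0 = Sigma 0 0.
  by have := congr1 (fun A : 'M[R]_1 => A 0 0) QQ; rewrite mxE big_ord1.
have zE t : (Z t) 0 0 = Num.sqrt 2 * (Sigma 0 0 * tnth t k).
  by rewrite /gaussmx /= !mxE !big_ord1 !mxE !big_ord1 !mxE -qq; field.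
have E t : frob_norm (V *m Si *m Z t) = (Num.sqrt 2 * frob_norm V) * `|tnth t k : R|.
  rewrite n1 mxE big_ord1 mxE big_ord1 zE n1.
  rewrite [X in `|X|](_ : _ = Num.sqrt 2 * (Si 0 0 * Sigma 0 0) * V 0 0 * (tnth t k : R)); last by ring.
  by rewrite SS mulr1 !normrM [`|Num.sqrt 2|]ger0_norm// sqrtr_ge0.
under eq_Rintegral do rewrite E.
have mk : measurable_fun [set: n.-tuple TR] (fun t => `|tnth t k : R|).
  by apply: measurableT_comp => //; exact: measurable_tnth.
have ek : (\int[gauss R n]_t (`|tnth t k : R|)%:E = (Num.sqrt (2 / pi))%:E)%E.
  rewrite -integral_normal_norm.
  apply: (gauss_marginal k (f := fun x : TR => (`|x : R|%R)%:E)) => //.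
  by apply/measurable_EFinP; exact: (@normr_measurable R setT).
have ik : rintegrable (gauss R n) (fun t => `|tnth t k : R|).
  by apply: ge0_rintegrable => //; rewrite ek ltry.
rewrite RintegralTZ// [X in _ * X]/Rintegral ek /=; move: (frob_norm V) => v; rewrite !exprMn !sqr_sqrtr// ?divr_ge0 ?pi_ge0//.
by move: (@pi R) (pi_gt0 R) => c c0; field; rewrite gt_eqF.
Qed.

End dimension_one.

Section gap.
Context (R : realType) (d : nat).
Variables (alpha : R) (Sigma : symmx R d).
Hypothesis d_gt0 : (0 < d)%N.
Hypothesis alpha_gt0 : 0 < alpha.
Hypothesis Sigma_pd : posdefmx Sigma.
Variable mu : probability (symmx R d) R.
Hypothesis muE : forall A : set (symmx R d), measurable A -> mu A =
  (\int[@lebesgue_symmx R d]_(X in A `&` [set X | posdefmx X])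
     (wishart_pdf alpha Sigma X)%:E)%E.
Local Notation Si := (invmx (Sigma : 'M[R]_d)).
Local Notation TR := (measurableTypeR R).
Local Notation n := #|{: 'I_d * 'I_d}|.
Local Notation Z := (gaussmx Sigma).
Local Notation X := (std_symmx alpha Sigma).
Local Notation gs := (gauss R n).
Local Notation pm := (mu \x gs)%E.

Let mu1 : mu [set: symmx R d] = 1%E.
Proof. exact: probability_setT. Qed.

Lemma rintegrable_lipschitz_std (h : symmx R d -> R) L : frob_lipschitz h L ->
  rintegrable mu (fun S => h (X S)).
Proof.
move=> hL; have L0 := frob_lipschitz_ge0 d_gt0 hL.
have i1 := rintegrable_norm_std d_gt0 alpha_gt0 Sigma_pd muE.
apply: (rintegrable_le _ (rintegrableD (rintegrable_cst mu1 `|h 0|) (rintegrableZ L i1))).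
  exact: (measurableT_comp (measurable_lipschitz hL) (measurable_std_symmx alpha Sigma)).
move=> S; have := hL (X S) 0; rewrite /= subr0 => hS.
by rewrite -lerBlDl (le_trans _ hS)// lerB_dist.
Qed.

Lemma rintegrable_lipschitz_gauss (h : symmx R d -> R) L : frob_lipschitz h L ->
  rintegrable gs (fun t => h (Z t)).
Proof.
move=> hL; have := rintegrable_lipschitz_gaussmx Sigma d_gt0 hL 1 0.
by under eq_fun do rewrite add0r scale1r.
Qed.

Lemma lipschitz_gap_half (h : symmx R d -> R) : frob_lipschitz h 1 ->
  \int[mu]_S h (X S) - \int[gs]_t h (Z t) <=
  1 / Num.sqrt alpha * \int[pm]_p frob_norm (X p.1 *m Si *m Z p.2).
Proof.
move=> hL; set B := (X in _ <= X).
pose C := \int[gs]_t frob_norm (Z t).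
have C0 : 0 <= C by apply: Rintegral_ge0 => t _; exact: frob_norm_ge0.
apply/ler_addgt0Pr => e e0.
(* Mollifying costs at most [eta * C] under each of the two laws, together at most [e]; C + 1 avoids
   dividing by 0. *)
pose eta := e / (2 * (C + 1)).
have C1 : 0 < 2 * (C + 1) by rewrite mulr_gt0// ltr_wpDl.
have eta0 : 0 < eta by rewrite divr_gt0.
pose g := mollify Sigma h eta.
have gL : frob_lipschitz g 1 := mollify_lipschitz Sigma d_gt0 hL eta.
have gD : gateaux g (mollify_deriv Sigma h eta) := mollify_gateaux Sigma_pd d_gt0 hL eta0.
have gl : linear_form (mollify_deriv Sigma h eta) := mollify_linear Sigma d_gt0 hL eta.
have G := smooth_gap d_gt0 alpha_gt0 Sigma_pd muE gL gD gl.
rewrite -/B in G.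
have close S : `|g S - h S| <= eta * C.
  by rewrite (le_trans (mollify_dist Sigma d_gt0 hL _ _))// gtr0_norm// mulr1.
have hX := rintegrable_lipschitz_std hL; have gX := rintegrable_lipschitz_std gL.
have hZ := rintegrable_lipschitz_gauss hL; have gZ := rintegrable_lipschitz_gauss gL.
have c1 : \int[mu]_S h (X S) <= \int[mu]_S g (X S) + eta * C.
  rewrite -[X in _ + X](RintegralT_cst mu1) -RintegralTD//; last exact: rintegrable_cst.
  apply: ler_RintegralT => //; first by apply: rintegrableD => //; exact: rintegrable_cst.
  by move=> S; have := close (X S); rewrite ler_norml => /andP[? _]; lra.
have c2 : \int[gs]_t g (Z t) <= \int[gs]_t h (Z t) + eta * C.
  rewrite -[X in _ + X](@Rintegral_gauss_cst R n) -RintegralTD//; last exact: rintegrable_gauss_cst.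
  apply: ler_RintegralT => //; first by apply: rintegrableD => //; exact: rintegrable_gauss_cst.
  by move=> t; have := close (Z t); rewrite ler_norml => /andP[_ ?]; lra.
have c3 : 2 * (eta * C) <= e.
  rewrite /eta mulrA (_ : 2 * (e / _) = e / (C + 1)); last by field; lra.
  by rewrite mulrAC ler_pdivrMr ?ler_wpM2l ?(ltW e0)//; lra.
by move: G c1 c2 c3; lra.
Qed.

Lemma lipschitz_gap (h : symmx R d -> R) : frob_lipschitz h 1 ->
  `|\int[mu]_S h (X S) - \int[gs]_t h (Z t)| <=
  1 / Num.sqrt alpha * \int[pm]_p frob_norm (X p.1 *m Si *m Z p.2).
Proof.
move=> hL; rewrite ler_norml lipschitz_gap_half// andbT lerNl.
have nL : frob_lipschitz (fun S => - h S) 1.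
  by move=> S T; rewrite opprK addrC distrC; exact: hL.
apply: le_trans (lipschitz_gap_half nL).
have E d' (T : measurableType d') (m : {measure set T -> \bar R}) (f : T -> R) :
    rintegrable m f -> \int[m]_x - f x = - \int[m]_x f x.
  by move=> fi; under eq_Rintegral do rewrite -mulN1r; rewrite RintegralTZ// mulN1r.
rewrite !E; first by rewrite opprB opprK addrC.
- exact: rintegrable_lipschitz_gauss hL.
- exact: rintegrable_lipschitz_std hL.
Qed.

(** The Gaussian integral is taken first with X fixed, then the second moment of X is used. [K]
    stands for the Gaussian constant, whose proof depends on the dimension. *)
Lemma cross_le (K : R) : 0 <= K ->
  (forall V : symmx R d, (\int[gs]_t frob_norm (V *m Si *m Z t)) ^+ 2 <= K * frob_norm V ^+ 2) ->
  \int[pm]_p frob_norm (X p.1 *m Si *m Z p.2) <=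
  Num.sqrt (K * (frob_norm Sigma ^+ 2 + \tr Sigma ^+ 2)).
Proof.
move=> K0 KV.
have i1 := rintegrable_norm_std d_gt0 alpha_gt0 Sigma_pd muE.
have [j1 ->] := Rintegral_prodl (rintegrable_cross d_gt0 alpha_gt0 Sigma_pd muE)
  (fun S => rintegrable_norm_mul_gaussmx Sigma (X S *m Si)).
rewrite sqrtrM//.
apply: (@le_trans _ _ (Num.sqrt K * \int[mu]_S frob_norm (X S))); last first.
  rewrite ler_wpM2l ?sqrtr_ge0// -[leLHS]ger0_norm; last first.
    by apply: Rintegral_ge0 => S _; exact: frob_norm_ge0.
  rewrite -sqrtr_sqr ler_sqrt ?addr_ge0 ?sqr_ge0//.
  exact: wishart_norm_le.
rewrite -RintegralTZ//; apply: ler_RintegralT => //; first exact: rintegrableZ.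
move=> S /=; have := KV (X S).
set I := \int[gs]_t _; have I0 : 0 <= I by apply: Rintegral_ge0 => t _; exact: frob_norm_ge0.
move=> /ler_wsqrtr; rewrite sqrtr_sqr ger0_norm// sqrtrM// sqrtr_sqr ger0_norm//.
exact: frob_norm_ge0.
Qed.

End gap.

(* Cauchy-Schwarz is too lossy in dimension one: it would require [2 pi <= 4]. *)
Lemma gauss_norm_cross_pi (R : realType) (d : nat) (Sigma V : symmx R d) :
  (0 < d)%N -> posdefmx Sigma ->
  (\int[gauss R #|{: 'I_d * 'I_d}|]_t
    frob_norm (V *m invmx (Sigma : 'M[R]_d) *m gaussmx Sigma t)) ^+ 2 <=
  spectral_norm (invmx Sigma) ^+ 2 * ((d%:R + 2) * \tr Sigma ^+ 2 + frob_norm Sigma ^+ 2)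
    / pi * frob_norm V ^+ 2.
Proof.
case: d Sigma V => [//|[|d]] Sigma V _ Spd.
  rewrite gauss_norm_cross1//.
  have h1 := dim_le_spectral_trace (ltn0Sn 0) (trmx_symmx Sigma) Spd.
  have h2 := dim_le_spectral_frob (ltn0Sn 0) (pdmx_unit Spd).
  rewrite ler_wpM2r ?sqr_ge0// ler_wpM2r ?invr_ge0 ?pi_ge0//.
  rewrite mulrDr [_ ^+ 2 * (_ * _)]mulrCA -exprMn.
  (* For d = 1 the claim reduces to 4 <= 3 u^2 + v with u and v at least 1; it is an equality when
     both are 1. *)
  by move: (spectral_norm _ * \tr _) (_ ^+ 2 * _ ^+ 2) h1 h2 => u v; nra.
have h1 := dim_le_spectral_trace (ltn0Sn d.+1) (trmx_symmx Sigma) Spd.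
have V0 := sqr_ge0 (frob_norm V).
apply: (le_trans (gauss_norm_cross_le Spd V (ltn0Sn d.+1))).
rewrite ler_wpM2r// ler_pdivlMr ?pi_gt0//.
rewrite [leRHS]mulrDr [_ ^+ 2 * (_ * _)]mulrCA -exprMn -exprMn.
(* With u = |Sigma^-1|_2 tr Sigma >= d >= 2, one has (1 + u) pi <= 4 (1 + u) <= 4 u^2 <= (d + 2)
   u^2. *)
have p4 : @pi R <= 4 by have := @pihalf_lt2 R; move: (@pi R) => c; lra.
have v0 := sqr_ge0 (spectral_norm (invmx Sigma) * frob_norm Sigma).
have d2 : 2 <= d.+2%:R :> R by rewrite ler_nat.
move: (spectral_norm _ * \tr _) (_ ^+ 2) h1 v0 => u v h1 v0.
have u2 : 2 <= u by exact: le_trans h1.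
apply: (@le_trans _ _ ((1 + u) * 4)).
  by rewrite ler_wpM2l//; lra.
have : 4 * u ^+ 2 <= (d.+2%:R + 2) * u ^+ 2.
  by rewrite ler_wpM2r ?sqr_ge0//; lra.
by move=> h; nra.
Qed.

(** * From random matrices to their laws *)

Section change_of_variables.
Context d1 d2 (T1 : measurableType d1) (T2 : measurableType d2) (R : realType).
Variables (m1 : {measure set T1 -> \bar R}) (m2 : {measure set T2 -> \bar R}).
Variable phi : T2 -> T1.
Hypothesis mphi : measurable_fun [set: T2] phi.
Hypothesis phiE : forall F : T1 -> \bar R, measurable_fun [set: T1] F ->
  (forall x, 0 <= F x)%E -> (\int[m1]_x F x = \int[m2]_y F (phi y))%E.

(** The distance is defined by extended integrals of signed functions, so the hypothesis is applied
    to positive and negative parts separately. *)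
Lemma integral_change_of_variables (f : T1 -> R) : measurable_fun [set: T1] f ->
  rintegrable m2 (f \o phi) -> (\int[m1]_x (f x)%:E = (\int[m2]_y f (phi y))%:E)%E.
Proof.
move=> mf fi; rewrite -rintegrable_fin//.
have mEf : measurable_fun [set: T1] (EFin \o f) by exact/measurable_EFinP.
rewrite integralE [RHS]integralE phiE//; last exact: measurable_funepos.
rewrite [X in (_ - X)%E]phiE//; last exact: measurable_funeneg.
by congr (_ - _)%E; apply: eq_integral => y _; rewrite ?funeposE ?funenegE.
Qed.

End change_of_variables.

Lemma mutually_independent_enum (R : realType) dT (T : measurableType dT)
    (P : probability T R) (I : finType) (Y : I -> {RV P >-> R}) :
  mutually_independent Y -> mutually_independent (fun k : 'I_#|I| => Y (enum_val k)).
Proof.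
move=> YI J B mB.
have := YI (@enum_val I I @: J) (fun i => B (enum_rank i)) (fun i => mB _).
rewrite big_imset /=; last by move=> x y _ _; exact: enum_val_inj.
under eq_bigr do rewrite enum_valK.
move=> <-; congr (P _); apply/seteqP; split=> w /= H.
  by move=> i /imsetP[k kJ ->] /=; rewrite enum_valK; exact: H.
by move=> k kJ; have := H (enum_val k) (imset_f _ kJ); rewrite /= enum_valK.
Qed.

Section transfer.
Context (R : realType) (d : nat) (alpha : R) (Sigma : symmx R d).
Context (dT1 dT2 : measure_display) (T1 : measurableType dT1) (T2 : measurableType dT2).
Variables (P1 : probability T1 R) (P2 : probability T2 R).
Variables (W : {RV P1 >-> symmx R d}) (G : 'I_d -> 'I_d -> {RV P2 >-> R}).
Local Notation TR := (measurableTypeR R).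
Local Notation n := #|{: 'I_d * 'I_d}|.

Lemma integral_center_scale (f : symmx R d -> R) : measurable_fun [set: symmx R d] f ->
  rintegrable (distribution P1 W) (fun S => f (std_symmx alpha Sigma S)) ->
  (\int[distribution P1 (center_scale alpha Sigma W)]_S (f S)%:E =
   (\int[distribution P1 W]_S f (std_symmx alpha Sigma S))%:E)%E.
Proof.
move=> mf fi.
apply: (integral_change_of_variables (phi := std_symmx alpha Sigma)) => // F mF F0.
rewrite ge0_integral_pushforward//= preimage_setT.
rewrite [RHS]ge0_integral_pushforward//= ?preimage_setT//.
exact: (measurableT_comp mF (measurable_std_symmx alpha Sigma)).
Qed.

Lemma integral_center_scale_gauss (f : symmx R d -> R) : 0 < alpha -> ginibre P2 G ->
  measurable_fun [set: symmx R d] f ->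
  rintegrable (gauss R n) (fun t => f (gaussmx Sigma t)) ->
  (\int[distribution P2 (center_scale alpha Sigma (gaussian_Z alpha Sigma G))]_S (f S)%:E =
   (\int[gauss R n]_t f (gaussmx Sigma t))%:E)%E.
Proof.
move=> a0 [Gn GI] mf fi.
apply: (integral_change_of_variables (phi := gaussmx Sigma)) => // F mF F0.
pose Y (k : 'I_n) : {RV P2 >-> R} := G (enum_val k).1 (enum_val k).2.
have Yn k : standard_normal (Y k) by exact: Gn.
have YI : mutually_independent Y := mutually_independent_enum GI.
rewrite ge0_integral_pushforward//= preimage_setT.
rewrite -(gauss_law Yn YI); last 2 first.
- exact: (measurableT_comp mF (measurable_gaussmx Sigma)).
- by move=> t; exact: F0.
have tE w : tuple_mx [tuple (Y k w : TR) | k < n] = \matrix_(i, j) G i j w.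
  by apply/matrixP => i j; rewrite !mxE tnth_mktuple /Y enum_rankK.
apply: eq_integral => w _; congr F.
rewrite /gaussmx tE; apply: symmx_eq; rewrite /= addrC addKr scalerA; congr (_ *: _).
by rewrite mulrC sqrtrM// mulfK// gt_eqF// sqrtr_gt0.
Qed.

End transfer.

Section wasserstein_bounds.
Context (R : realType) (d : nat) (mu nu : probability (symmx R d) R).

Lemma wasserstein_le (D : R) :
  (forall h, frob_lipschitz h 1 -> exists a b : R,
    [/\ (\int[mu]_S (h S)%:E = a%:E)%E, (\int[nu]_S (h S)%:E = b%:E)%E & `|a - b| <= D]) ->
  (wasserstein mu nu <= D%:E)%E.
Proof.
move=> hD; apply: ub_ereal_sup => _ [h /= hL <-].
have hL1 : frob_lipschitz h 1 by move=> S T; rewrite mul1r; exact: hL.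
by have [a [b [-> -> ab]]] := hD h hL1; rewrite -EFinB /= lee_fin.
Qed.

Lemma le_wasserstein (h : symmx R d -> R) (a b : R) : frob_lipschitz h 1 ->
  (\int[mu]_S (h S)%:E = a%:E)%E -> (\int[nu]_S (h S)%:E = b%:E)%E ->
  (`|a - b|%:E <= wasserstein mu nu)%E.
Proof.
move=> hL ea eb; apply: ereal_sup_ubound.
by exists h => [S T|]; [rewrite -[leRHS]mul1r; exact: hL|rewrite ea eb].
Qed.

End wasserstein_bounds.

(** * The lower bound *)

Section cauchy_kernel.
Context (R : realType).

(** [ckern] and [xckern] are the functions q and p of the overview; both are bounded and Lipschitz,
    as test functions for the distance should be. *)
Definition ckern (x : R) : R := (1 + x ^+ 2)^-1.

Definition xckern (x : R) : R := x * ckern x.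

Lemma ckern_den_gt0 (x : R) : 0 < 1 + x ^+ 2.
Proof. by rewrite ltr_wpDr ?sqr_ge0. Qed.

Lemma ckern_gt0 x : 0 < ckern x.
Proof. by rewrite invr_gt0 ckern_den_gt0. Qed.

Lemma ckernE x : (1 + x ^+ 2) * ckern x = 1.
Proof. by rewrite mulfV// gt_eqF// ckern_den_gt0. Qed.

Lemma ckern_le1 x : ckern x <= 1.
Proof. by rewrite invf_le1 ?ckern_den_gt0// lerDl sqr_ge0. Qed.

Lemma norm_xckern_le x : `|xckern x| <= 2^-1.
Proof.
rewrite /xckern normrM (gtr0_norm (ckern_gt0 x)) ler_pdivrMr ?ckern_den_gt0//.
have := sqr_ge0 (`|x| - 1); rewrite -[x ^+ 2]real_normK ?num_real//.
by move: `|x| => y; nra.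
Qed.

Lemma ckern_lipschitz x y : `|ckern x - ckern y| <= `|x - y|.
Proof.
have -> : ckern x - ckern y = (y - x) * (xckern x * ckern y + ckern x * xckern y).
  rewrite /xckern /ckern; field.
  by rewrite !gt_eqF ?ckern_den_gt0.
rewrite normrM distrC ler_piMr// (le_trans (ler_normD _ _))//.
rewrite (normrM (xckern x)) (normrM (ckern x)).
rewrite !(gtr0_norm (ckern_gt0 _)).
have := norm_xckern_le x; have := norm_xckern_le y.
have := ckern_le1 x; have := ckern_le1 y; have := ckern_gt0 x; have := ckern_gt0 y.
move: (normr_ge0 (xckern x)) (normr_ge0 (xckern y)).
move: (ckern x) (ckern y) `|xckern x| `|xckern y| => a b p q p0 q0 b0 a0 b1 a1 q2 p2.
have h1 : p * b <= 2^-1 * 1 by apply: ler_pM => //; exact: ltW.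
have h2 : a * q <= 1 * 2^-1 by apply: ler_pM => //; exact: ltW.
by lra.
Qed.

(** The difference is (x - y) (q(x) q(y) - p(x) p(y)). Since q^2 + p^2 = q <= 1, the points (q, p)
    lie in the unit disc, and the second factor is at most 1 in absolute value by Lagrange's
    identity. *)
Lemma xckern_lipschitz x y : `|xckern x - xckern y| <= `|x - y|.
Proof.
have -> : xckern x - xckern y = (x - y) * (ckern x * ckern y - xckern x * xckern y).
  rewrite /xckern /ckern; field.
  by rewrite !gt_eqF ?ckern_den_gt0.
rewrite normrM ler_piMr//.
have hx := ckernE x; have hy := ckernE y.
have px := ckern_gt0 x; have py := ckern_gt0 y.
have cx : xckern x ^+ 2 = ckern x - ckern x ^+ 2.
  by rewrite /xckern exprMn -{2}[ckern x]mul1r -hx; ring.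
have cy : xckern y ^+ 2 = ckern y - ckern y ^+ 2.
  by rewrite /xckern exprMn -{2}[ckern y]mul1r -hy; ring.
have lx := ckern_le1 x; have ly := ckern_le1 y.
move: (ckern x) (ckern y) (xckern x) (xckern y) px py cx cy lx ly => a b p q.
move=> a0 b0 pa qb a1 b1.
rewrite -(@ler_pXn2r _ 2) ?nnegrE// expr1n real_normK ?num_real//.
have h := sqr_ge0 (a * q + p * b).
have -> : (a * b - p * q) ^+ 2 = (a ^+ 2 + p ^+ 2) * (b ^+ 2 + q ^+ 2) - (a * q + p * b) ^+ 2 by ring.
have -> : a ^+ 2 + p ^+ 2 = a by rewrite pa; ring.
have -> : b ^+ 2 + q ^+ 2 = b by rewrite qb; ring.
by nra.
Qed.

(** The quotient simplifies algebraically to - b (p(a + h b) q(a) + q(a + h b) p(a)), so only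
    continuity of q and p is left to use. *)
Lemma ckern_quotient (a b : R) :
  h^-1 * (ckern (a + h * b) - ckern a) @[h --> 0^'] --> - 2 * xckern a * ckern a * b.
Proof.
have p0 := ckern_den_gt0.
have c1 : xckern (a + h * b) * ckern a + ckern (a + h * b) * xckern a @[h --> 0^'] -->
    xckern a * ckern a + ckern a * xckern a.
  have lim : h * b @[h --> 0^'] --> (0 : R).
    have : {for (0:R), continuous (fun h : R => h * b)}.
      by move=> ?; apply: cvgM; [exact: cvg_id|exact: cvg_cst].
    by move=> /continuous_withinNx /=; rewrite mul0r.
  have squeeze (f : R -> R) : (forall x y, `|f x - f y| <= `|x - y|) ->
      f (a + h * b) @[h --> 0^'] --> f a.
    move=> fl; apply/subr_cvg0/norm_cvg0P.
    apply: (@squeeze_cvgr _ _ _ _ (cst 0) (fun h : R => `|h * b|)).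
    - near=> h; rewrite normr_ge0 /= (le_trans (fl _ _))//.
      by rewrite (_ : a + h * b - a = h * b)//; ring.
    - exact: cvg_cst.
    - by rewrite -[X in _ --> X](@normr0 R R); exact: cvg_norm.
  apply: cvgD; apply: cvgM; try exact: cvg_cst; apply: squeeze.
  - exact: xckern_lipschitz.
  - exact: ckern_lipschitz.
have c2 : (- b) * (xckern (a + h * b) * ckern a + ckern (a + h * b) * xckern a) @[h --> 0^'] -->
    (- b) * (xckern a * ckern a + ckern a * xckern a).
  by apply: cvgM => //; exact: cvg_cst.
rewrite (_ : - 2 * _ * _ * b = (- b) * (xckern a * ckern a + ckern a * xckern a)); last by ring.
apply: cvg_trans c2; apply: near_eq_cvg; near=> h.
have h0 : h != 0 by near: h; exact: nbhs_dnbhs_neq.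
have q0 := p0 a; have q1 := p0 (a + h * b).
rewrite /xckern /ckern; field.
by rewrite h0 !gt_eqF.
Unshelve. all: by end_near. Qed.

End cauchy_kernel.

Section trace_functionals.
Context (R : realType) (d : nat).
Variable Sigma : symmx R d.
Local Notation Si := (invmx (Sigma : 'M[R]_d)).
Local Notation tS := (wishart_tr Sigma).
Local Notation sig := (frob_norm Si).

Lemma wishart_tr_lipschitz (f : R -> R) (K : R) : 0 <= K ->
  (forall x y, `|f x - f y| <= K * `|x - y|) ->
  frob_lipschitz (fun S => f (tS S)) (K * sig).
Proof.
move=> K0 fK S T; rewrite (le_trans (fK _ _))// -mulrA ler_wpM2l//.
have -> : tS S - tS T = tS (S - T).
  have -> : S - T = S + (-1) *: T by rewrite scaleN1r.
  by rewrite wishart_trD wishart_trZ mulN1r.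
exact: wishart_tr_le.
Qed.

Lemma wishart_tr_linear (c : symmx R d -> R) : linear_form (fun S V => c S * tS V).
Proof. by move=> S a U V; rewrite wishart_trD wishart_trZ; ring. Qed.

Lemma wishart_tr_Sigma : posdefmx Sigma -> tS Sigma = d%:R.
Proof. by move=> /pdmx_unit U; rewrite /wishart_tr mulVmx// mxtrace1. Qed.

Lemma ckern_gateaux : gateaux (fun S => ckern (tS S))
  (fun S V => - 2 * xckern (tS S) * ckern (tS S) * tS V).
Proof.
move=> S V; under eq_fun do rewrite wishart_trD wishart_trZ.
exact: ckern_quotient.
Qed.

Lemma wishart_tr_gateaux : gateaux (fun S => tS S) (fun S V => 1 * tS V).
Proof.
move=> S V; apply: cvg_near_cst; near=> h.
have h0 : h != 0 by near: h; exact: nbhs_dnbhs_neq.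
by rewrite wishart_trD wishart_trZ addrAC subrr add0r mulKf// mul1r.
Unshelve. all: by end_near. Qed.

End trace_functionals.

(** A nonnegative function of mean 0 vanishes almost everywhere. It serves to pass from the mean of
    p(T)^2 to that of T^2, which is known. *)
Lemma Rintegral_eq0_trans d (T : measurableType d) (R : realType) (mu : {measure set T -> \bar R})
    (f g : T -> R) : measurable_fun [set: T] f -> measurable_fun [set: T] g ->
  (forall x, 0 <= f x) -> (forall x, 0 <= g x) -> (forall x, f x = 0 -> g x = 0) ->
  rintegrable mu f -> \int[mu]_x f x = 0 -> \int[mu]_x g x = 0.
Proof.
move=> mf mg f0 g0 fg fi If.
have mEf : measurable_fun [set: T] (EFin \o f) by exact/measurable_EFinP.
have mEg : measurable_fun [set: T] (EFin \o g) by exact/measurable_EFinP.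
have /(ae_eq_integral_abs mu measurableT mEf) h : (\int[mu]_x `|(EFin \o f) x| = 0)%E.
  rewrite -[RHS](congr1 EFin If) -rintegrable_fin//; apply: eq_integral => x _ /=.
  by rewrite ger0_norm.
have /(ae_eq_integral_abs mu measurableT mEg) h' : ae_eq mu [set: T] (EFin \o g) (cst 0%E).
  apply: filterS h => x /= + _ => /(_ I) [] /fg gx.
  by rewrite gx.
rewrite /Rintegral -[RHS]/(fine 0%E) -h'; congr fine; apply: eq_integral => x _ /=.
by rewrite ger0_norm.
Qed.

Section lower_bound.
Context (R : realType) (d : nat).
Variable Sigma : symmx R d.
Hypothesis d_gt0 : (0 < d)%N.
Hypothesis Sigma_pd : posdefmx Sigma.
Local Notation Si := (invmx (Sigma : 'M[R]_d)).
Local Notation TR := (measurableTypeR R).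
Local Notation n := #|{: 'I_d * 'I_d}|.
Local Notation Z := (gaussmx Sigma).
Local Notation gs := (gauss R n).
Local Notation tS := (wishart_tr Sigma).
Local Notation sig := (frob_norm Si).

Let U : (Sigma : 'M[R]_d) \in unitmx.
Proof. exact: pdmx_unit. Qed.

Definition tr_bump (S : symmx R d) : R := xckern (tS S) ^+ 2.

(** Along Sigma the derivative of q(T) is -2 d p(T) q(T), and the Gaussian weight is T / 2. Twice
    the difference of the two sides is p(T) + 4 d p(T) q(T), which is the origin of 4 d. *)
Definition tr_odd (S : symmx R d) : R :=
  xckern (tS S) + 4 * d%:R * (xckern (tS S) * ckern (tS S)).

Lemma tr_bump_lipschitz : frob_lipschitz tr_bump sig.
Proof.
have h := @wishart_tr_lipschitz R d Sigma (fun x => xckern x ^+ 2) 1 ler01.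
rewrite mul1r in h; apply: h => x y; rewrite mul1r.
rewrite subr_sqr normrM mulrC (le_trans _ (xckern_lipschitz x y))// ler_piMl//.
rewrite (le_trans (ler_normD _ _))//.
by have := norm_xckern_le x; have := norm_xckern_le y; lra.
Qed.

Lemma tr_odd_lipschitz : frob_lipschitz tr_odd ((1 + 6 * d%:R) * sig).
Proof.
(* Since q <= 1 and |p| <= 1/2, the product p q has Lipschitz constant 1 + 1/2, and 4 d times 3/2 is
   6 d. *)
have K0 : 0 <= 1 + 6 * d%:R :> R by rewrite addr_ge0// mulr_ge0.
apply: (@wishart_tr_lipschitz R d Sigma (fun x => xckern x + 4 * d%:R * (xckern x * ckern x))) => // x y.
have -> : xckern x + 4 * d%:R * (xckern x * ckern x) -
    (xckern y + 4 * d%:R * (xckern y * ckern y)) =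
  (xckern x - xckern y) + 4 * d%:R * (ckern x * (xckern x - xckern y) +
    xckern y * (ckern x - ckern y)) by ring.
have h1 := xckern_lipschitz x y; have h2 := ckern_lipschitz x y.
rewrite (le_trans (ler_normD _ _))// [leRHS]mulrDl mul1r lerD// normrM.
rewrite [leRHS](_ : _ = `|4 * d%:R| * (1 * `|x - y| + 2^-1 * `|x - y|)); last first.
  by rewrite [`|4 * _|]ger0_norm ?mulr_ge0//; field.
rewrite ler_wpM2l// (le_trans (ler_normD _ _))// (normrM (ckern x)) (normrM (xckern y)).
by rewrite lerD// ler_pM// ?norm_xckern_le// gtr0_norm ?ckern_gt0// ckern_le1.
Qed.

Lemma ckern_tr_lipschitz : frob_lipschitz (fun S => ckern (tS S)) sig.
Proof.
have h := @wishart_tr_lipschitz R d Sigma (@ckern R) 1 ler01.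
rewrite mul1r in h; apply: h => x y; rewrite mul1r; exact: ckern_lipschitz.
Qed.

Lemma gauss_tr_odd : \int[gs]_t tr_odd (Z t) = 0.
Proof.
have [i1 i2 e] := gauss_gateaux_ibp d_gt0 Sigma_pd 1 0 Sigma ckern_tr_lipschitz (@ckern_gateaux R d Sigma).
have E t : tr_odd (Z t) = 2 * (ckern (tS (0 + 1 *: Z t)) * (2^-1 * \tr (Si *m Sigma *m Si *m Z t)))
   - 2 * (- 2 * xckern (tS (0 + 1 *: Z t)) * ckern (tS (0 + 1 *: Z t)) * tS (1 *: Sigma)).
  rewrite add0r !scale1r wishart_tr_Sigma// mulVmx// mul1mx -/(wishart_tr Sigma (Z t)) /tr_odd.
  by rewrite /xckern; field.
under eq_Rintegral do rewrite E.
by rewrite RintegralTB ?RintegralTZ ?e ?subrr//; exact: rintegrableZ.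
Qed.

Lemma gauss_tr_sqr : rintegrable gs (fun t => tS (Z t) ^+ 2) /\
  \int[gs]_t (tS (Z t) ^+ 2) = 2 * d%:R.
Proof.
have tL : frob_lipschitz (fun S => tS S) (1 * sig).
  by apply: (@wishart_tr_lipschitz R d Sigma (id)) => // x y; rewrite mul1r.
have [i1 i2 e] := gauss_gateaux_ibp d_gt0 Sigma_pd 1 0 Sigma tL (@wishart_tr_gateaux R d Sigma).
have E t : tS (Z t) ^+ 2 = 2 * (tS (0 + 1 *: Z t) * (2^-1 * \tr (Si *m Sigma *m Si *m Z t))).
  by rewrite add0r !scale1r mulVmx// mul1mx -/(wishart_tr Sigma (Z t)); field.
under eq_fun do rewrite E; split; first exact: rintegrableZ.
by rewrite RintegralTZ// -e Rintegral_gauss_cst scale1r mul1r wishart_tr_Sigma.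
Qed.

Lemma rintegrable_tr_bump_gauss : rintegrable gs (fun t => tr_bump (Z t)).
Proof. exact: rintegrable_lipschitz_gauss tr_bump_lipschitz. Qed.

(** If the mean were 0, then T would vanish almost surely, against E T^2 = 2 d. *)
Lemma gauss_tr_bump_gt0 : 0 < \int[gs]_t tr_bump (Z t).
Proof.
rewrite lt_neqAle Rintegral_ge0 ?andbT; last by move=> t _; exact: sqr_ge0.
apply/eqP => /esym I0.
have [i2 e2] := gauss_tr_sqr.
have : \int[gs]_t (tS (Z t) ^+ 2) = 0.
  apply: (Rintegral_eq0_trans (rintegrable_meas rintegrable_tr_bump_gauss)
    (rintegrable_meas i2) _ _ _ rintegrable_tr_bump_gauss I0).
  - by move=> t; exact: sqr_ge0.
  - by move=> t; exact: sqr_ge0.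
  - move=> t /eqP; rewrite sqrf_eq0 mulf_eq0 (gt_eqF (ckern_gt0 _)) orbF => /eqP ->.
    by rewrite expr0n.
by rewrite e2 => /eqP; rewrite mulf_eq0 !pnatr_eq0 /= -leqn0 leqNgt d_gt0.
Qed.

Section wishart_side.
Variables (alpha : R) (mu : probability (symmx R d) R).
Hypothesis alpha_gt0 : 0 < alpha.
Hypothesis muE : forall A : set (symmx R d), measurable A -> mu A =
  (\int[@lebesgue_symmx R d]_(X in A `&` [set X | posdefmx X])
     (wishart_pdf alpha Sigma X)%:E)%E.
Local Notation X := (std_symmx alpha Sigma).

(** For T = Sigma the cross term [sympart] (X Sigma^-1 Sigma) is X itself, so the derivative of q
    gains -2 p q T / sqrt alpha = -2 p^2 / sqrt alpha. This bias has a sign, hence cannot average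
    out. *)
Lemma wishart_tr_odd : \int[mu]_S tr_odd (X S) = - (4 / Num.sqrt alpha) * \int[mu]_S tr_bump (X S).
Proof.
have sa0 : Num.sqrt alpha != 0 by rewrite gt_eqF// sqrtr_gt0.
have gl : linear_form (fun S V => - 2 * xckern (tS S) * ckern (tS S) * tS V).
  exact: wishart_tr_linear.
have [i1 i2 e] := wishart_std_ibp d_gt0 alpha_gt0 Sigma_pd muE 1 Sigma 0
  ckern_tr_lipschitz (@ckern_gateaux R d Sigma) gl.
have ib := rintegrable_lipschitz_std d_gt0 alpha_gt0 Sigma_pd muE tr_bump_lipschitz.
have E S : tr_odd (X S) = 2 * (ckern (tS (1 *: X S + 0)) * (2^-1 * \tr (Si *m X S *m Si *m Sigma)))
   - 2 * (- 2 * xckern (tS (1 *: X S + 0)) * ckern (tS (1 *: X S + 0)) *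
      tS (1 *: Sigma + (1 / Num.sqrt alpha) *: sympart (X S *m Si *m Sigma)))
   - (4 / Num.sqrt alpha) * tr_bump (X S).
  move: (X S) => V; rewrite addr0 !scale1r !mulmxKV// sympart_id wishart_trD wishart_trZ wishart_tr_Sigma//.
  rewrite -/(wishart_tr Sigma V) /tr_odd /tr_bump /xckern.
  by move: (tS V) (Num.sqrt alpha) sa0 => x r r0; field.
under eq_Rintegral do rewrite E.
rewrite RintegralTB; [|by apply: rintegrableB; exact: rintegrableZ|exact: rintegrableZ].
rewrite RintegralTB; [|exact: rintegrableZ|exact: rintegrableZ].
by rewrite !RintegralTZ// e subrr sub0r mulNr.
Qed.

(** Let I be the Wishart mean of p(T)^2. The two gaps give m - I <= w (sig + 1) and 4 I <= (1 + 6 d)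
    (sig + 1) w sqrt alpha. Adding four times the first to the second eliminates I; with sqrt alpha
    >= 1 the constants add up to 4 + (1 + 6 d) = 5 + 6 d. *)
Lemma wishart_gap_lower (m w : R) : m = \int[gs]_t tr_bump (Z t) -> 1 <= alpha ->
  `|\int[mu]_S tr_bump (X S) - m| / (sig + 1) <= w ->
  `|\int[mu]_S tr_odd (X S) - 0| / ((1 + 6 * d%:R) * (sig + 1)) <= w ->
  4 * m / ((sig + 1) * (5 + 6 * d%:R)) / Num.sqrt alpha <= w.
Proof.
move=> mE a1; have m0 : 0 < m by rewrite mE gauss_tr_bump_gt0.
have s0 : 0 < sig + 1 by rewrite ltr_wpDl// frob_norm_ge0.
have D0 : 0 <= d%:R :> R by [].
have r1 : 1 <= Num.sqrt alpha by rewrite -[leLHS]sqrtr1 ler_sqrt// (le_trans ler01).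
have I0 : 0 <= \int[mu]_S tr_bump (X S) by apply: Rintegral_ge0 => S _; exact: sqr_ge0.
rewrite wishart_tr_odd subr0 ler_pdivrMr// ler_pdivrMr ?mulr_gt0//.
move: (\int[mu]_S _) (Num.sqrt alpha) r1 I0 => I r r1 I0 h1 h2.
have r0 : 0 < r by exact: lt_le_trans r1.
rewrite normrM normrN (ger0_norm I0) ger0_norm ?divr_ge0 ?(ltW r0)// in h2.
have h3 : m - I <= w * (sig + 1) by rewrite (le_trans _ h1)// distrC ler_norm.
rewrite mulrAC ler_pdivrMr// in h2.
rewrite ler_pdivrMr// ler_pdivrMr ?mulr_gt0//.
have w0 : 0 <= w * (sig + 1) by exact: le_trans h1.
have h4 : w * (sig + 1) <= w * (sig + 1) * r by rewrite ler_peMr.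
move: h2; rewrite !mulrA.
rewrite (_ : w * (1 + 6 * d%:R) * (sig + 1) * r = (1 + 6 * d%:R) * (w * (sig + 1) * r)); last by ring.
rewrite (_ : w * r * (sig + 1) * (5 + 6 * d%:R) = (5 + 6 * d%:R) * (w * (sig + 1) * r)); last by ring.
lra.
Qed.

End wishart_side.
End lower_bound.

Theorem proposition4p1 (R : realType) (d : nat) (d_gt0 : (0 < d)%N)
    (Sigma : symmx R d) (Sigma_pd : posdefmx Sigma) :
  (forall (alpha : R), d%:R - 1 < alpha ->
   forall (dT1 dT2 : measure_display)
     (T1 : measurableType dT1) (T2 : measurableType dT2)
     (P1 : probability T1 R) (P2 : probability T2 R)
     (W : {RV P1 >-> symmx R d}) (G : 'I_d -> 'I_d -> {RV P2 >-> R}),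
   wishart_distributed alpha Sigma P1 W -> ginibre P2 G ->
   (wasserstein
      (distribution P1 (center_scale alpha Sigma W))
      (distribution P2 (center_scale alpha Sigma (gaussian_Z alpha Sigma G)))
    <= (1 / Num.sqrt (pi * alpha) * spectral_norm (invmx Sigma) *
        Num.sqrt (((d%:R + 2) * \tr Sigma ^+ 2 + frob_norm Sigma ^+ 2) *
                  (\tr Sigma ^+ 2 + frob_norm Sigma ^+ 2)))%:E)%E) /\
  (exists c alpha0 : R, 0 < c /\
   forall (alpha : R), d%:R - 1 < alpha -> alpha0 <= alpha ->
   forall (dT1 dT2 : measure_display)
     (T1 : measurableType dT1) (T2 : measurableType dT2)
     (P1 : probability T1 R) (P2 : probability T2 R)
     (W : {RV P1 >-> symmx R d}) (G : 'I_d -> 'I_d -> {RV P2 >-> R}),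
   wishart_distributed alpha Sigma P1 W -> ginibre P2 G ->
   ((c / Num.sqrt alpha)%:E <=
    wasserstein
      (distribution P1 (center_scale alpha Sigma W))
      (distribution P2
        (center_scale alpha Sigma (gaussian_Z alpha Sigma G))))%E).
Proof.
have transfer (alpha : R) : 0 < alpha ->
    forall (dT1 dT2 : measure_display)
      (T1 : measurableType dT1) (T2 : measurableType dT2)
      (P1 : probability T1 R) (P2 : probability T2 R)
      (W : {RV P1 >-> symmx R d}) (G : 'I_d -> 'I_d -> {RV P2 >-> R}),
    wishart_distributed alpha Sigma P1 W -> ginibre P2 G ->
    forall (h : symmx R d -> R) (L : R), frob_lipschitz h L ->
    (\int[distribution P1 (center_scale alpha Sigma W)]_S (h S)%:E =
      (\int[distribution P1 W]_S h (std_symmx alpha Sigma S))%:E)%E /\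
    (\int[distribution P2 (center_scale alpha Sigma (gaussian_Z alpha Sigma G))]_S (h S)%:E =
      (\int[gauss R #|{: 'I_d * 'I_d}|]_t h (gaussmx Sigma t))%:E)%E.
  move=> a0 dT1 dT2 T1 T2 P1 P2 W G WW GG h L hL.
  have mh := measurable_lipschitz hL; split.
    by apply: integral_center_scale => //; exact: (rintegrable_lipschitz_std d_gt0 a0 Sigma_pd WW hL).
  by apply: integral_center_scale_gauss => //; exact: (rintegrable_lipschitz_gauss Sigma d_gt0 hL).
have pos (alpha : R) : d%:R - 1 < alpha -> 0 < alpha.
  by apply: le_lt_trans; rewrite subr_ge0 ler1n.
split=> [alpha da dT1 dT2 T1 T2 P1 P2 W G WW GG|].
  have a0 := pos alpha da.
  apply: wasserstein_le => h hL.
  have [e1 e2] := transfer alpha a0 _ _ _ _ _ _ _ _ WW GG h 1 hL.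
  do 2 eexists; split; [exact: e1|exact: e2|].
  (* From here on the bound is explicit: the Gaussian constant [K] of [cross_le] is s^2 A / pi, and
     pulling s and 1 / pi out of the root gives the stated form. *)
  apply: (le_trans (lipschitz_gap d_gt0 a0 Sigma_pd WW hL)).
  pose s := spectral_norm (invmx Sigma).
  pose A := (d%:R + 2) * \tr Sigma ^+ 2 + frob_norm Sigma ^+ 2.
  have s0 : 0 <= s by exact: spectral_norm_ge0.
  have A0 : 0 <= A by rewrite addr_ge0 ?sqr_ge0// mulr_ge0 ?sqr_ge0// addr_ge0.
  have K0 : 0 <= s ^+ 2 * A / pi by rewrite !mulr_ge0 ?sqr_ge0// invr_ge0 pi_ge0.
  have KV V := gauss_norm_cross_pi V d_gt0 Sigma_pd.
  have sa : 0 <= 1 / Num.sqrt alpha by rewrite divr_ge0// sqrtr_ge0.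
  apply: (le_trans (ler_wpM2l sa (cross_le d_gt0 a0 Sigma_pd WW K0 KV))).
  rewrite le_eqVlt; apply/orP; left; apply/eqP.
  rewrite -/s -/A [_ + \tr _ ^+ 2]addrC.
  rewrite (_ : s ^+ 2 * A / pi * _ = s ^+ 2 * pi^-1 * (A * (\tr Sigma ^+ 2 + frob_norm Sigma ^+ 2))); last by ring.
  rewrite sqrtrM ?mulr_ge0 ?sqr_ge0 ?invr_ge0 ?pi_ge0// sqrtrM ?sqr_ge0//.
  rewrite sqrtr_sqr (ger0_norm s0) sqrtrV ?pi_ge0// (sqrtrM alpha) ?pi_ge0//.
  by rewrite invfM; ring.
pose m := \int[gauss R #|{: 'I_d * 'I_d}|]_t tr_bump Sigma (gaussmx Sigma t).
pose sig := frob_norm (invmx (Sigma : 'M[R]_d)).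
have s0 : 0 < sig + 1 by rewrite ltr_wpDl// frob_norm_ge0.
have D0 : 0 <= 6 * d%:R :> R by rewrite mulr_ge0.
exists (4 * m / ((sig + 1) * (5 + 6 * d%:R))), 1; split.
  by rewrite divr_gt0 ?mulr_gt0// ?gauss_tr_bump_gt0//.
move=> alpha da a1 dT1 dT2 T1 T2 P1 P2 W G WW GG; have a0 := pos alpha da.
(* Dividing by any K at least the Lipschitz constant makes [f] admissible. Below sig + 1 replaces
   sig, so that K is visibly positive. *)
have scaled (f : symmx R d -> R) (L K : R) : frob_lipschitz f L -> L <= K -> 0 < K ->
    ((`|\int[distribution P1 W]_S f (std_symmx alpha Sigma S) -
     \int[gauss R #|{: 'I_d * 'I_d}|]_t f (gaussmx Sigma t)| / K)%:E <=
     wasserstein (distribution P1 (center_scale alpha Sigma W))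
      (distribution P2 (center_scale alpha Sigma (gaussian_Z alpha Sigma G))))%E.
  move=> fL LK K0.
  have hL : frob_lipschitz (fun S => K^-1 * f S) 1.
    move=> S T; rewrite -mulrBr normrM gtr0_norm ?invr_gt0// ler_pdivrMl// mul1r.
    by rewrite (le_trans (fL S T))// ler_wpM2r// frob_norm_ge0.
  have [e1 e2] := transfer alpha a0 _ _ _ _ _ _ _ _ WW GG _ 1 hL.
  have := le_wasserstein hL e1 e2.
  rewrite RintegralTZ; last exact: (rintegrable_lipschitz_std d_gt0 a0 Sigma_pd WW fL).
  rewrite RintegralTZ; last exact: (rintegrable_lipschitz_gauss Sigma d_gt0 fL).
  by rewrite -mulrBr normrM gtr0_norm ?invr_gt0// mulrC.
have w1 := scaled _ _ (sig + 1) (tr_bump_lipschitz Sigma).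
have w2 := scaled _ _ ((1 + 6 * d%:R) * (sig + 1)) (tr_odd_lipschitz Sigma).
have {}w1 := w1 ltac:(by rewrite lerDl) s0.
have K0 : 0 < 1 + 6 * d%:R :> R by rewrite ltr_pwDl.
have {}w2 := w2 ltac:(by rewrite ler_wpM2l ?(ltW K0)// lerDl) ltac:(by rewrite mulr_gt0).
rewrite (gauss_tr_odd d_gt0 Sigma_pd) in w2.
set w := wasserstein _ _ in w1 w2 *.
set x1 := _ / _ in w1; set x2 := _ / _ in w2.
(* The distance is an extended real, whereas [wishart_gap_lower] takes a real bound; the larger of
   the two gaps plays that part. *)
apply: (@le_trans _ _ (Num.max x1 x2)%:E); last first.
  by case: (leP x1 x2).
rewrite lee_fin; apply: (wishart_gap_lower d_gt0 Sigma_pd a0 WW erefl a1).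
  by rewrite le_max lexx.
by rewrite le_max lexx orbT.
Qed.
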